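(* Let $\phi:(D,J)\to(E,K)$ be a homomorphism of skew fields with involutions and assume that $D^\varepsilon$ is infinite. Let $M$ be a $-\varepsilon$-hermitian hyperbolic module over $D$ and consider the natural group monomorphism $$\Phi:\mathbf U(M)\to\mathbf U(M\otimes_\phi E).$$ Let $\mathsf m_D\in H^2(\mathbf U(M);W^\varepsilon(D,J))$ and $\mathsf m_E\in H^2(\mathbf U(M\otimes_\phi E);W^\varepsilon(E,K))$ be the Maslov classes of $M$ and $M\otimes_\phi E$. Then $$(W^D_E)_*\mathsf m_D=\Phi^*\mathsf m_E\quad\text{in } H^2(\mathbf U(M);W^\varepsilon(E,K)),$$ where $(W^D_E)_*:H^2(\mathbf U(M);W^\varepsilon(D,J))\to H^2(\mathbf U(M);W^\varepsilon(E,K))$ is induced by the coefficient map $W^D_E$ and $\Phi^*:H^2(\mathbf U(M\otimes_\phi E);W^\varepsilon(E,K))\to H^2(\mathbf U(M);W^\varepsilon(E,K))$ is the restriction map.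
   Context: A skew field with involution $(D,J)$ is a field or division ring $D$ (arbitrary characteristic) with an antiautomorphism $J$, $J^2=\mathrm{id}$ ($J=\mathrm{id}$ is allowed if $D$ is commutative). A homomorphism $(D,J)\to(E,K)$ is a ring homomorphism commuting with the involutions. $\varepsilon\in\{1,-1\}$ and $D^\varepsilon=\{a\in D\mid a-a^J\varepsilon=0\}$. Modules are finite dimensional right modules. For a matrix $a$, $a^J$ denotes the transpose with $J$ applied to all entries, and $a^{-J}=(a^J)^{-1}$. For $\delta=\pm1$, a $\delta$-hermitian form on $M$ is a biadditive map $h:M\times M\to D$ with $h(ua,vb)=a^Jh(u,v)b$ and $h(u,v)=h(v,u)^J\delta$. For a right $D$-module $X$, $X^J$ is its dual space made into a right $D$-module by $(\xi a)(v)=a^J\xi(v)$. The hyperbolic $\delta$-hermitian module on $X$ is $X\oplus X^J$ with $h_X((x,\xi),(y,\eta))=\xi(y)+\eta(x)^J\delta$; every isometric module is also called hyperbolic, of rank $\dim X$. $\mathbf U(M)$ is the isometry group. If $M$ is hyperbolic over $D$, then $M\otimes_\phi E$ with the extended form is hyperbolic over $E$. A Lagrangian is a subspace $X$ with $X=X^\perp$; two Lagrangians $X,Y$ are opposite if $X\cap Y=0$. The Witt group $W^\varepsilon(D,J)$ is the group completion of the monoid of isomorphism classes of nondegenerate $\varepsilon$-hermitian forms over $(D,J)$ modulo the subgroup generated by the $\varepsilon$-hermitian hyperbolic modules; $W^D_E:W^\varepsilon(D,J)\to W^\varepsilon(E,K)$ is the natural map given by extension of scalars along $\phi$. For a $-\varepsilon$-hermitian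 hyperbolic module $M$ of rank $n$ with form $h$ and pairwise opposite Lagrangians $X,Y,Z$, choose a basis $x_1,\dots,x_n$ of $X$ and let $y_1,\dots,y_n$ be the basis of $Y$ with $h(y_\mu,x_\nu)=\delta_{\mu\nu}$; then $Z$ has a unique basis $y_\nu+\sum_\mu x_\mu t_{\mu\nu}$ with $t$ nonsingular and $\varepsilon$-hermitian ($t=t^J\varepsilon$), and $\kappa(X,Y,Z)$ is the isomorphism class of $t$ (well defined). The opposition graph $\Gamma$ of $M$ has the Lagrangians as vertices and pairs of opposite Lagrangians as edges. $Fl(\Gamma)$ is the simplicial set whose $k$-simplices are tuples of vertices that are pairwise equal or adjacent, with $\mathbb Z$-free chain complex $C_*=C_*(Fl(\Gamma))$, and $\tilde C_*$ is its quotient complex of alternating chains $\langle x_0,\dots,x_k\rangle$ (antisymmetric in the entries, zero if two entries coincide). The Maslov cocycle is the $\mathbf U(M)$-invariant $2$-cocycle $\mathsf m:\langle X,Y,Z\rangle\mapsto[\kappa(X,Y,Z)]\in W^\varepsilon(D,J)$. For a group $G$ acting on $C_*$, a projective resolution $P_*\to\mathbb Z$ of $G$ with augmentation $\eta:P_0\to\mathbb Z$, and a coefficient group $A$ with trivial action, $H^*_G(C_*;A)$ is the cohomology of $\mathrm{Hom}_{\mathbb Z}(P_*\otimes_GC_*,A)$; a $G$-invariant cochain $c$ on $C_*$ is viewed as the cochain $p\otimes z\mapsto\eta(p)c(z)$ on $P_0\otimes_G C_*$ (zero on the other components). If $D^\varepsilon$ is infinite, $Fl(\Gamma)$ is acyclic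 and the constant map $Fl(\Gamma)\to pt$ induces an isomorphism $H^*(\mathbf U(M);A)\cong H^*_{\mathbf U(M)}(Fl(\Gamma);A)$; via this isomorphism the Maslov cocycle defines the Maslov class in $H^2(\mathbf U(M);W^\varepsilon(D,J))$. *)

(* Defs.v *)
From HB Require Import structures.
From mathcomp Require Import all_boot all_order all_algebra.
From mathcomp Require Import zify.
From mathcomp Require Import boolp classical_sets functions cardinality.

Set Implicit Arguments.
Unset Strict Implicit.
Unset Printing Implicit Defensive.

Import GRing.Theory.
Local Open Scope ring_scope.
Local Open Scope quotient_scope.

HB.mixin Record isInvSkewField D of GRing.UnitRing D := {
  skew_unit : forall x : D, x != 0 -> x \is a GRing.unit;
  invo : D -> D;
  invoD : {morph invo : x y / x + y};
  invoM : forall x y, invo (x * y) = invo y * invo x;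
  invoK : involutive invo }.

#[short(type="invSkewFieldType")]
HB.structure Definition InvSkewField :=
  {D of isInvSkewField D & GRing.UnitRing D}.

Record invMorph (D E : invSkewFieldType) := InvMorph {
  im_fun :> {rmorphism D -> E};
  im_invo : forall a, im_fun (invo a) = invo (im_fun a) }.

Section InvoTheory.
Variable D : invSkewFieldType.
Implicit Types a b : D.

Lemma invo0 : invo (0 : D) = 0.
Proof. by apply: (addrI (invo 0)); rewrite -invoD !addr0. Qed.

Lemma invoN a : invo (- a) = - invo a.
Proof. by apply: (addrI (invo a)); rewrite -invoD !subrr invo0. Qed.

Lemma invo1 : invo (1 : D) = 1.
Proof. by have := invoM (invo 1) (1 : D); rewrite mulr1 !invoK mulr1 => <-. Qed.

Lemma invo_sum I (r : seq I) (P : pred I) (F : I -> D) :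
  invo (\sum_(i <- r | P i) F i) = \sum_(i <- r | P i) invo (F i).
Proof. exact: (big_morph _ (@invoD D) invo0). Qed.

Lemma invo_sign (s : bool) : invo ((-1) ^+ s : D) = (-1) ^+ s.
Proof. by case: s; rewrite ?expr1 ?expr0 ?invoN invo1. Qed.

Lemma sign_comm (s : bool) a : a * (-1) ^+ s = (-1) ^+ s * a.
Proof. by case: s; rewrite ?expr1 ?expr0 ?mulrN ?mulNr ?mulr1 ?mul1r. Qed.

End InvoTheory.

(* A right D-module is a left module over the converse ring D^c. *)
Definition rscale (D : invSkewFieldType) (M : lmodType D^c) (v : M) (a : D) : M :=
  (a : D^c) *: v.
Notation "v ** a" := (rscale v a) (at level 40, left associativity) : ring_scope.

Section RightModule.
Variables (D : invSkewFieldType) (M : lmodType D^c).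
Implicit Types (u v : M) (a b : D).

Lemma rscaleDl u v a : (u + v) ** a = u ** a + v ** a.
Proof. exact: scalerDr. Qed.

Lemma rscaleDr v a b : v ** (a + b) = v ** a + v ** b.
Proof. exact: scalerDl. Qed.

Lemma rscaleA v a b : v ** a ** b = v ** (a * b).
Proof. exact: scalerA. Qed.

Lemma rscale1 v : v ** 1 = v.
Proof. exact: scale1r. Qed.

End RightModule.

(* In all that follows a sign delta is a boolean s, standing for
   delta = (-1) ^+ s; hence - delta is ~~ s. *)
Record hermMod (D : invSkewFieldType) (s : bool) := HermMod {
  hm_mod :> lmodType D^c;
  form : hm_mod -> hm_mod -> D;
  formDl : forall u v w, form (u + v) w = form u w + form v w;
  formDr : forall u v w, form u (v + w) = form u v + form u w;
  formZ : forall u v a b, form (u ** a) (v ** b) = invo a * form u v * b;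
  formC : forall u v, form u v = invo (form v u) * (-1) ^+ s }.

Definition isometric (D : invSkewFieldType) (s : bool) (M N : hermMod D s) :=
  exists f : {linear M -> N},
    bijective f /\ forall u v, form (f u) (f v) = form u v.

Section DualModule.
Variables (D : invSkewFieldType) (X : lmodType D^c).

Record dualJ := DualJ {
  dfun :> X -> D;
  dfunD : forall u v, dfun (u + v) = dfun u + dfun v;
  dfunZ : forall v a, dfun (v ** a) = dfun v * a }.

HB.instance Definition _ := gen_eqMixin dualJ.
HB.instance Definition _ := gen_choiceMixin dualJ.

Lemma dualJP (xi eta : dualJ) : (forall v, xi v = eta v) -> xi = eta.
Proof.
case: xi eta => [f fD fZ] [g gD gZ] /= /funext fg; subst g.
by congr DualJ; exact: Prop_irrelevance.
Qed.

Program Definition dual0 := @DualJ (fun=> 0) _ _.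
Next Obligation. by rewrite addr0. Qed.
Next Obligation. by rewrite mul0r. Qed.

Program Definition dualN (xi : dualJ) := @DualJ (fun v => - xi v) _ _.
Next Obligation. by rewrite dfunD opprD. Qed.
Next Obligation. by rewrite dfunZ mulNr. Qed.

Program Definition dualD (xi eta : dualJ) := @DualJ (fun v => xi v + eta v) _ _.
Next Obligation. by rewrite !dfunD addrACA. Qed.
Next Obligation. by rewrite !dfunZ mulrDl. Qed.

Program Definition dualZ (a : D^c) (xi : dualJ) :=
  @DualJ (fun v => invo (a : D) * xi v) _ _.
Next Obligation. by rewrite dfunD mulrDr. Qed.
Next Obligation. by rewrite dfunZ mulrA. Qed.

Fact dualDA : associative dualD.
Proof. by move=> x y z; apply: dualJP => v /=; rewrite addrA. Qed.
Fact dualDC : commutative dualD.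
Proof. by move=> x y; apply: dualJP => v /=; rewrite addrC. Qed.
Fact dual0D : left_id dual0 dualD.
Proof. by move=> x; apply: dualJP => v /=; rewrite add0r. Qed.
Fact dualND : left_inverse dual0 dualN dualD.
Proof. by move=> x; apply: dualJP => v /=; rewrite addNr. Qed.

HB.instance Definition _ := GRing.isZmodule.Build dualJ dualDA dualDC dual0D dualND.

Fact dualZA (a b : D^c) (xi : dualJ) : dualZ a (dualZ b xi) = dualZ (a * b) xi.
Proof. by apply: dualJP => v /=; rewrite mulrA -invoM. Qed.
Fact dual1Z : left_id 1 dualZ.
Proof. by move=> x; apply: dualJP => v /=; rewrite [invo _]invo1 mul1r. Qed.
Fact dualZDr : right_distributive dualZ +%R.
Proof. by move=> a x y; apply: dualJP => v /=; rewrite mulrDr. Qed.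
Fact dualZDl (xi : dualJ) : {morph dualZ^~ xi : a b / a + b}.
Proof. by move=> a b; apply: dualJP => v /=; rewrite invoD mulrDl. Qed.

HB.instance Definition _ :=
  GRing.Zmodule_isLmodule.Build D^c dualJ dualZA dual1Z dualZDr dualZDl.

End DualModule.

Section HyperbolicModule.
Variables (D : invSkewFieldType) (s : bool).

Section OnX.
Variable X : lmodType D^c.

Definition hyp_form (p q : X * dualJ X) : D :=
  p.2 q.1 + invo (q.2 p.1) * (-1) ^+ s.

Fact hyp_formDl u v w : hyp_form (u + v) w = hyp_form u w + hyp_form v w.
Proof. by rewrite /hyp_form /= dfunD invoD mulrDl addrACA. Qed.

Fact hyp_formDr u v w : hyp_form u (v + w) = hyp_form u v + hyp_form u w.
Proof. by rewrite /hyp_form /= dfunD invoD mulrDl addrACA. Qed.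

Fact hyp_formZ u v a b :
  hyp_form (u ** a) (v ** b) = invo a * hyp_form u v * b.
Proof.
rewrite /hyp_form /= !dfunZ invoM invoM invoK.
by rewrite mulrDr mulrDl !mulrA -!(mulrA _ b) (sign_comm s b) !mulrA.
Qed.

Fact hyp_formC u v : hyp_form u v = invo (hyp_form v u) * (-1) ^+ s.
Proof.
rewrite /hyp_form invoD invoM invo_sign invoK -sign_comm mulrDl addrC.
by rewrite -mulrA -expr2 sqrr_sign mulr1.
Qed.

Definition hyp_mod : hermMod D s :=
  @HermMod D s (X * dualJ X)%type hyp_form hyp_formDl hyp_formDr hyp_formZ hyp_formC.

End OnX.

Definition hyperbolic (M : hermMod D s) :=
  exists X : vectType D^c, isometric (hyp_mod X) M.

End HyperbolicModule.

Section IsometryGroup.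
Variables (D : invSkewFieldType) (s : bool) (M : hermMod D s).

Record unitary := Unitary {
  ufun :> M -> M;
  uinv : M -> M;
  ufunK : cancel ufun uinv;
  uinvK : cancel uinv ufun;
  ufunD : forall u v, ufun (u + v) = ufun u + ufun v;
  ufunZ : forall v a, ufun (v ** a) = ufun v ** a;
  ufun_form : forall u v, form (ufun u) (ufun v) = form u v }.

HB.instance Definition _ := gen_eqMixin unitary.
HB.instance Definition _ := gen_choiceMixin unitary.

Lemma unitaryP (g h : unitary) : (forall v, g v = h v) -> g = h.
Proof.
move=> gh; have gi : uinv g = uinv h.
  by apply/funext => v; rewrite -{1}(uinvK h v) -gh ufunK.
case: g h gh gi => [f f' ? ? ? ? ?] [g g' ? ? ? ? ?] /= /funext fg gi.
subst g g'; congr Unitary; exact: Prop_irrelevance.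
Qed.

Definition unitary1 := @Unitary id id (fun=> erefl) (fun=> erefl)
  (fun _ _ => erefl) (fun _ _ => erefl) (fun _ _ => erefl).

Program Definition unitaryV (g : unitary) := @Unitary (uinv g) g _ _ _ _ _.
Next Obligation. by move=> v; rewrite uinvK. Qed.
Next Obligation. by move=> v; rewrite ufunK. Qed.
Next Obligation. by apply: (can_inj (ufunK g)); rewrite ufunD !uinvK. Qed.
Next Obligation. by apply: (can_inj (ufunK g)); rewrite ufunZ !uinvK. Qed.
Next Obligation. by rewrite -(ufun_form g) !uinvK. Qed.

Program Definition unitaryM (g h : unitary) := @Unitary (g \o h) (uinv h \o uinv g) _ _ _ _ _.
Next Obligation. by move=> v /=; rewrite !ufunK. Qed.
Next Obligation. by move=> v /=; rewrite !uinvK. Qed.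
Next Obligation. by rewrite !ufunD. Qed.
Next Obligation. by rewrite !ufunZ. Qed.
Next Obligation. by rewrite !ufun_form. Qed.

Fact unitaryMA : associative unitaryM. Proof. by move=> g h k; apply: unitaryP. Qed.
Fact unitary1M : left_id unitary1 unitaryM. Proof. by move=> g; apply: unitaryP. Qed.
Fact unitaryM1 : right_id unitary1 unitaryM. Proof. by move=> g; apply: unitaryP. Qed.
Fact unitaryVM : left_inverse unitary1 unitaryV unitaryM.
Proof. by move=> g; apply: unitaryP => v /=; rewrite ufunK. Qed.
Fact unitaryMV : right_inverse unitary1 unitaryV unitaryM.
Proof. by move=> g; apply: unitaryP => v /=; rewrite uinvK. Qed.

HB.instance Definition _ := isGroup.Build unitary unitaryMA unitary1M unitaryM1 unitaryVM unitaryMV.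

Lemma unitaryME (g h : unitary) v : (g * h)%g v = g (h v). Proof. by []. Qed.
Lemma unitary1E v : (1%g : unitary) v = v. Proof. by []. Qed.

End IsometryGroup.

Notation "''U' ( M )" := (unitary M) (at level 0, format "''U' ( M )") : type_scope.

Section GroupCompletion.
Variable N : nmodType.

Definition gc_rel : rel (N * N) :=
  fun p q => `[< exists k, p.1 + q.2 + k = q.1 + p.2 + k >].

Lemma gc_refl : reflexive gc_rel.
Proof. by move=> p; apply/asboolP; exists 0. Qed.

Lemma gc_sym : symmetric gc_rel.
Proof. by move=> p q; apply/asboolP/asboolP => -[k e]; exists k. Qed.

Lemma gc_trans : transitive gc_rel.
Proof.
move=> q p r /asboolP[k e] /asboolP[l f]; apply/asboolP.
exists (q.1 + q.2 + k + l).
rewrite [LHS](AC (2*4) ((1*4*5)*(3*2*6)))/= e f.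
by rewrite [LHS](AC (3*3) ((4*2)*(1*5*3*6))).
Qed.

Canonical gc_equiv := EquivRel gc_rel gc_refl gc_sym gc_trans.

Definition completion := {eq_quot gc_rel}.
HB.instance Definition _ := EqQuotient.on completion.
HB.instance Definition _ := Choice.on completion.

(* [gc_diff a b] is the formal difference a - b. *)
Definition gc_diff (a b : N) : completion := \pi_completion (a, b).

Lemma gc_diffP a b c d :
  gc_diff a b = gc_diff c d <-> exists k, a + d + k = c + b + k.
Proof.
split=> [/eqP|h]; first by rewrite /gc_diff piE => /asboolP.
by apply/eqP; rewrite /gc_diff piE; apply/asboolP.
Qed.

Lemma gc_diff_ind (P : completion -> Prop) :
  (forall a b, P (gc_diff a b)) -> forall x, P x.
Proof. by move=> H x; rewrite -[x]reprK; case: (repr x). Qed.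

Definition gc_add (x y : completion) :=
  gc_diff ((repr x).1 + (repr y).1) ((repr x).2 + (repr y).2).
Definition gc_opp (x : completion) := gc_diff (repr x).2 (repr x).1.

Lemma gc_reprP a b :
  exists k, (repr (gc_diff a b)).1 + b + k = a + (repr (gc_diff a b)).2 + k.
Proof. by apply/gc_diffP; rewrite -[RHS]reprK; case: (repr (gc_diff a b)). Qed.

Lemma gc_addE a b c d :
  gc_add (gc_diff a b) (gc_diff c d) = gc_diff (a + c) (b + d).
Proof.
have [k e] := gc_reprP a b; have [l f] := gc_reprP c d.
apply/gc_diffP; exists (k + l).
rewrite (addrACA _ _ b) (addrACA a c) addrACA e f.
by rewrite addrACA.
Qed.

Lemma gc_oppE a b : gc_opp (gc_diff a b) = gc_diff b a.
Proof.
have [k e] := gc_reprP a b; apply/gc_diffP; exists k.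
by rewrite addrC (addrC _ a) -[LHS]addrC -e [in RHS](addrC b).
Qed.

Fact gc_addA : associative gc_add.
Proof.
elim/gc_diff_ind => a b; elim/gc_diff_ind => c d; elim/gc_diff_ind => e f.
by rewrite !gc_addE !addrA.
Qed.
Fact gc_addC : commutative gc_add.
Proof.
elim/gc_diff_ind => a b; elim/gc_diff_ind => c d.
by rewrite !gc_addE (addrC a) (addrC b).
Qed.
Fact gc_add0 : left_id (gc_diff 0 0) gc_add.
Proof. by elim/gc_diff_ind => a b; rewrite gc_addE !add0r. Qed.
Fact gc_addN : left_inverse (gc_diff 0 0) gc_opp gc_add.
Proof.
elim/gc_diff_ind => a b; rewrite gc_oppE gc_addE.
by apply/gc_diffP; exists 0; rewrite !addr0 add0r addrC.
Qed.

HB.instance Definition _ :=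
  GRing.isZmodule.Build completion gc_addA gc_addC gc_add0 gc_addN.

Lemma gc_diffD a b c d :
  gc_diff a b + gc_diff c d = gc_diff (a + c) (b + d).
Proof. exact: gc_addE. Qed.

Lemma gc_diffN a b : - gc_diff a b = gc_diff b a.
Proof. exact: gc_oppE. Qed.

End GroupCompletion.

Section CompletionMap.
Variables (N N' : nmodType) (f : {additive N -> N'}).

Definition gc_map (x : completion N) : completion N' :=
  gc_diff (f (repr x).1) (f (repr x).2).

Lemma gc_mapE a b : gc_map (gc_diff a b) = gc_diff (f a) (f b).
Proof.
have [k e] := gc_reprP a b; apply/gc_diffP; exists (f k).
by rewrite -!raddfD e.
Qed.

Fact gc_map_additive : zmod_morphism gc_map.
Proof.
elim/gc_diff_ind => a b; elim/gc_diff_ind => c d.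
by rewrite gc_diffN gc_diffD !gc_mapE gc_diffN gc_diffD !raddfD.
Qed.

HB.instance Definition _ :=
  GRing.isZmodMorphism.Build (completion N) (completion N') gc_map gc_map_additive.

End CompletionMap.

Section GeneratedSubgroup.
Variables (V : zmodType) (S : set V).

Definition gen_sub : {pred V} := fun x =>
  `[< forall P : set V, P 0 -> (forall u v, P u -> P v -> P (u - v)) ->
        (S `<=` P)%classic -> P x >].

Lemma gen_sub_closed : zmod_closed gen_sub.
Proof.
split=> [|u v /asboolP uS /asboolP vS]; apply/asboolP => // P P0 PB SP.
by apply: (PB); [exact: uS | exact: vS].
Qed.

HB.instance Definition _ := GRing.isZmodClosed.Build V gen_sub gen_sub_closed.

Lemma gen_sub_gen x : S x -> x \in gen_sub.
Proof. by move=> Sx; apply/asboolP => P _ _; apply. Qed.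

End GeneratedSubgroup.

Lemma quot_piP (V : zmodType) (I : zmodClosed V) (x y : V) :
  \pi_(Quotient.quot I) x = \pi_(Quotient.quot I) y <-> x - y \in I.
Proof.
split=> [/eqP|xy]; last apply/eqP; first by rewrite -Quotient.idealrBE.
by rewrite -Quotient.idealrBE.
Qed.

Section QuotientMap.
Variables (V V' : zmodType) (I : zmodClosed V) (I' : zmodClosed V').
Variable f : {additive V -> V'}.

Definition quot_map (x : Quotient.quot I) : Quotient.quot I' :=
  \pi_(Quotient.quot I') (f (repr x)).

Hypothesis fI : forall x, x \in I -> f x \in I'.

Lemma quot_mapE x : quot_map (\pi_(Quotient.quot I) x) = \pi_(Quotient.quot I') (f x).
Proof. by apply/quot_piP; rewrite -raddfB fI //; apply/quot_piP; rewrite reprK. Qed.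

Lemma quot_map_additive : zmod_morphism quot_map.
Proof.
move=> x y; rewrite -[x]reprK -[y]reprK -(raddfB \pi_(Quotient.quot I)).
by rewrite !quot_mapE !raddfB.
Qed.

End QuotientMap.

Section MatrixInvo.
Variable D : invSkewFieldType.

(* a^J for a matrix a *)
Definition adjmx m n (a : 'M[D]_(m, n)) : 'M[D]_(n, m) := (map_mx invo a)^T.

Lemma adjmxM m n p (a : 'M[D]_(m, n)) (b : 'M[D]_(n, p)) :
  adjmx (a *m b) = adjmx b *m adjmx a.
Proof.
apply/matrixP => i j; rewrite !mxE invo_sum; apply: eq_bigr => k _.
by rewrite invoM !mxE.
Qed.

Lemma adjmxK m n (a : 'M[D]_(m, n)) : adjmx (adjmx a) = a.
Proof. by apply/matrixP => i j; rewrite !mxE invoK. Qed.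

Lemma adjmx1 n : adjmx (1%:M : 'M[D]_n) = 1%:M.
Proof.
apply/matrixP => i j; rewrite !mxE eq_sym.
by case: (i == j); rewrite ?invo1 ?invo0.
Qed.

Lemma adjmx0 m n : adjmx (0 : 'M[D]_(m, n)) = 0.
Proof. by apply/matrixP => i j; rewrite !mxE invo0. Qed.

Lemma adjmx_block m1 m2 n1 n2 (a : 'M[D]_(m1, n1)) (b : 'M[D]_(m1, n2))
    (c : 'M[D]_(m2, n1)) (d : 'M[D]_(m2, n2)) :
  adjmx (block_mx a b c d) = block_mx (adjmx a) (adjmx c) (adjmx b) (adjmx d).
Proof. by rewrite /adjmx map_block_mx tr_block_mx. Qed.

End MatrixInvo.

(* [unitmx] is only available over commutative rings. *)
Definition invertible (R : pzRingType) m n (a : 'M[R]_(m, n)) :=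
  exists b : 'M[R]_(n, m), a *m b = 1%:M /\ b *m a = 1%:M.

Section Forms.
Variables (D : invSkewFieldType) (eps : bool).

Definition herm_mx n (t : 'M[D]_n) : Prop :=
  t = map_mx (fun a => a * (-1) ^+ eps) (adjmx t).

(* A nondegenerate eps-hermitian form on the right module D^n of columns, given
   by its Gram matrix t: the form is (u, v) |-> u^J t v. Since every finite
   dimensional right module is free, these represent all isomorphism classes. *)
Record nform := NForm {
  rk : nat;
  gram : 'M[D]_rk;
  gram_herm : herm_mx gram;
  gram_inv : invertible gram }.

HB.instance Definition _ := gen_eqMixin nform.
HB.instance Definition _ := gen_choiceMixin nform.

Definition congruent m n (s : 'M[D]_m) (t : 'M[D]_n) :=
  exists a : 'M[D]_(m, n), invertible a /\ adjmx a *m s *m a = t.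

Definition nform_iso : rel nform := fun q r => `[< congruent (gram q) (gram r) >].

Lemma invertibleM m n p (a : 'M[D]_(m, n)) (b : 'M[D]_(n, p)) :
  invertible a -> invertible b -> invertible (a *m b).
Proof.
move=> [a' [aa' a'a]] [b' [bb' b'b]]; exists (b' *m a'); split.
  by rewrite -mulmxA (mulmxA b) bb' mul1mx.
by rewrite -mulmxA (mulmxA a') a'a mul1mx.
Qed.

Lemma congruent_refl n (t : 'M[D]_n) : congruent t t.
Proof.
exists 1%:M; rewrite adjmx1 mul1mx mulmx1; split=> //.
by exists 1%:M; rewrite mulmx1.
Qed.

Lemma congruent_sym m n (s : 'M[D]_m) (t : 'M[D]_n) :
  congruent s t -> congruent t s.
Proof.
move=> [a [[b [ab ba]] <-]]; exists b; split; first by exists a.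
by rewrite !mulmxA -adjmxM ab adjmx1 mul1mx -mulmxA ab mulmx1.
Qed.

Lemma congruent_trans m n p (s : 'M[D]_m) (t : 'M[D]_n) (u : 'M[D]_p) :
  congruent s t -> congruent t u -> congruent s u.
Proof.
move=> [a [ia <-]] [b [ib <-]]; exists (a *m b); split; first exact: invertibleM.
by rewrite adjmxM !mulmxA.
Qed.

Lemma nform_iso_refl : reflexive nform_iso.
Proof. by move=> q; apply/asboolP; exact: congruent_refl. Qed.
Lemma nform_iso_sym : symmetric nform_iso.
Proof. by move=> q r; apply/asboolP/asboolP => /congruent_sym. Qed.
Lemma nform_iso_trans : transitive nform_iso.
Proof.
move=> r q p /asboolP qr /asboolP rp; apply/asboolP.
exact: congruent_trans qr rp.
Qed.

Canonical nform_equiv := EquivRel nform_iso nform_iso_refl nform_iso_sym nform_iso_trans.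

Definition isoclass := {eq_quot nform_iso}.
HB.instance Definition _ := EqQuotient.on isoclass.
HB.instance Definition _ := Choice.on isoclass.

Definition class_of (q : nform) : isoclass := \pi_isoclass q.

Lemma class_ofP q r : class_of q = class_of r <-> congruent (gram q) (gram r).
Proof.
split=> [/eqP|h]; first by rewrite /class_of piE => /asboolP.
by apply/eqP; rewrite /class_of piE; apply/asboolP.
Qed.

Lemma class_of_ind (P : isoclass -> Prop) :
  (forall q, P (class_of q)) -> forall x, P x.
Proof. by move=> H x; rewrite -[x]reprK. Qed.

Lemma class_of_repr q : congruent (gram (repr (class_of q))) (gram q).
Proof. by apply/class_ofP; rewrite /class_of reprK. Qed.

Fact hermitian_block m n (s : 'M[D]_m) (t : 'M[D]_n) :
  herm_mx s -> herm_mx t -> herm_mx (block_mx s 0 0 t).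
Proof.
rewrite /herm_mx => {1}-> {1}->; rewrite adjmx_block map_block_mx !adjmx0.
by congr block_mx; apply/matrixP => i j; rewrite !mxE mul0r.
Qed.

Fact invertible_block m1 m2 n1 n2 (s : 'M[D]_(m1, n1)) (t : 'M[D]_(m2, n2)) :
  invertible s -> invertible t -> invertible (block_mx s 0 0 t).
Proof.
move=> [s' [ss' s's]] [t' [tt' t't]]; exists (block_mx s' 0 0 t').
rewrite !mulmx_block !mulmx0 !mul0mx !addr0 !add0r ss' s's tt' t't.
by rewrite -!scalar_mx_block.
Qed.

Definition nform_add (q r : nform) : nform :=
  NForm (hermitian_block (gram_herm q) (gram_herm r))
        (invertible_block (gram_inv q) (gram_inv r)).

Fact hermitian_0 : herm_mx (0 : 'M[D]_0).
Proof. by apply/matrixP => -[]. Qed.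
Fact invertible_0 : invertible (0 : 'M[D]_0).
Proof. by exists 0; split; apply/matrixP => -[]. Qed.

Definition nform0 : nform := NForm hermitian_0 invertible_0.

Lemma congruent_block m1 m2 n1 n2 (s1 : 'M[D]_m1) (t1 : 'M[D]_n1)
    (s2 : 'M[D]_m2) (t2 : 'M[D]_n2) :
  congruent s1 t1 -> congruent s2 t2 ->
  congruent (block_mx s1 0 0 s2) (block_mx t1 0 0 t2).
Proof.
move=> [a [ia <-]] [b [ib <-]]; exists (block_mx a 0 0 b).
split; first exact: invertible_block.
by rewrite adjmx_block !adjmx0 !mulmx_block
  ?(mulmx0, mul0mx, addr0, add0r).
Qed.

Lemma congruent_cast m n (e : m = n) (t : 'M[D]_m) : congruent t (castmx (e, e) t).
Proof. by case: n / e; rewrite castmx_id; exact: congruent_refl. Qed.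

Definition iso_add (x y : isoclass) := class_of (nform_add (repr x) (repr y)).

Lemma iso_addE q r : iso_add (class_of q) (class_of r) = class_of (nform_add q r).
Proof. by apply/class_ofP; apply: congruent_block; exact: class_of_repr. Qed.

Fact iso_addA : associative iso_add.
Proof.
elim/class_of_ind => p; elim/class_of_ind => q; elim/class_of_ind => r.
rewrite !iso_addE; apply/class_ofP => /=.
have := congruent_cast (addnA (rk p) (rk q) (rk r))
  (block_mx (gram p) 0 0 (block_mx (gram q) 0 0 (gram r))).
rewrite (_ : castmx _ _ = block_mx (block_mx (gram p) 0 0 (gram q)) 0 0 (gram r)) //.
rewrite -[in LHS]row_mx0 -[in LHS]col_mx0 block_mxA.
by rewrite castmx_comp castmx_id row_mx0 col_mx0.
Qed.

Fact iso_addC : commutative iso_add.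
Proof.
elim/class_of_ind => q; elim/class_of_ind => r.
rewrite !iso_addE; apply/class_ofP => /=.
exists (block_mx 0 1%:M 1%:M 0); split.
  exists (block_mx 0 1%:M 1%:M 0).
  by rewrite !mulmx_block !(mulmx0, mul0mx, addr0, add0r, mulmx1) -!scalar_mx_block.
by rewrite adjmx_block !adjmx0 !adjmx1 !mulmx_block
  !(mulmx0, mul0mx, addr0, add0r, mul1mx, mulmx1).
Qed.

Fact iso_add0 : left_id (class_of nform0) iso_add.
Proof.
elim/class_of_ind => q; rewrite iso_addE; apply/class_ofP => /=.
rewrite (_ : block_mx _ _ _ _ = gram q :> 'M_(0 + rk q)); first exact: congruent_refl.
rewrite -[RHS](@submxK _ 0 _ 0 _ (gram q)); congr block_mx.
- by rewrite [RHS]flatmx0.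
- by rewrite [RHS]flatmx0.
- by rewrite [RHS]thinmx0.
- by apply/matrixP => i j; rewrite !mxE; congr (gram q _ _); exact: val_inj.
Qed.

HB.instance Definition _ := GRing.isNmodule.Build isoclass iso_addA iso_addC iso_add0.

Lemma class_ofD q r : class_of (nform_add q r) = class_of q + class_of r.
Proof. by rewrite -[RHS]/(iso_add _ _) iso_addE. Qed.

(* The Gram matrix of the form h_X of [hyp_form], for X = D^r, in the basis of X + X^J
   formed by the standard basis of D^r and its dual basis. *)
Definition hyp_gram r : 'M[D]_(r + r) := block_mx 0 ((-1) ^+ eps)%:M 1%:M 0.

Definition hyp_class : set (completion isoclass) :=
  [set x | exists (q : nform) r,
     congruent (hyp_gram r) (gram q) /\ x = gc_diff (class_of q) 0]%classic.

Definition Witt := Quotient.quot (gen_sub hyp_class).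
HB.instance Definition _ := GRing.Zmodule.on Witt.

Definition Witt_class (k : isoclass) : Witt := \pi_Witt (gc_diff k 0).

End Forms.

Section WittExt.
Variables (D E : invSkewFieldType) (phi : invMorph D E) (eps : bool).

Lemma map_adjmx m n (a : 'M[D]_(m, n)) : map_mx phi (adjmx a) = adjmx (map_mx phi a).
Proof. by apply/matrixP => i j; rewrite !mxE im_invo. Qed.

Fact map_hermitian n (t : 'M[D]_n) : herm_mx eps t -> herm_mx eps (map_mx phi t).
Proof.
rewrite /herm_mx => {1}->; apply/matrixP => i j.
by rewrite !mxE rmorphM im_invo rmorph_sign.
Qed.

Fact map_invertible m n (a : 'M[D]_(m, n)) :
  invertible a -> invertible (map_mx phi a).
Proof.
move=> [b [ab ba]]; exists (map_mx phi b).
by rewrite -!map_mxM ab ba !map_mx1.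
Qed.

Definition nform_map (q : nform D eps) : nform E eps :=
  NForm (map_hermitian (gram_herm q)) (map_invertible (gram_inv q)).

Lemma map_congruent m n (s : 'M[D]_m) (t : 'M[D]_n) :
  congruent s t -> congruent (map_mx phi s) (map_mx phi t).
Proof.
move=> [a [ia <-]]; exists (map_mx phi a); split; first exact: map_invertible.
by rewrite !map_mxM map_adjmx.
Qed.

Definition iso_map (x : isoclass D eps) : isoclass E eps := class_of (nform_map (repr x)).

Lemma iso_mapE q : iso_map (class_of q) = class_of (nform_map q).
Proof. by apply/class_ofP; apply: map_congruent; exact: class_of_repr. Qed.

Fact iso_map_additive : nmod_morphism iso_map.
Proof.
split=> [|].
  have -> : 0 = class_of (nform0 D eps) by [].
  have -> : 0 = class_of (nform0 E eps) by [].
  rewrite iso_mapE; apply/class_ofP => /=.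
  by rewrite map_mx0; exact: congruent_refl.
elim/class_of_ind => q; elim/class_of_ind => r.
rewrite -class_ofD !iso_mapE -class_ofD; apply/class_ofP => /=.
by rewrite map_block_mx !map_mx0; exact: congruent_refl.
Qed.

HB.instance Definition _ := GRing.isNmodMorphism.Build
  (isoclass D eps) (isoclass E eps) iso_map iso_map_additive.

Fact iso_map_hyp x :
  x \in gen_sub (@hyp_class D eps) -> gc_map iso_map x \in gen_sub (@hyp_class E eps).
Proof.
move=> /asboolP/(_ [set y | gc_map iso_map y \in gen_sub (@hyp_class E eps)]%classic).
apply => /= [|u v uS vS|y [q [r [qr ->]]]].
- by rewrite raddf0 rpred0.
- by rewrite raddfB rpredB.
apply: gen_sub_gen; exists (nform_map q), r; split.
  have := map_congruent qr.
  by rewrite map_block_mx !map_mx0 map_mx1 map_scalar_mx /= rmorph_sign.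
by rewrite gc_mapE raddf0 /= iso_mapE.
Qed.

Definition Witt_ext (x : Witt D eps) : Witt E eps :=
  quot_map (gen_sub (@hyp_class E eps)) (gc_map iso_map) x.

HB.instance Definition _ := GRing.isZmodMorphism.Build (Witt D eps) (Witt E eps)
  Witt_ext (quot_map_additive iso_map_hyp).

Lemma Witt_ext_class k : Witt_ext (Witt_class k) = Witt_class (iso_map k).
Proof.
by rewrite /Witt_ext /Witt_class (quot_mapE iso_map_hyp) /= gc_mapE raddf0.
Qed.

End WittExt.

Arguments Witt_ext {D E} phi eps x.

Section Tensor.
Variables (D E : invSkewFieldType) (phi : invMorph D E) (M : lmodType D^c).

(* The list [:: (m_1, e_1); ...; (m_k, e_k)] stands for the formal sum
   m_1 (x) e_1 + ... + m_k (x) e_k.  No formal opposites are needed, because of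
   m (x) e + (- m) (x) e = 0 (x) e. *)
Inductive tens_rel : seq (M * E) -> seq (M * E) -> Prop :=
| tr_refl s : tens_rel s s
| tr_sym s t : tens_rel s t -> tens_rel t s
| tr_trans s t u : tens_rel s t -> tens_rel t u -> tens_rel s u
| tr_cat s s' t t' : tens_rel s s' -> tens_rel t t' -> tens_rel (s ++ t) (s' ++ t')
| tr_catC s t : tens_rel (s ++ t) (t ++ s)
| tr_0l e : tens_rel [:: (0, e)] [::]
| tr_Dl m m' e : tens_rel [:: (m + m', e)] [:: (m, e); (m', e)]
| tr_Dr m e e' : tens_rel [:: (m, e + e')] [:: (m, e); (m, e')]
| tr_bal m a e : tens_rel [:: (m ** a, e)] [:: (m, phi a * e)].

Definition tens_eq : rel (seq (M * E)) := fun s t => `[< tens_rel s t >].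

Lemma tens_eq_refl : reflexive tens_eq.
Proof. by move=> s; apply/asboolP; exact: tr_refl. Qed.
Lemma tens_eq_sym : symmetric tens_eq.
Proof. by move=> s t; apply/asboolP/asboolP; exact: tr_sym. Qed.
Lemma tens_eq_trans : transitive tens_eq.
Proof. by move=> t s u /asboolP st /asboolP tu; apply/asboolP; exact: tr_trans st tu. Qed.

Canonical tens_equiv := EquivRel tens_eq tens_eq_refl tens_eq_sym tens_eq_trans.

Definition tensor := {eq_quot tens_eq}.
HB.instance Definition _ := EqQuotient.on tensor.
HB.instance Definition _ := Choice.on tensor.

Definition tens_sum (s : seq (M * E)) : tensor := \pi_tensor s.
Definition tens (m : M) (e : E) : tensor := tens_sum [:: (m, e)].

Lemma tens_sumP s t : tens_sum s = tens_sum t <-> tens_rel s t.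
Proof.
split=> [/eqP|h]; first by rewrite /tens_sum piE => /asboolP.
by apply/eqP; rewrite /tens_sum piE; apply/asboolP.
Qed.

Lemma tens_sum_ind (P : tensor -> Prop) :
  (forall s, P (tens_sum s)) -> forall x, P x.
Proof. by move=> H x; rewrite -[x]reprK. Qed.

Lemma tens_sum_repr s : tens_rel (repr (tens_sum s)) s.
Proof. by apply/tens_sumP; rewrite /tens_sum reprK. Qed.

Lemma tens_rel_map (f : M * E -> seq (M * E)) (s t : seq (M * E)) :
  (forall e, tens_rel (f (0, e)) [::]) ->
  (forall m m' e, tens_rel (f (m + m', e)) (f (m, e) ++ f (m', e))) ->
  (forall m e e', tens_rel (f (m, e + e')) (f (m, e) ++ f (m, e'))) ->
  (forall m a e, tens_rel (f (m ** a, e)) (f (m, phi a * e))) ->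
  tens_rel s t -> tens_rel (flatten (map f s)) (flatten (map f t)).
Proof.
move=> f0 fDl fDr fbal; elim=> {s t} /=.
- by move=> s; exact: tr_refl.
- by move=> s t _; exact: tr_sym.
- by move=> s t u _ + _; exact: tr_trans.
- by move=> s s' t t' _ ss _ tt; rewrite !map_cat !flatten_cat; exact: tr_cat.
- by move=> s t; rewrite !map_cat !flatten_cat; exact: tr_catC.
- by move=> e; rewrite cats0.
- by move=> m m' e; rewrite !cats0.
- by move=> m e e'; rewrite !cats0.
- by move=> m a e; rewrite !cats0.
Qed.

Lemma tens_rel_sum (P : zmodType) (beta : M -> E -> P) (s t : seq (M * E)) :
  (forall m m' e, beta (m + m') e = beta m e + beta m' e) ->
  (forall m e e', beta m (e + e') = beta m e + beta m e') ->
  (forall m a e, beta (m ** a) e = beta m (phi a * e)) ->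
  tens_rel s t ->
  \sum_(p <- s) beta p.1 p.2 = \sum_(p <- t) beta p.1 p.2.
Proof.
move=> bDl bDr bbal; elim=> {s t} //=.
- by move=> s t u _ -> _ ->.
- by move=> s s' t t' _ ss _ tt; rewrite !big_cat /= ss tt.
- by move=> s t; rewrite !big_cat /= addrC.
- move=> e; rewrite big_seq1 big_nil /=.
  by apply: (addrI (beta 0 e)); rewrite -bDl !addr0.
- by move=> m m' e; rewrite big_seq1 big_cons big_seq1 bDl.
- by move=> m e e'; rewrite big_seq1 big_cons big_seq1 bDr.
- by move=> m a e; rewrite !big_seq1 bbal.
Qed.

Definition tens_add (x y : tensor) := tens_sum (repr x ++ repr y).
Definition tens_opp (x : tensor) := tens_sum [seq (- p.1, p.2) | p <- repr x].
Definition tens_scale (b : E^c) (x : tensor) :=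
  tens_sum [seq (p.1, p.2 * (b : E)) | p <- repr x].

Lemma tens_addE s t : tens_add (tens_sum s) (tens_sum t) = tens_sum (s ++ t).
Proof. by apply/tens_sumP; apply: tr_cat; exact: tens_sum_repr. Qed.

Lemma tens_oppE s : tens_opp (tens_sum s) = tens_sum [seq (- p.1, p.2) | p <- s].
Proof.
apply/tens_sumP; rewrite -!(flatten_map1 (fun p : M * E => (- p.1, p.2))).
apply: tens_rel_map (tens_sum_repr s) => /=.
- by move=> e; rewrite oppr0; exact: tr_0l.
- by move=> m m' e; rewrite opprD; exact: tr_Dl.
- by move=> m e e'; exact: tr_Dr.
- move=> m a e; rewrite (_ : - (m ** a) = (- m) ** a); first exact: tr_bal.
  by rewrite /rscale scalerN.
Qed.

Lemma tens_scaleE (b : E^c) s :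
  tens_scale b (tens_sum s) = tens_sum [seq (p.1, p.2 * (b : E)) | p <- s].
Proof.
apply/tens_sumP; rewrite -!(flatten_map1 (fun p : M * E => (p.1, p.2 * (b : E)))).
apply: tens_rel_map (tens_sum_repr s) => /=.
- by move=> e; exact: tr_0l.
- by move=> m m' e; exact: tr_Dl.
- by move=> m e e'; rewrite mulrDl; exact: tr_Dr.
- by move=> m a e; rewrite -mulrA; exact: tr_bal.
Qed.

Fact tens_addA : associative tens_add.
Proof.
elim/tens_sum_ind => s; elim/tens_sum_ind => t; elim/tens_sum_ind => u.
by rewrite !tens_addE catA.
Qed.
Fact tens_addC : commutative tens_add.
Proof.
elim/tens_sum_ind => s; elim/tens_sum_ind => t.
by rewrite !tens_addE; apply/tens_sumP; exact: tr_catC.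
Qed.
Fact tens_add0 : left_id (tens_sum [::]) tens_add.
Proof. by elim/tens_sum_ind => s; rewrite tens_addE. Qed.
Fact tens_addN : left_inverse (tens_sum [::]) tens_opp tens_add.
Proof.
elim/tens_sum_ind => s; rewrite tens_oppE.
elim: s => [|[m e] s IHs] /=; first by rewrite tens_addE.
have -> : tens_sum ((- m, e) :: [seq (- p.1, p.2) | p <- s]) =
    tens_add (tens (- m) e) (tens_sum [seq (- p.1, p.2) | p <- s]).
  by rewrite tens_addE.
have -> : tens_sum ((m, e) :: s) = tens_add (tens_sum s) (tens m e).
  by rewrite tens_addC tens_addE.
rewrite -tens_addA (tens_addA _ (tens_sum s)) IHs tens_add0 tens_addE.
apply/tens_sumP; apply: tr_trans (tr_0l e).
by rewrite -(addNr m); apply: tr_sym; exact: tr_Dl.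
Qed.

HB.instance Definition _ :=
  GRing.isZmodule.Build tensor tens_addA tens_addC tens_add0 tens_addN.

Lemma tens_sumD s t : tens_sum (s ++ t) = tens_sum s + tens_sum t.
Proof. by rewrite -[RHS]/(tens_add _ _) tens_addE. Qed.

Lemma tens_sum_cons p s : tens_sum (p :: s) = tens p.1 p.2 + tens_sum s.
Proof. by case: p => m e; rewrite -tens_sumD. Qed.

Fact tens_scaleA (a b : E^c) x : tens_scale a (tens_scale b x) = tens_scale (a * b) x.
Proof.
elim/tens_sum_ind: x => s; rewrite !tens_scaleE -map_comp; congr tens_sum.
by apply: eq_map => p /=; rewrite -mulrA.
Qed.
Fact tens_scale1 : left_id 1 tens_scale.
Proof.
elim/tens_sum_ind => s; rewrite tens_scaleE; congr tens_sum.
by rewrite -[RHS]map_id; apply: eq_map => -[m e] /=; rewrite [_ * _]mulr1.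
Qed.
Fact tens_scaleDr : right_distributive tens_scale +%R.
Proof.
move=> b; elim/tens_sum_ind => s; elim/tens_sum_ind => t.
by rewrite -tens_sumD !tens_scaleE map_cat tens_sumD.
Qed.
Fact tens_scaleDl x : {morph tens_scale^~ x : a b / a + b}.
Proof.
move=> a b; elim/tens_sum_ind: x => s; rewrite !tens_scaleE.
elim: s => [|[m e] s IHs] /=; first by rewrite -tens_sumD.
rewrite !tens_sum_cons IHs [RHS]addrACA; congr (_ + _) => /=.
rewrite -tens_sumD; apply/tens_sumP.
by rewrite [e * _]mulrDr; exact: tr_Dr.
Qed.

HB.instance Definition _ := GRing.Zmodule_isLmodule.Build E^c tensor
  tens_scaleA tens_scale1 tens_scaleDr tens_scaleDl.

Lemma tens_sumE s : tens_sum s = \sum_(p <- s) tens p.1 p.2.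
Proof.
elim: s => [|[m e] s IHs]; first by rewrite big_nil.
by rewrite big_cons -IHs tens_sum_cons.
Qed.

Lemma tensDl m m' e : tens (m + m') e = tens m e + tens m' e.
Proof. by rewrite -tens_sumD; apply/tens_sumP; exact: tr_Dl. Qed.

Lemma tensDr m e e' : tens m (e + e') = tens m e + tens m e'.
Proof. by rewrite -tens_sumD; apply/tens_sumP; exact: tr_Dr. Qed.

Lemma tens_bal m a e : tens (m ** a) e = tens m (phi a * e).
Proof. by apply/tens_sumP; exact: tr_bal. Qed.

Lemma tensZ m e b : tens m e ** b = tens m (e * b).
Proof. exact: tens_scaleE. Qed.

End Tensor.

Section FormExtension.
Variables (D E : invSkewFieldType) (phi : invMorph D E) (s : bool) (M : hermMod D s).

(* The form on M (x) E with
   (m (x) e, m' (x) e') |-> e^K phi (form m m') e'. *)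
Definition ext_sum (x y : seq (M * E)) : E :=
  \sum_(p <- x) \sum_(q <- y) invo p.2 * phi (form p.1 q.1) * q.2.

Definition ext_form (x y : tensor phi M) : E := ext_sum (repr x) (repr y).

Lemma form_Zl (u v : M) a : form (u ** a) v = invo a * form u v.
Proof. by rewrite -{1}[v]rscale1 formZ mulr1. Qed.

Lemma form_Zr (u v : M) a : form u (v ** a) = form u v * a.
Proof. by rewrite -{1}[u]rscale1 formZ invo1 mul1r. Qed.

Lemma ext_sum_rel x x' y y' :
  tens_rel phi x x' -> tens_rel phi y y' -> ext_sum x y = ext_sum x' y'.
Proof.
move=> xx yy; transitivity (ext_sum x' y).
  pose beta (m : M) (e : E) := \sum_(q <- y) invo e * phi (form m q.1) * q.2.
  apply: (tens_rel_sum (beta := beta) _ _ _ xx).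
  - move=> m m' e; rewrite -big_split; apply: eq_bigr => q _.
    by rewrite formDl rmorphD mulrDr mulrDl.
  - move=> m e e'; rewrite -big_split; apply: eq_bigr => q _.
    by rewrite invoD !mulrDl.
  - move=> m a e; apply: eq_bigr => q _.
    by rewrite form_Zl rmorphM im_invo invoM !mulrA.
apply: eq_bigr => p _.
apply: (tens_rel_sum (beta := fun m e => invo p.2 * phi (form p.1 m) * e) _ _ _ yy).
- by move=> m m' e; rewrite formDr rmorphD mulrDr mulrDl.
- by move=> m e e'; rewrite mulrDr.
- by move=> m a e; rewrite form_Zr rmorphM !mulrA.
Qed.

Lemma ext_formE x y : ext_form (tens_sum phi x) (tens_sum phi y) = ext_sum x y.
Proof. by apply: ext_sum_rel; exact: tens_sum_repr. Qed.

Fact ext_formDl x y z : ext_form (x + y) z = ext_form x z + ext_form y z.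
Proof.
elim/tens_sum_ind: x => x; elim/tens_sum_ind: y => y; elim/tens_sum_ind: z => z.
by rewrite -tens_sumD !ext_formE /ext_sum big_cat.
Qed.

Fact ext_formDr x y z : ext_form x (y + z) = ext_form x y + ext_form x z.
Proof.
elim/tens_sum_ind: x => x; elim/tens_sum_ind: y => y; elim/tens_sum_ind: z => z.
rewrite -tens_sumD !ext_formE /ext_sum -big_split.
by apply: eq_bigr => p _; rewrite big_cat.
Qed.

Fact ext_formZ x y a b : ext_form (x ** a) (y ** b) = invo a * ext_form x y * b.
Proof.
elim/tens_sum_ind: x => x; elim/tens_sum_ind: y => y.
rewrite -[_ ** a]/(tens_scale _ _) -[_ ** b]/(tens_scale _ _) !tens_scaleE.
rewrite !ext_formE /ext_sum big_map mulr_sumr mulr_suml.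
apply: eq_bigr => p _; rewrite big_map mulr_sumr mulr_suml.
by apply: eq_bigr => q _; rewrite /= invoM !mulrA.
Qed.

Fact ext_formC x y : ext_form x y = invo (ext_form y x) * (-1) ^+ s.
Proof.
elim/tens_sum_ind: x => x; elim/tens_sum_ind: y => y.
rewrite !ext_formE /ext_sum invo_sum mulr_suml.
under [RHS]eq_bigr do rewrite invo_sum mulr_suml.
rewrite exchange_big; apply: eq_bigr => q _; apply: eq_bigr => p _ /=.
rewrite !invoM invoK -im_invo (formC p.1) rmorphM rmorph_sign.
by rewrite !mulrA -!(mulrA _ _ q.2) -!sign_comm !mulrA.
Qed.

Definition ext_mod : hermMod E s :=
  @HermMod E s (tensor phi M) ext_form ext_formDl ext_formDr ext_formZ ext_formC.

Definition tens_map (g : 'U(M)) (x : tensor phi M) : tensor phi M :=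
  tens_sum phi [seq (g p.1, p.2) | p <- repr x].

Lemma tens_mapE (g : 'U(M)) x :
  tens_map g (tens_sum phi x) = tens_sum phi [seq (g p.1, p.2) | p <- x].
Proof.
apply/tens_sumP; rewrite -!(flatten_map1 (fun p : M * E => (g p.1, p.2))).
apply: tens_rel_map (tens_sum_repr phi x) => /=.
- move=> e; rewrite (_ : g 0 = 0); first exact: tr_0l.
  by apply: (addrI (g 0)); rewrite -ufunD !addr0.
- by move=> m m' e; rewrite ufunD; exact: tr_Dl.
- by move=> m e e'; exact: tr_Dr.
- by move=> m a e; rewrite ufunZ; exact: tr_bal.
Qed.

Lemma tens_mapM (g h : 'U(M)) x : tens_map (g * h)%g x = tens_map g (tens_map h x).
Proof. by elim/tens_sum_ind: x => x; rewrite !tens_mapE -map_comp. Qed.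

Lemma tens_map1 x : tens_map 1%g x = x.
Proof.
elim/tens_sum_ind: x => x; rewrite tens_mapE; congr tens_sum.
by rewrite -[RHS]map_id; apply: eq_map => -[].
Qed.

(* Phi(g) = g (x) id *)
Program Definition unitary_ext (g : 'U(M)) : 'U(ext_mod) :=
  @Unitary E s ext_mod (tens_map g) (tens_map g^-1%g) _ _ _ _ _.
Next Obligation. by move=> x; rewrite -tens_mapM mulVg tens_map1. Qed.
Next Obligation. by move=> x; rewrite -tens_mapM mulgV tens_map1. Qed.
Next Obligation.
elim/tens_sum_ind: u => x; elim/tens_sum_ind: v => y.
by rewrite -[in LHS]tens_sumD !tens_mapE map_cat tens_sumD.
Qed.
Next Obligation.
elim/tens_sum_ind: v => x.
have Z t : rscale (M := ext_mod) (tens_sum phi t) a =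
    tens_sum phi [seq (p.1, p.2 * a) | p <- t] by exact: tens_scaleE.
by rewrite Z !tens_mapE Z -!map_comp.
Qed.
Next Obligation.
elim/tens_sum_ind: u => x; elim/tens_sum_ind: v => y.
rewrite !tens_mapE !ext_formE /ext_sum big_map; apply: eq_bigr => p _.
by rewrite big_map; apply: eq_bigr => q _; rewrite /= ufun_form.
Qed.

Fact unitary_extM : {morph unitary_ext : g h / (g * h)%g}.
Proof. by move=> g h; apply: unitaryP => x; exact: tens_mapM. Qed.

HB.instance Definition _ := isMultiplicative.Build 'U(M) 'U(ext_mod) unitary_ext unitary_extM.

End FormExtension.

Arguments unitary_ext {D E} phi {s} M g.

Record ccomplex := CComplex {
  cc :> nat -> zmodType;
  cdiff : forall n, {additive cc n -> cc n.+1};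
  cdiff_diff : forall n (c : cc n), cdiff n.+1 (cdiff n c) = 0 }.

Section Cohomology.
Variables (C : ccomplex) (n : nat).

Definition cocycle : {pred C n} := fun c => cdiff C n c == 0.

Lemma cocycleE c : (c \in cocycle) = (cdiff C n c == 0). Proof. by []. Qed.

Fact cocycle_closed : zmod_closed cocycle.
Proof.
split=> [|c c']; rewrite !cocycleE; first by rewrite raddf0.
by move=> /eqP dc /eqP dc'; rewrite raddfB dc dc' subrr.
Qed.
HB.instance Definition _ := GRing.isZmodClosed.Build (C n) cocycle cocycle_closed.

Record cocycles := Cocycle { cocycle_val : C n; cocycleP : cocycle_val \in cocycle }.
HB.instance Definition _ := [isSub for cocycle_val].
HB.instance Definition _ := [Choice of cocycles by <:].
HB.instance Definition _ := [SubChoice_isSubZmodule of cocycles by <:].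

End Cohomology.

Definition is_cobound (C : ccomplex) (n : nat) : C n -> Prop :=
  match n with
  | 0 => fun c => c = 0
  | m.+1 => fun c => exists b : C m, c = cdiff C m b
  end.

Definition cobound (C : ccomplex) (n : nat) : {pred cocycles C n} :=
  fun c => `[< is_cobound (cocycle_val c) >].

Fact cobound_closed C n : zmod_closed (@cobound C n).
Proof.
split; first by apply/asboolP; case: n => //= n; exists 0; rewrite raddf0.
case: n => [|n] c c' /asboolP + /asboolP + /=.
  by move=> /= e e'; apply/asboolP; rewrite /= e e' subrr.
by move=> [b e] [b' e']; apply/asboolP; exists (b - b'); rewrite raddfB /= e e'.
Qed.
HB.instance Definition _ C n :=
  GRing.isZmodClosed.Build (cocycles C n) (@cobound C n) (@cobound_closed C n).

Definition cohomology (n : nat) (C : ccomplex) := Quotient.quot (@cobound C n).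
HB.instance Definition _ n C := GRing.Zmodule.on (cohomology n C).

Definition coh_class C n (c : cocycles C n) : cohomology n C := \pi_(cohomology n C) c.

Record cmap (C C' : ccomplex) := CMap {
  cmap_fun :> forall n, {additive C n -> C' n};
  cmap_diff : forall n (c : C n), cmap_fun n.+1 (cdiff C n c) = cdiff C' n (cmap_fun n c) }.

Section CohomologyMap.
Variables (C C' : ccomplex) (f : cmap C C') (n : nat).

Fact cmap_cocycle (c : cocycles C n) : f n (cocycle_val c) \in @cocycle C' n.
Proof.
case: c => c /= /eqP dc; rewrite cocycleE.
by rewrite -cmap_diff dc raddf0.
Qed.

Definition cocycle_map (c : cocycles C n) : cocycles C' n := Cocycle (cmap_cocycle c).

Fact cocycle_map_additive : zmod_morphism cocycle_map.
Proof.
move=> c c'; apply: val_inj; rewrite [RHS](raddfB val) /= -raddfB.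
by congr (f n _); exact: (raddfB val).
Qed.
HB.instance Definition _ := GRing.isZmodMorphism.Build
  (cocycles C n) (cocycles C' n) cocycle_map cocycle_map_additive.

Fact cocycle_map_cobound c : c \in @cobound C n -> cocycle_map c \in @cobound C' n.
Proof.
case: c => c cP /asboolP /= h; apply/asboolP => /=.
move: c h {cP}; case: n => [|m] c /=; first by move->; rewrite raddf0.
by move=> [b ->]; exists (f m b); rewrite cmap_diff.
Qed.

Definition H_map : cohomology n C -> cohomology n C' := quot_map (@cobound C' n) cocycle_map.

HB.instance Definition _ := GRing.isZmodMorphism.Build (cohomology n C) (cohomology n C') H_map
  (quot_map_additive cocycle_map_cobound).

Lemma H_mapE c : H_map (coh_class c) = coh_class (cocycle_map c).
Proof. exact: (quot_mapE cocycle_map_cobound). Qed.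

End CohomologyMap.

Definition del T (i : nat) (s : seq T) := take i s ++ drop i.+1 s.

Lemma size_del T i (s : seq T) : (i < size s)%N -> size (del i s) = (size s).-1.
Proof. by move=> lt; rewrite size_cat size_take lt size_drop; lia. Qed.

Lemma map_del T T' (f : T -> T') i s : map f (del i s) = del i (map f s).
Proof. by rewrite /del map_cat map_take map_drop. Qed.

Lemma del_del T i j (s : seq T) : (i <= j)%N -> del j (del i s) = del i (del j.+1 s).
Proof.
elim: s i j => [|x s IHs] [|i] [|j] //= le; rewrite /del /= ?drop0 //.
by congr cons; exact: IHs.
Qed.

Lemma alt_sum_del T (A : zmodType) (f : seq T -> A) (s : seq T) :
  \sum_(i < size s) \sum_(j < (size s).-1)
    f (del j (del i s)) *~ ((-1) ^+ i * (-1) ^+ j) = 0.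
Proof.
case: (size s) => [|n]; first by rewrite big_ord0.
rewrite exchange_big /=.
pose a i j := f (del j (del i s)) *~ ((-1) ^+ i * (-1) ^+ j).
have -> : \sum_(j < n) \sum_(i < n.+1) a i j =
  \sum_(j < n) \sum_(i < n | (i <= j)%N) a i j + \sum_(j < n) \sum_(i < n | (j <= i)%N) a i.+1 j.
  rewrite -big_split; apply: eq_bigr => j _ /=.
  rewrite (bigID (fun i : 'I_n.+1 => i <= j)%N) /=; congr (_ + _).
    rewrite big_mkcond big_ord_recr /= leqNgt ltn_ord addr0.
    by rewrite [RHS]big_mkcond; apply: eq_bigr.
  rewrite big_mkcond big_ord_recl /= add0r.
  by rewrite [RHS]big_mkcond; apply: eq_bigr => i _; rewrite /bump /= add1n -ltnNge ltnS.
rewrite [X in _ + X](exchange_big_dep xpredT) //= -big_split big1 // => k _ /=.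
rewrite -big_split big1 // => i ik /=; rewrite /a (del_del _ ik) -mulrzDr.
by rewrite exprS mulN1r mulNr mulrC subrr mulr0z.
Qed.

Record Gcomplex (G : groupType) := GComplex {
  vert : Type;
  vact : G -> vert -> vert;
  vact1 : forall x, vact 1%g x = x;
  vactM : forall g h x, vact (g * h)%g x = vact g (vact h x);
  simplex : seq vert -> Prop;
  simplex_neq0 : ~ simplex [::];
  simplex_act : forall g z, simplex z -> simplex (map (vact g) z);
  simplex_del : forall i z,
    simplex z -> (i < size z)%N -> (1 < size z)%N -> simplex (del i z) }.

(* A simplicial set with vertices acted on by G, whose k-simplices are tuples of k + 1
   vertices, is a [Gcomplex]; its chain complex C_* has C_k freely generated by these
   tuples.  P_* is the standard free resolution of Z over G: P_p has the Z-basis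
   G^(p+1), on which G acts diagonally, and eta : P_0 -> Z maps every element of G
   to 1.  Hence Hom_Z (P_* (x)_G C_*, A) consists in degree n of the functions c of
   s in G^(p+1) and of a q-simplex z, where p + q = n, such that
   c (g s) (g z) = c s z.  All bidegrees (p, q) are gathered in a single function on
   pairs of sequences, extended by zero; p and q are (size s).-1 and (size z).-1. *)

Section EquivariantCochains.
Variables (G : groupType) (X : Gcomplex G) (A : zmodType).
Implicit Types (s : seq G) (z : seq (vert X)).

Definition cell n s z := [/\ s <> [::], simplex z & (size s + size z)%N = n.+2].

Record cochain n := Cochain {
  cochain_fun :> seq G -> seq (vert X) -> A;
  cochain_supp : forall s z, ~ cell n s z -> cochain_fun s z = 0;
  cochain_inv : forall g s z,
    cochain_fun [seq (g * x)%g | x <- s] (map (vact g) z) = cochain_fun s z }.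

HB.instance Definition _ n := gen_eqMixin (cochain n).
HB.instance Definition _ n := gen_choiceMixin (cochain n).

Lemma cochainP n (c c' : cochain n) : (forall s z, c s z = c' s z) -> c = c'.
Proof.
case: c c' => [f fs fi] [g gs gi] /= fg.
have {}fg : f = g by apply/funext => s; apply/funext => z.
by subst g; congr Cochain; exact: Prop_irrelevance.
Qed.

Section CochainGroup.
Variable n : nat.

Program Definition cochain0 := @Cochain n (fun _ _ => 0) _ _.
Program Definition cochainN (c : cochain n) := @Cochain n (fun s z => - c s z) _ _.
Next Obligation. by rewrite cochain_supp // oppr0. Qed.
Next Obligation. by rewrite cochain_inv. Qed.
Program Definition cochainD (c c' : cochain n) :=
  @Cochain n (fun s z => c s z + c' s z) _ _.
Next Obligation. by rewrite !cochain_supp // addr0. Qed.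
Next Obligation. by rewrite !cochain_inv. Qed.

Fact cochainDA : associative cochainD.
Proof. by move=> b c d; apply: cochainP => s z /=; rewrite addrA. Qed.
Fact cochainDC : commutative cochainD.
Proof. by move=> b c; apply: cochainP => s z /=; rewrite addrC. Qed.
Fact cochain0D : left_id cochain0 cochainD.
Proof. by move=> c; apply: cochainP => s z /=; rewrite add0r. Qed.
Fact cochainND : left_inverse cochain0 cochainN cochainD.
Proof. by move=> c; apply: cochainP => s z /=; rewrite addNr. Qed.

HB.instance Definition _ :=
  GRing.isZmodule.Build (cochain n) cochainDA cochainDC cochain0D cochainND.

End CochainGroup.

Lemma cochain0l n (c : cochain n) z : c [::] z = 0.
Proof. by apply: cochain_supp => -[]. Qed.

Lemma cochain0r n (c : cochain n) s : c s [::] = 0.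
Proof. by apply: cochain_supp => -[_ /simplex_neq0]. Qed.

Lemma cochainNz n (c : cochain n) s z : ~ simplex z -> c s z = 0.
Proof. by move=> Nz; apply: cochain_supp => -[_ /Nz]. Qed.

Lemma simplex_actE g z : simplex (map (vact g) z) <-> simplex z.
Proof.
split; last exact: simplex_act.
move=> /(simplex_act g^-1%g); rewrite -map_comp (eq_map (g := id)) ?map_id // => x /=.
by rewrite -vactM mulVg vact1.
Qed.

(* The dual of the boundary d (p (x) z) = d p (x) z + (-1) ^ (deg p) p (x) d z. *)
Definition total_diff (c : seq G -> seq (vert X) -> A) s z : A :=
  if `[< simplex z >] then
    \sum_(i < size s) c (del i s) z *~ (-1) ^+ i +
    \sum_(j < size z) c s (del j z) *~ ((-1) ^+ (size s).-1 * (-1) ^+ j)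
  else 0.

Fact total_diff_supp n (c : cochain n) s z :
  ~ cell n.+1 s z -> total_diff c s z = 0.
Proof.
move=> Nsz; rewrite /total_diff; case: asboolP => // zX.
case: s Nsz => [|x s] Nsz.
  by rewrite big_ord0 add0r big1 // => j _; rewrite cochain0l mul0rz.
rewrite !big1 ?addr0 // => i _; rewrite cochain_supp ?mul0rz // => -[_ _ sz].
  by apply: Nsz; split=> //; move: sz (ltn_ord i); rewrite size_del //=; lia.
by apply: Nsz; split=> //; move: sz (ltn_ord i); rewrite size_del //=; lia.
Qed.

Fact total_diff_inv n (c : cochain n) g s z :
  total_diff c [seq (g * x)%g | x <- s] (map (vact g) z) = total_diff c s z.
Proof.
rewrite /total_diff (asbool_equiv_eq (simplex_actE g z)) !size_map.
case: ifP => // _; congr (_ + _); apply: eq_bigr => i _.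
  by rewrite -map_del cochain_inv.
by rewrite -map_del cochain_inv.
Qed.

Definition cochain_diff n (c : cochain n) : cochain n.+1 :=
  Cochain (@total_diff_supp n c) (@total_diff_inv n c).

Fact cochain_diff_additive n : zmod_morphism (@cochain_diff n).
Proof.
move=> c c'; apply: cochainP => s z /=; rewrite /total_diff.
case: ifP => _; last by rewrite subr0.
rewrite opprD addrACA -!sumrB.
by congr (_ + _); apply: eq_bigr => i _; rewrite mulrzBl.
Qed.

HB.instance Definition _ n := GRing.isZmodMorphism.Build
  (cochain n) (cochain n.+1) (@cochain_diff n) (@cochain_diff_additive n).

Lemma cochain_diffE n (c : cochain n) s z : z = [::] \/ simplex z ->
  cochain_diff c s z =
    \sum_(i < size s) c (del i s) z *~ (-1) ^+ i +
    \sum_(j < size z) c s (del j z) *~ ((-1) ^+ (size s).-1 * (-1) ^+ j).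
Proof.
rewrite /= /total_diff; case: asboolP => // Nz [->|//].
by rewrite big_ord0 addr0 big1 // => i _; rewrite cochain0r mul0rz.
Qed.

Fact cochain_diff_diff n (c : cochain n) : cochain_diff (cochain_diff c) = 0.
Proof.
apply: cochainP => s z; have [zX|Nz] := pselect (simplex z); last first.
  by rewrite [RHS]/= cochainNz.
have zdel j : (j < size z)%N -> del j z = [::] \/ simplex (del j z).
  move=> lt; have [z1|z1] := ltnP 1 (size z); first by right; exact: simplex_del.
  by left; apply: size0nil; rewrite size_del //; lia.
rewrite cochain_diffE; last by right.
under eq_bigr => i _ do rewrite (cochain_diffE _ _ (or_intror zX)) mulrzDl.
under [X in _ + X]eq_bigr => j _ do rewrite (cochain_diffE _ _ (zdel _ (ltn_ord j))) mulrzDl.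
rewrite !big_split /= [X in X + _ + _](_ : _ = 0); last first.
  rewrite -[RHS](alt_sum_del (fun s => c s z) s); apply: eq_bigr => i _.
  rewrite size_del // mulrz_suml; apply: eq_bigr => j _.
  by rewrite -mulrzA mulrC.
rewrite [X in _ + (_ + X)](_ : _ = 0); last first.
  rewrite -[RHS](alt_sum_del (c s) z); apply: eq_bigr => i _.
  rewrite size_del // mulrz_suml; apply: eq_bigr => j _.
  rewrite -mulrzA; congr (_ *~ _).
  by rewrite mulrACA -expr2 sqrr_sign mul1r mulrC.
rewrite add0r addr0; under [X in _ + X]eq_bigr do rewrite mulrz_suml.
rewrite [X in _ + X]exchange_big -big_split big1 //= => i _.
rewrite mulrz_suml -big_split big1 //= => j _.
rewrite -!mulrzA -mulrzDr size_del //.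
have [s1|s1] := ltnP 1 (size s); last first.
  by rewrite (size0nil (s := del i s)) ?cochain0l ?mul0rz // size_del //; lia.
rewrite (_ : (size s).-1 = (size s).-2.+1); last by lia.
rewrite exprS /=; rewrite [X in _ *~ X](_ : _ = 0) ?mulr0z //.
by rewrite !mulN1r !(mulNr, mulrN) mulrC addrN.
Qed.

Definition eq_complex := @CComplex cochain (fun n => @cochain_diff n) cochain_diff_diff.

End EquivariantCochains.

Section CoefficientMap.
Variables (G : groupType) (X : Gcomplex G) (A B : zmodType) (f : {additive A -> B}).

Program Definition coef_cochain n (c : cochain X A n) : cochain X B n :=
  @Cochain G X B n (fun s z => f (c s z)) _ _.
Next Obligation. by rewrite cochain_supp ?raddf0. Qed.
Next Obligation. by rewrite cochain_inv. Qed.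

Fact coef_additive n : zmod_morphism (@coef_cochain n).
Proof. by move=> c c'; apply: cochainP => s z /=; rewrite raddfB. Qed.

HB.instance Definition _ n := GRing.isZmodMorphism.Build
  (cochain X A n) (cochain X B n) (@coef_cochain n) (@coef_additive n).

Fact coef_diff n (c : cochain X A n) :
  coef_cochain (cochain_diff c) = cochain_diff (coef_cochain c).
Proof.
apply: cochainP => s z /=; rewrite /total_diff; case: ifP => _; last exact: raddf0.
by rewrite raddfD !raddf_sum; congr (_ + _); apply: eq_bigr => i _; rewrite raddfMz.
Qed.

Definition coef_cmap : cmap (eq_complex X A) (eq_complex X B) :=
  @CMap (eq_complex X A) (eq_complex X B) (fun n => @coef_cochain n) coef_diff.

End CoefficientMap.

Arguments coef_cmap {G} X {A B} f.

(* The complex Z, concentrated in degree 0, with trivial action. *)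
Section TrivialComplex.
Variable G : groupType.

Let triv_simplex (z : seq unit) : Prop := size z = 1%N.

Fact triv_simplex_act (g : G) z : triv_simplex z -> triv_simplex (map id z).
Proof. by rewrite map_id. Qed.

Fact triv_simplex_del i z :
  triv_simplex z -> (i < size z)%N -> (1 < size z)%N -> triv_simplex (del i z).
Proof. by move=> ->. Qed.

Definition triv_complex : Gcomplex G :=
  @GComplex G unit (fun _ x => x) (fun=> erefl) (fun _ _ _ => erefl) triv_simplex
    (fun h => O_S _ h) triv_simplex_act triv_simplex_del.

End TrivialComplex.

(* cohomology n (grp_complex G A) is H^n (G; A), computed by Hom_Z (P_* (x)_G Z, A). *)
Definition grp_complex (G : groupType) (A : zmodType) := eq_complex (triv_complex G) A.

Section Restriction.
Variables (G G' : groupType) (A : zmodType) (Phi : {multiplicative G -> G'}).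

Fact res_supp n (c : cochain (triv_complex G') A n) s z :
  ~ cell (X := triv_complex G) n s z -> c (map Phi s) z = 0.
Proof.
move=> Nsz; apply: cochain_supp => -[s0 z1 sz]; apply: Nsz; split=> //.
  by move=> s_nil; apply: s0; rewrite s_nil.
by move: sz; rewrite size_map.
Qed.

Fact res_inv n (c : cochain (triv_complex G') A n) g s (z : seq unit) :
  c (map Phi [seq (g * x)%g | x <- s]) (map id z) = c (map Phi s) z.
Proof.
rewrite -[RHS](cochain_inv c (Phi g)); congr (cochain_fun c _ _).
by rewrite -!map_comp; apply: eq_map => x /=; rewrite gmulfM.
Qed.

Definition res_cochain n (c : cochain (triv_complex G') A n) :
    cochain (triv_complex G) A n :=
  @Cochain G (triv_complex G) A n _ (res_supp c) (res_inv c).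

Fact res_additive n : zmod_morphism (@res_cochain n).
Proof. by move=> c c'; exact: cochainP. Qed.

HB.instance Definition _ n := GRing.isZmodMorphism.Build
  (cochain (triv_complex G') A n) (cochain (triv_complex G) A n)
  (@res_cochain n) (@res_additive n).

Fact res_diff n (c : cochain (triv_complex G') A n) :
  res_cochain (cochain_diff c) = cochain_diff (res_cochain c).
Proof.
apply: cochainP => s z /=; rewrite /total_diff /= size_map; case: ifP => // _.
by congr (_ + _); apply: eq_bigr => i _; rewrite map_del.
Qed.

Definition res_cmap : cmap (grp_complex G' A) (grp_complex G A) :=
  @CMap (grp_complex G' A) (grp_complex G A) (fun n => @res_cochain n) res_diff.

End Restriction.

Arguments res_cmap {G G'} A Phi.

(* The map H^n (G; A) -> H^n_G (C_*; A) induced by the constant map, that is, by the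
   augmentation C_0 -> Z mapping every vertex to 1. *)
Section Augmentation.
Variables (G : groupType) (X : Gcomplex G) (A : zmodType).

Definition aug_fun (c : seq G -> seq unit -> A) (s : seq G) (z : seq (vert X)) : A :=
  if `[< simplex z >] && (size z == 1%N) then c s [:: tt] else 0.

Fact aug_supp n (c : cochain (triv_complex G) A n) s z :
  ~ cell n s z -> aug_fun c s z = 0.
Proof.
rewrite /aug_fun; case: asboolP => //= zX; case: eqP => // z1 Nsz.
apply: cochain_supp => -[s0 _ sz]; apply: Nsz; split=> //.
by rewrite z1 -[in RHS]sz.
Qed.

Fact aug_inv n (c : cochain (triv_complex G) A n) g s z :
  aug_fun c [seq (g * x)%g | x <- s] (map (vact g) z) = aug_fun c s z.
Proof.
rewrite /aug_fun (asbool_equiv_eq (simplex_actE g z)) size_map.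
by case: ifP => // _; rewrite -[RHS](cochain_inv c g).
Qed.

Definition aug_cochain n (c : cochain (triv_complex G) A n) : cochain X A n :=
  Cochain (@aug_supp n c) (@aug_inv n c).

Fact aug_additive n : zmod_morphism (@aug_cochain n).
Proof.
move=> c c'; apply: cochainP => s z /=; rewrite /aug_fun.
by case: ifP => // _; rewrite subr0.
Qed.

HB.instance Definition _ n := GRing.isZmodMorphism.Build
  (cochain (triv_complex G) A n) (cochain X A n) (@aug_cochain n) (@aug_additive n).

Fact aug_diff n (c : cochain (triv_complex G) A n) :
  aug_cochain (cochain_diff c) = cochain_diff (aug_cochain c).
Proof.
apply: cochainP => s z /=; rewrite {2}/total_diff {1}/aug_fun.
case: asboolP => //= zX; have tX : @simplex G (triv_complex G) [:: tt] by [].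
have [z1|z1] := eqVneq (size z) 1%N.
  rewrite /total_diff asboolT // z1 !big_ord_recr !big_ord0 /= cochain0r mul0rz !addr0.
  rewrite (_ : del 0 z = [::]) ?{2}/aug_fun ?andbF ?mul0rz ?addr0.
    by apply: eq_bigr => i _; rewrite /aug_fun asboolT // z1.
  by apply: size0nil; rewrite size_del z1.
rewrite big1 => [|i _]; last by rewrite /aug_fun (negPf z1) andbF mul0rz.
have [z2|z2] := eqVneq (size z) 2%N.
  rewrite z2 !big_ord_recr big_ord0 /= /aug_fun !add0r.
  rewrite !asboolT ?size_del ?z2 //=; try by apply: simplex_del; rewrite ?z2.
  by rewrite -mulrzDr expr0 expr1 -mulrDr subrr mulr0 mulr0z.
rewrite big1 ?addr0 // => j _; rewrite /aug_fun size_del //.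
case: eqP => [e|]; last by rewrite andbF mul0rz.
by move: z1 z2 e (ltn_ord j); lia.
Qed.

Definition aug_cmap : cmap (grp_complex G A) (eq_complex X A) :=
  @CMap (grp_complex G A) (eq_complex X A) (fun n => @aug_cochain n) aug_diff.

End Augmentation.

Section Lagrangians.
Variables (D : invSkewFieldType) (s : bool) (M : hermMod D s).

Definition perp (X : set M) : set M :=
  [set v | forall u, X u -> form u v = 0]%classic.

Record lagrangian := Lagrangian {
  lset :> set M;
  lset_perp : lset = perp lset }.

HB.instance Definition _ := gen_eqMixin lagrangian.
HB.instance Definition _ := gen_choiceMixin lagrangian.

Lemma lagrangianP (X Y : lagrangian) : lset X = lset Y -> X = Y.
Proof.
case: X Y => [X hX] [Y hY] /= e; subst Y.
by congr Lagrangian; exact: Prop_irrelevance.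
Qed.

Definition opposite (X Y : lagrangian) : Prop := (X `&` Y = [set 0])%classic.

Fact lagr_act_perp (g : 'U(M)) (X : lagrangian) :
  (g @` X = perp (g @` X))%classic.
Proof.
apply/seteqP; split=> [_ [v Xv <-] _ [u Xu <-]|v vX].
  by rewrite ufun_form; move: Xv; rewrite {1}lset_perp; apply.
exists (uinv g v); last exact: uinvK.
rewrite lset_perp => u Xu; rewrite -(ufun_form g) uinvK.
by apply: vX; exists u.
Qed.

Definition lagr_act (g : 'U(M)) (X : lagrangian) := Lagrangian (lagr_act_perp g X).

Fact lagr_act1 X : lagr_act 1%g X = X.
Proof.
apply: lagrangianP; apply/seteqP; split=> [_ [v Xv <-] //|v Xv].
by exists v.
Qed.

Fact lagr_actM g h X : lagr_act (g * h)%g X = lagr_act g (lagr_act h X).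
Proof.
apply: lagrangianP; apply/seteqP; split=> [_ [v Xv <-]|_ [_ [v Xv <-] <-]].
  by exists (h v) => //; exists v.
by exists v.
Qed.

Fact lagr_act_opposite g X Y : opposite X Y -> opposite (lagr_act g X) (lagr_act g Y).
Proof.
rewrite /opposite => XY; have g0 : g 0 = 0.
  by apply: (addrI (g 0)); rewrite -ufunD !addr0.
have XY0 v : lset X v -> lset Y v -> v = 0.
  by move=> Xv Yv; have : (X `&` Y)%classic v by []; rewrite XY.
have [X0 Y0] : (X `&` Y)%classic 0 by rewrite XY.
apply/seteqP; split=> [_ [[u Xu <-] [v Yv /(can_inj (ufunK g)) e]]|_ ->] /=.
  by subst v; rewrite (XY0 u).
by split; exists 0.
Qed.

Definition fl_simplex (z : seq lagrangian) : Prop :=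
  z <> [::] /\ {in z &, forall X Y, X = Y \/ opposite X Y}.

Fact fl_simplex_act g z : fl_simplex z -> fl_simplex (map (lagr_act g) z).
Proof.
move=> [z0 zX]; split; first by case: z z0 {zX}.
move=> _ _ /mapP[X Xz ->] /mapP[Y Yz ->].
by have [->|XY] := zX X Y Xz Yz; [left | right; exact: lagr_act_opposite].
Qed.

Fact fl_simplex_del i z :
  fl_simplex z -> (i < size z)%N -> (1 < size z)%N -> fl_simplex (del i z).
Proof.
move=> [_ zX] iz z1; split; first by move=> /(congr1 size); rewrite size_del //=; lia.
have sub X : X \in del i z -> X \in z.
  by rewrite mem_cat => /orP[/mem_take|/mem_drop].
by move=> X Y /sub Xz /sub Yz; exact: zX.
Qed.

Definition Fl : Gcomplex 'U(M) :=
  @GComplex 'U(M) lagrangian lagr_act lagr_act1 lagr_actM fl_simplex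
    (fun h => h.1 erefl) fl_simplex_act fl_simplex_del.

Definition is_basis (X : set M) n (x : 'I_n -> M) : Prop :=
  (forall v, X v <-> exists a : 'I_n -> D, v = \sum_i x i ** a i) /\
  (forall a : 'I_n -> D, \sum_i x i ** a i = 0 -> forall i, a i = 0).

End Lagrangians.

Section Maslov.
Variables (D : invSkewFieldType) (eps : bool) (M : hermMod D (~~ eps)).
Implicit Types X Y Z : lagrangian M.

Definition is_kappa X Y Z (t : nform D eps) : Prop :=
  exists x y : 'I_(rk t) -> M,
    [/\ is_basis X x, is_basis Y y,
        forall mu nu, form (y mu) (x nu) = (mu == nu)%:R
      & is_basis Z (fun nu => y nu + \sum_mu x mu ** gram t mu nu)].

Definition kappa X Y Z : isoclass D eps :=
  xget 0 [set k | exists t, is_kappa X Y Z t /\ k = class_of t]%classic.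

(* The value of the Maslov cocycle on the alternating chain <X, Y, Z>. *)
Definition maslov X Y Z : Witt D eps :=
  if [|| X == Y, Y == Z | X == Z] then 0 else Witt_class (kappa X Y Z).

(* p (x) z |-> eta(p) maslov(z) on P_0 (x)_G C_2, zero on the other components;
   eta(p) = 1 for p in G. *)
Definition maslov_fun (s : seq 'U(M)) (z : seq (lagrangian M)) : Witt D eps :=
  match s, z with
  | [:: _], [:: X; Y; Z] => if `[< fl_simplex z >] then maslov X Y Z else 0
  | _, _ => 0
  end.

(* The class corresponding to the Maslov cocycle under the isomorphism
   H^2 (U(M); A) = H^2_U(M) (Fl; A), that is, the unique m satisfying the condition
   below when M is hyperbolic and D^eps is infinite. *)
Definition maslov_class : cohomology 2 (grp_complex 'U(M) (Witt D eps)) :=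
  xget 0 [set m : cohomology 2 (grp_complex 'U(M) (Witt D eps)) |
    exists c : cocycles (eq_complex (Fl M) (Witt D eps)) 2,
    cochain_fun (cocycle_val c) = maslov_fun /\
    H_map (aug_cmap (Fl M) (Witt D eps)) m = coh_class c]%classic.

End Maslov.

(* Main.v *)
From HB Require Import structures.
From mathcomp Require Import all_boot all_order all_algebra.
From mathcomp Require Import zify.
From mathcomp Require Import boolp classical_sets functions cardinality.
Require Import Defs.

Set Implicit Arguments.
Unset Strict Implicit.
Unset Printing Implicit Defensive.

Import GRing.Theory.
Local Open Scope ring_scope.
Local Open Scope quotient_scope.

(** The two classes are compared on the opposition graph itself.  Sending a
    Lagrangian X of M to X (x) E gives a map of flag complexes Fl(M) -> Fl(M (x) E)
    that is equivariant along Phi, and a triple of invariant t goes to a triple of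
    invariant phi(t): if x, y, y + x t are the bases that compute kappa(X, Y, Z), the
    bases x (x) 1, y (x) 1, (y + x t) (x) 1 compute kappa of the extended triple.  So
    the Maslov cocycle of M (x) E, pulled back to Fl(M), is W^D_E applied to the
    Maslov cocycle of M ([ext_maslov_fun]).  As H^2(U(M)) -> H^2_U(M)(Fl(M)) is
    injective, the equality follows from this one between cocycles.

    Existence of the two classes needs that the augmentation is surjective, and the
    comparison that it is injective.  Both come from cones: since D^eps is infinite,
    every finite set of Lagrangians has a common opposite ([opposite_to_all]).  To find
    it, start from W opposite to all but one of them, Z say, and move W by
    transvections v + u a h(u, v) with u isotropic and a in D^eps.  If u is not
    orthogonal to W /\ Z, any a <> 0 makes W /\ Z smaller, and each Lagrangian that was
    opposite to W stays so for all values of a but one.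
    Coning off finite chains builds a contracting homotopy of the chain complex
    ([contractible]).  Conjugated by the first entry of the group variable it becomes
    equivariant, and it pushes any cocycle of the double complex down to simplicial
    degree 0 up to a coboundary ([concentrate]), where it is the augmentation of a group
    cocycle.

    That the Maslov cochain is a cocycle is a statement about Gram matrices.  If Z and
    W are the graphs of t and s, seen as maps from Y to X, then the four triples
    have invariants t, s, s - t and eps (t^-1 - s^-1), and
    s + eps (t^-1 - s^-1) is isometric to t + (s - t) ([congruent_cocycle]):
    the diagonal of t + (s - t) carries the form s, and its orthogonal complement the
    other summand.  Simplices with repeated vertices require in addition that the cochain
    is alternating, that is [-t] = - [t] in the Witt group.  In characteristic 2 the form
    t + (-t) need not be hyperbolic, but t + (-t) + t is isometric to the sum of a
    hyperbolic form and t ([congruent_hyp]), and this is enough in a group completion. *)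

(** * Contracting homotopies of simplicial sets with cones *)

Lemma all_flatten T (p : pred T) ss : all p (flatten ss) = all (all p) ss.
Proof. by elim: ss => //= s ss IHss; rewrite all_cat IHss. Qed.

Section ContractingHomotopy.
Variables (G : groupType) (X : Gcomplex G).
Local Notation V := (vert X).

(** The empty sequence is the simplex of degree -1 of the augmented complex, so that the
    augmentation is the boundary of a vertex. *)
Definition asimplex (z : seq V) : bool := `[< z = [::] \/ simplex z >].

(** Every finite set of simplices is contained in a cone: the condition on a flag complex
    that makes it acyclic. *)
Definition has_cones := forall zs : seq (seq V),
  all asimplex zs -> exists v, all (fun z => asimplex (v :: z)) zs.

(** Chains are unreduced formal sums; they are only compared through [ev], their pairing
    with arbitrary cochains. *)
Definition chain := seq (int * seq V).
Implicit Types (A : zmodType) (c : chain).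

Definition ev A (f : seq V -> A) c : A := \sum_(p <- c) f p.2 *~ p.1.

Definition cobd A (f : seq V -> A) (z : seq V) : A :=
  \sum_(i < size z) f (del i z) *~ (-1) ^+ i.

Lemma ev_cat A (f : seq V -> A) c c' : ev f (c ++ c') = ev f c + ev f c'.
Proof. exact: big_cat. Qed.

Lemma ev_cons A (f : seq V -> A) p c : ev f (p :: c) = f p.2 *~ p.1 + ev f c.
Proof. exact: big_cons. Qed.

Lemma evB A (f g : seq V -> A) c : ev (fun z => f z - g z) c = ev f c - ev g c.
Proof. by rewrite /ev -sumrB; apply: eq_bigr => p _; rewrite mulrzBl. Qed.

Lemma cobdB A (f g : seq V -> A) z : cobd (fun z => f z - g z) z = cobd f z - cobd g z.
Proof. by rewrite /cobd -sumrB; apply: eq_bigr => i _; rewrite mulrzBl. Qed.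

Lemma cobd_cobd A (f : seq V -> A) z : cobd (cobd f) z = 0.
Proof.
rewrite -[RHS](alt_sum_del f z); apply: eq_bigr => i _.
rewrite /cobd size_del // mulrz_suml; apply: eq_bigr => j _.
by rewrite -mulrzA mulrC.
Qed.

Lemma asimplexW z : simplex z -> asimplex z.
Proof. by move=> zX; apply/asboolP; right. Qed.

Lemma asimplex_del i z : asimplex z -> (i < size z)%N -> asimplex (del i z).
Proof.
move=> /asboolP[->//|zX] iz; apply/asboolP.
have [z1|z1] := ltnP 1 (size z); first by right; exact: simplex_del.
by left; apply: size0nil; rewrite size_del //; lia.
Qed.

(** Dual to the formula d (v * z) = z - v * d z for the cone with apex v. *)
Lemma cobd_cone A (f : seq V -> A) v z : cobd f (v :: z) = f z - cobd (fun w => f (v :: w)) z.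
Proof.
rewrite /cobd /= big_ord_recl /= mulr1z /del /= drop0; congr (_ + _).
rewrite -sumrN; apply: eq_bigr => i _.
by rewrite /bump /= add1n exprS mulN1r mulrNz.
Qed.

Definition boundary z : chain := [seq ((-1) ^+ i, del i z) | i <- iota 0 (size z)].

Lemma ev_boundary A (f : seq V -> A) z : ev f (boundary z) = cobd f z.
Proof.
rewrite /ev big_map -[X in iota _ X]subn0 -/(index_iota 0 (size z)).
by rewrite big_mkord.
Qed.

Definition bind (F : seq V -> chain) c : chain :=
  flatten [seq [seq (p.1 * q.1, q.2) | q <- F p.2] | p <- c].

Lemma ev_bind A (f : seq V -> A) F c : ev f (bind F c) = ev (fun z => ev f (F z)) c.
Proof.
rewrite /bind; elim: c => [|p c IHc]; first by rewrite /ev !big_nil.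
rewrite /= ev_cat ev_cons IHc; congr (_ + _).
rewrite /ev big_map mulrz_suml; apply: eq_bigr => q _ /=.
by rewrite -mulrzA mulrC.
Qed.

Definition supported n c := all (fun p => asimplex p.2 && (size p.2 == n)) c.

(** The transpose of the identity d h + h d = 1; on the empty sequence it
    says that h [::] has augmentation 1. *)
Definition homotopy (h : seq V -> chain) :=
  forall z, asimplex z -> supported (size z).+1 (h z) /\
    forall (A : zmodType) (f : seq V -> A),
      f z = ev (cobd f) (h z) + cobd (fun w => ev f (h w)) z.

(** The homotopy is built by recursion on the size n of z: the chain c = z - h (d z) is a
    cycle because d h = 1 - h d in lower degree, so that it is the boundary of its cone,
    with any apex adjacent to the finitely many vertices of c.  The apex depends on c, and
    is chosen once and for all for each list of simplices. *)
Lemma contractible : has_cones -> exists h, homotopy h.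
Proof.
move=> Xcones; have [v0 _] := Xcones [::] isT.
have /choice[apex apexP] : forall zs, exists v,
    all asimplex zs -> all (fun z => asimplex (v :: z)) zs.
  move=> zs; case: (boolP (all asimplex zs)) => [/Xcones[v vP]|Nzs].
    by exists v.
  by exists v0.
pose cone (c : chain) : chain := [seq (p.1, apex (map snd c) :: p.2) | p <- c].
pose fix hn (n : nat) (z : seq V) {struct n} : chain := cone ((1, z) ::
  if n is n'.+1 then bind (fun w => [seq (- q.1, q.2) | q <- hn n' w]) (boundary z)
  else [::]).
exists (fun z => hn (size z) z) => z; move: {2}(size z) (erefl (size z)) => n.
elim: n z => [|n IHn] z zn zX.
  have z0 := size0nil zn; subst z => /=; rewrite /supported /= andbT; split.
    by have /= := apexP [:: [::]]; rewrite /asimplex /= !andbT => ->.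
  move=> A f; rewrite /ev /= big_seq1 /= cobd_cone /cobd /= !big_ord0.
  by rewrite subr0 addr0 mulr1z.
pose c := (1, z) :: bind (fun w => [seq (- q.1, q.2) | q <- hn n w]) (boundary z).
have hz : hn (size z) z = cone c by rewrite zn.
have dX i : (i < size z)%N -> asimplex (del i z) /\ size (del i z) = n.
  by move=> iz; rewrite size_del // zn; split=> //; exact: asimplex_del.
have cX : supported n.+1 c.
  rewrite /supported /= zX zn eqxx /= /bind all_flatten !all_map.
  apply/allP => i; rewrite mem_iota /= add0n => iz; rewrite !all_map.
  have [iX isz] := dX i iz; have [+ _] := IHn _ isz iX.
  by rewrite isz; apply: sub_all.
have sX : supported (size z).+1 (hn (size z) z).
  rewrite hz zn; have: all asimplex (map snd c).
    by rewrite all_map; apply: sub_all cX => p /andP[].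
  move=> /apexP; rewrite all_map /supported all_map => aX.
  have := conj aX cX => /andP; rewrite -all_predI; apply: sub_all => p /=.
  by move=> /andP[-> /andP[_ /eqP->]] /=.
split=> // A f.
have evc (g : seq V -> A) : ev g c = g z - cobd (fun w => ev g (hn (size w) w)) z.
  rewrite ev_cons mulr1z ev_bind ev_boundary /=; congr (_ + _).
  rewrite /cobd -sumrN; apply: eq_bigr => i _.
  have [_ ->] := dX i (ltn_ord i); rewrite -mulNrz; congr (_ *~ _).
  by rewrite /ev big_map -sumrN; apply: eq_bigr => q _; rewrite mulrNz.
have evcone (g : seq V -> A) : ev g (cone c) = ev (fun w => g (apex (map snd c) :: w)) c.
  by rewrite /ev big_map.
rewrite hz evcone; under [X in ev X _]functional_extensionality_dep do rewrite cobd_cone.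
rewrite evB evc; set g := (fun w => f (_ :: w)).
rewrite (evc (cobd g)) [X in _ - (_ - X)](_ : _ = cobd g z) ?subrr ?subr0 ?subrK //.
rewrite -[RHS]subr0 -(cobd_cobd (fun w => ev g (hn (size w) w)) z) -cobdB.
apply: eq_bigr => i _; have [iX isz] := dX i (ltn_ord i).
by have [_ /(_ A g) ->] := IHn _ isz iX; rewrite addrK.
Qed.

End ContractingHomotopy.

(** * Equivariant cohomology of a simplicial set with cones *)

Lemma diff_subr_diff G (X : Gcomplex G) A n (c : cochain X A n.+1) (e : cochain X A n) :
  cochain_diff (c - cochain_diff e) = cochain_diff c.
Proof. by rewrite (raddfB (@cochain_diff G X A n.+1)) /= cochain_diff_diff subr0. Qed.

Section Concentration.
Variables (G : groupType) (X : Gcomplex G) (h : seq (vert X) -> chain X).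
Hypothesis hP : homotopy h.
Local Notation V := (vert X).
Implicit Types (A : zmodType) (s : seq G) (z : seq V).

Lemma eq_ev A (f f' : seq V -> A) n c : supported n c ->
  (forall z, asimplex z -> size z = n -> f z = f' z) -> ev f c = ev f' c.
Proof.
move=> + ff; rewrite /ev; elim: c => [|p c IHc]; first by rewrite !big_nil.
by rewrite /= !big_cons => /andP[/andP[pX /eqP pn] /IHc->]; rewrite ff.
Qed.

Lemma asimplex_act g z : asimplex (map (vact g) z) = asimplex z.
Proof.
apply/asboolP/asboolP => -[zX|zX]; try (by left; case: z zX); right.
  by apply/(simplex_actE g).
exact: simplex_act.
Qed.

Lemma asimplex_simplex z : asimplex z -> (0 < size z)%N -> simplex z.
Proof. by move=> /asboolP[->|]. Qed.

Lemma vactK g z : map (vact g) (map (vact g^-1%g) z) = z.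
Proof.
rewrite -map_comp -[RHS]map_id; apply: eq_map => x /=.
by rewrite -vactM mulgV vact1.
Qed.

(** The operator (h^* c)(s, z), with h replaced by g h g^-1, where g is the first entry of s.
    As g is moved to a g by the action of a, this makes an equivariant operator out of
    an arbitrary h; it keeps s fixed, so that the homotopy identity of h
    carries over to the simplicial differential. *)
Definition hev A n (c : cochain X A n) s z : A :=
  ev (fun w => c s (map (vact (head 1%g s)) w)) (h (map (vact (head 1%g s)^-1%g) z)).

Lemma hev_inv A n (c : cochain X A n) g s z :
  hev c [seq (g * x)%g | x <- s] (map (vact g) z) = hev c s z.
Proof.
rewrite /hev; case: s => [|x s]; first by rewrite /ev !big1 // => p _; rewrite cochain0l mul0rz.
rewrite (_ : map _ (map _ z) = map (vact x^-1%g) z) /=; last first.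
  by rewrite -map_comp; apply: eq_map => y /=; rewrite -vactM invgM mulgVK.
apply: eq_bigr => p _; congr (_ *~ _).
rewrite -(cochain_inv c g (x :: s)); congr (cochain_fun c _ _).
by rewrite -map_comp; apply: eq_map => y /=; rewrite -vactM.
Qed.

Lemma hev_eq0 A n (c : cochain X A n) s z : asimplex z ->
  (forall w, size w = (size z).+1 -> c s w = 0) -> hev c s z = 0.
Proof.
move=> zX c0; rewrite /hev; set f := (fun w => _).
have [|hz _] := hP (z := map (vact (head 1%g s)^-1%g) z).
  by rewrite asimplex_act.
rewrite (eq_ev (f' := fun=> 0) hz) => [|w _ wz]; last by rewrite /f c0 // size_map wz size_map.
by rewrite /ev big1 // => p _; rewrite mul0rz.
Qed.

(** In the top simplicial degree k of c the group part of D c vanishes at simplices of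
    size k + 1, so that D c = 0 there says that c is a simplicial cocycle for each s; the
    homotopy identity then loses one of its two terms. *)
Lemma hev_cobd A n (c : cochain X A n) k s z :
  (forall s w, (1 < size w)%N -> cochain_diff c s w = 0) ->
  (forall s w, (k < size w)%N -> c s w = 0) ->
  simplex z -> size z = k ->
  c s z = cobd (hev c s) z.
Proof.
move=> Dc0 c0 zX zk; set g := head 1%g s; set z' := map (vact g^-1%g) z.
have k0 : (0 < k)%N by rewrite -zk; case: z zX {z' zk} => // /simplex_neq0.
pose f w := c s (map (vact g) w).
have z'X : asimplex z' by rewrite asimplex_act; exact: asimplexW.
have [hz /(_ A f)] := hP z'X; rewrite {1}/f vactK => ->.
rewrite (eq_ev (f' := fun=> 0) hz) => [|w wX wk].
  rewrite {1}/ev big1 ?add0r => [|p _]; last exact: mul0rz.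
  rewrite /cobd size_map; apply: eq_bigr => i _; congr (_ *~ _).
  by rewrite /hev map_del.
have gwX : simplex (map (vact g) w).
  by apply: simplex_act; apply: asimplex_simplex; rewrite ?wk.
have wsz : size (map (vact g) w) = k.+1 by rewrite size_map wk size_map zk.
have := Dc0 s (map (vact g) w); rewrite wsz cochain_diffE; last by right.
rewrite big1 => [|i _]; last by rewrite c0 ?mul0rz ?wsz.
rewrite add0r wsz => /(_ k0) /(congr1 (fun a => a *~ (-1) ^+ (size s).-1)).
rewrite mul0rz => H; rewrite -[RHS]H mulrz_suml /cobd wk size_map zk.
apply: eq_bigr => i _; rewrite -mulrzA mulrC mulrA -expr2 sqrr_sign mul1r.
by rewrite /f map_del.
Qed.

Section Descent.
Variables (A : zmodType) (n k : nat) (c : cochain X A n.+1).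

(** The sign turns the simplicial differential of the total complex back into [cobd]. *)
Definition descent_fun s z : A :=
  if asimplex z && (size z == k.+1) then hev c s z *~ (-1) ^+ (size s).-1 else 0.

Fact descent_supp s z : ~ cell n s z -> descent_fun s z = 0.
Proof.
rewrite /descent_fun => Nsz; case: ifP => // /andP[zX /eqP zk].
rewrite hev_eq0 ?mul0rz // => w wk; apply: cochain_supp => -[s0 _ sw].
by apply: Nsz; split=> //; [apply: asimplex_simplex; rewrite ?zk | lia].
Qed.

Fact descent_inv g s z :
  descent_fun [seq (g * x)%g | x <- s] (map (vact g) z) = descent_fun s z.
Proof. by rewrite /descent_fun hev_inv asimplex_act !size_map. Qed.

Definition descent : cochain X A n := Cochain descent_supp descent_inv.

(** One step down: subtracting the coboundary of h^* c kills the part of c of top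
    simplicial degree and only changes the parts of lower degree. *)
Lemma descentP :
  (forall s w, (1 < size w)%N -> cochain_diff c s w = 0) ->
  (forall s w, (k.+2 < size w)%N -> c s w = 0) ->
  forall s z, (k.+1 < size z)%N -> (c - cochain_diff descent) s z = 0.
Proof.
move=> Dc0 c0 s z zk; have [zX|Nz] := pselect (simplex z); last exact: cochainNz.
rewrite -[LHS]/(c s z - cochain_diff descent s z) cochain_diffE; last by right.
rewrite big1 => [|i _]; last by rewrite /= /descent_fun gtn_eqF ?andbF ?mul0rz.
rewrite add0r; have [zk2|zk2] := eqVneq (size z) k.+2; last first.
  rewrite c0 ?big1 ?subr0 // => [i _|]; last by lia.
  by rewrite /= /descent_fun size_del // gtn_eqF ?andbF ?mul0rz //; lia.
rewrite (hev_cobd s Dc0 c0 zX zk2); apply/eqP; rewrite subr_eq0; apply/eqP.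
apply: eq_bigr => i _; rewrite /= /descent_fun size_del //.
rewrite [X in X.-1]zk2 eqxx andbT.
rewrite asimplex_del //; last exact: asimplexW.
by rewrite -mulrzA mulrA -expr2 sqrr_sign mul1r.
Qed.

End Descent.

(** The hypothesis covers cocycles, for surjectivity of the augmentation on cohomology,
    as well as cochains whose coboundary is an augmentation, for its injectivity. *)
Lemma concentrate A n (c : cochain X A n.+1) :
  (forall s w, (1 < size w)%N -> cochain_diff c s w = 0) ->
  exists e : cochain X A n, forall s z, (1 < size z)%N -> (c - cochain_diff e) s z = 0.
Proof.
suff red k : (forall s w, (k.+1 < size w)%N -> c s w = 0) ->
    (forall s w, (1 < size w)%N -> cochain_diff c s w = 0) ->
    exists e : cochain X A n, forall s z, (1 < size z)%N -> (c - cochain_diff e) s z = 0.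
  apply: (red n.+1) => s w wn; apply: cochain_supp => -[s0 _ sw].
  by case: s s0 sw => //= x s _; lia.
elim: k c => [|k IHk] c c0 Dc0; first by exists 0 => s z z1; rewrite raddf0 subr0 c0.
have [|e eP] := IHk _ (descentP Dc0 c0).
  move=> s w w1; rewrite diff_subr_diff; exact: Dc0.
by exists (descent k c + e) => s z z1; rewrite raddfD opprD addrA eP.
Qed.

Section AugPreimage.
Variables (A : zmodType) (n : nat) (c : cochain X A n).

(** The value of c at the base point h [::], translated by the first entry of s. *)
Definition aug_preim_fun s (z : seq unit) : A :=
  if size z == 1%N then hev c s [::] else 0.

Fact aug_preim_supp s (z : seq unit) :
  ~ cell (X := triv_complex G) n s z -> aug_preim_fun s z = 0.
Proof.
rewrite /aug_preim_fun => Nsz; case: eqP => // z1.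
apply: hev_eq0 => [|w w1]; first by apply/asboolP; left.
apply: cochain_supp => -[s0 _ sw]; apply: Nsz; split=> //.
by move: sw; rewrite w1 z1.
Qed.

Fact aug_preim_inv g s (z : seq unit) :
  aug_preim_fun [seq (g * x)%g | x <- s] (map id z) = aug_preim_fun s z.
Proof. by rewrite /aug_preim_fun size_map -[[::] in LHS]/(map (vact g) [::]) hev_inv. Qed.

Definition aug_preim : cochain (triv_complex G) A n :=
  @Cochain _ (triv_complex G) _ _ _ aug_preim_supp aug_preim_inv.

(** Here the homotopy identity at a vertex z says that c(s, z) equals the value of c(s, _)
    at the base point. *)
Lemma aug_preimP :
  (forall s w, (1 < size w)%N -> cochain_diff c s w = 0) ->
  (forall s w, (1 < size w)%N -> c s w = 0) -> c = aug_cochain X aug_preim.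
Proof.
move=> Dc0 c0; apply: cochainP => s z; rewrite /= /aug_fun.
case: asboolP => /= [zX|/cochainNz-> //].
case: eqP => [z1|z1].
  rewrite (hev_cobd s Dc0 c0 zX z1) /cobd z1 big_ord1 expr0 mulr1z.
  by congr (hev c s _); apply: size0nil; rewrite size_del z1.
apply: c0; case: z zX z1 => [/simplex_neq0|x [|y z]] //.
Qed.

End AugPreimage.

Lemma aug_cochain_inj A n v : @simplex G X [:: v] -> injective (@aug_cochain G X A n).
Proof.
move=> vX b b' /(congr1 (fun c => cochain_fun c)) e; apply: cochainP => s z.
have [z1|z1] := eqVneq (size z) 1%N; last first.
  by rewrite !cochain_supp // => -[_ /eqP]; rewrite (negPf z1).
have -> : z = [:: tt] by case: z z1 => [|[] []].
by have := congr1 (fun f => f s [:: v]) e; rewrite /= /aug_fun asboolT.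
Qed.

End Concentration.

Section AugmentationIso.
Variables (G : groupType) (X : Gcomplex G) (A : zmodType).
Hypothesis Xcones : has_cones X.

Lemma has_vertex : exists v, @simplex G X [:: v].
Proof.
have [|v /=] := Xcones (zs := [:: [::]]); first by rewrite /= andbT; apply/asboolP; left.
by rewrite andbT => vX; exists v; apply: asimplex_simplex.
Qed.

Lemma coh_classP C n (c c' : cocycles C n) :
  coh_class c = coh_class c' <-> is_cobound (cocycle_val c - cocycle_val c').
Proof.
rewrite /coh_class quot_piP; have -> : cocycle_val c - cocycle_val c' = val (c - c').
  by rewrite (raddfB val).
by split=> [/asboolP|?]; last apply/asboolP.
Qed.

Lemma coh_class_repr C n (m : cohomology n C) : exists c, m = coh_class c.
Proof. by exists (repr m); rewrite /coh_class reprK. Qed.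

Lemma H_aug_surj n (m : cohomology n.+1 (eq_complex X A)) :
  exists m', H_map (aug_cmap X A) m' = m.
Proof.
have [h hP] := contractible Xcones; have [v vX] := has_vertex.
have [[c cP] ->] := coh_class_repr m; have /eqP /= dc := cP.
have [|e eP] := concentrate hP (c := c); first by rewrite dc.
set c' := c - _ in eP.
have dc' : cochain_diff c' = 0.
  by rewrite diff_subr_diff.
have := aug_preimP hP (c := c') _ eP; rewrite dc' => /(_ (fun _ _ _ => erefl)) c'E.
have bP : aug_preim hP c' \in @cocycle (grp_complex G A) n.+1.
  rewrite -[_ \in _]/(cochain_diff (aug_preim hP c') == 0); apply/eqP; apply: (aug_cochain_inj vX).
  by rewrite raddf0 aug_diff -c'E.
exists (coh_class (Cocycle bP)); rewrite H_mapE; apply/coh_classP => /=.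
by exists (- e); rewrite -c'E /c' addrAC subrr add0r raddfN.
Qed.

Lemma H_aug_inj n : injective (@H_map _ _ (aug_cmap X A) n.+2).
Proof.
have [h hP] := contractible Xcones; have [v vX] := has_vertex.
move=> m m'; have [b ->] := coh_class_repr m; have [b' ->] := coh_class_repr m'.
rewrite !H_mapE => /coh_classP /= [e be]; apply/coh_classP => /=.
set b0 := _ - _; have {}be : cochain_diff e = aug_cochain X b0.
  by rewrite (raddfB (@aug_cochain G X A n.+2)) be.
have ab0 s w : (1 < size w)%N -> aug_cochain X b0 s w = 0.
  by rewrite /= /aug_fun; case: w => [|x [|]] //= *; rewrite andbF.
have [|f fP] := concentrate hP (c := e); first by move=> s w w1; rewrite be ab0.
set e' := e - _ in fP.
have de' : cochain_diff e' = aug_cochain X b0 by rewrite diff_subr_diff be.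
have := aug_preimP hP (c := e') _ fP; rewrite de' => /(_ ab0) e'E.
by exists (aug_preim hP e'); apply: (aug_cochain_inj vX); rewrite aug_diff -e'E -de'.
Qed.

End AugmentationIso.

(** A map of vertices that is equivariant along Phi and both preserves and reflects
    simplices acts on cochains by plain composition, extension by zero included. *)
Section Pullback.
Variables (G G' : groupType) (Phi : {multiplicative G -> G'}).
Variables (X : Gcomplex G) (X' : Gcomplex G') (F : vert X -> vert X').
Hypothesis F_act : forall g x, F (vact g x) = vact (Phi g) (F x).
Hypothesis F_simplex : forall z, simplex (map F z) <-> simplex z.
Variable A : zmodType.

Fact pull_supp n (c : cochain X' A n) s z : ~ cell n s z -> c (map Phi s) (map F z) = 0.
Proof.
move=> Nsz; apply: cochain_supp => -[s0 /F_simplex zX sz]; apply: Nsz; split=> //.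
  by move=> s_nil; apply: s0; rewrite s_nil.
by move: sz; rewrite !size_map.
Qed.

Fact pull_inv n (c : cochain X' A n) g s z :
  c (map Phi [seq (g * x)%g | x <- s]) (map F (map (vact g) z)) = c (map Phi s) (map F z).
Proof.
rewrite -[RHS](cochain_inv c (Phi g)); congr (cochain_fun c _ _); rewrite -!map_comp.
  by apply: eq_map => x /=; rewrite gmulfM.
by apply: eq_map => x /=; rewrite F_act.
Qed.

Definition pull_cochain n (c : cochain X' A n) : cochain X A n :=
  Cochain (pull_supp c) (pull_inv c).

Fact pull_additive n : zmod_morphism (@pull_cochain n).
Proof. by move=> c c'; exact: cochainP. Qed.

HB.instance Definition _ n := GRing.isZmodMorphism.Build
  (cochain X' A n) (cochain X A n) (@pull_cochain n) (@pull_additive n).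

Fact pull_diff n (c : cochain X' A n) :
  pull_cochain (cochain_diff c) = cochain_diff (pull_cochain c).
Proof.
apply: cochainP => s z; rewrite /= /total_diff (asbool_equiv_eq (F_simplex z)) !size_map.
by case: ifP => // _; congr (_ + _); apply: eq_bigr => i _; rewrite map_del.
Qed.

Definition pull_cmap : cmap (eq_complex X' A) (eq_complex X A) :=
  @CMap (eq_complex X' A) (eq_complex X A) (fun n => @pull_cochain n) pull_diff.

Lemma pull_aug n (c : cochain (triv_complex G') A n) :
  pull_cochain (aug_cochain X' c) = aug_cochain X (res_cochain Phi c).
Proof.
apply: cochainP => s z; rewrite /= /aug_fun (asbool_equiv_eq (F_simplex z)) size_map.
by [].
Qed.

End Pullback.

Lemma coef_aug (G : groupType) (X : Gcomplex G) (A B : zmodType) (f : {additive A -> B})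
    n (c : cochain (triv_complex G) A n) :
  coef_cochain f (aug_cochain X c) = aug_cochain X (coef_cochain f c).
Proof.
apply: cochainP => s z; rewrite /= /aug_fun.
by case: ifP => // _; exact: raddf0.
Qed.

Lemma H_map_comm (C C1 C2 C3 : ccomplex) (f : cmap C C1) (g : cmap C1 C3)
    (f' : cmap C C2) (g' : cmap C2 C3) n (m : cohomology n C) :
  (forall c, g n (f n c) = g' n (f' n c)) -> H_map g (H_map f m) = H_map g' (H_map f' m).
Proof.
move=> fg; have [c ->] := coh_class_repr m; rewrite !H_mapE; congr coh_class.
by apply: val_inj; exact: fg.
Qed.

(** * Finite bases and dual families over a skew field *)

Section Families.
Variables (D : invSkewFieldType) (s : bool) (M : hermMod D s).
Implicit Types (u v w : M) (a b : D) (X Y : set M).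

Lemma rscale0 v : v ** 0 = 0. Proof. exact: scale0r. Qed.
Lemma rscaleN v a : v ** (- a) = - (v ** a). Proof. exact: scaleNr. Qed.
Lemma rscaleNl v a : (- v) ** a = - (v ** a). Proof. exact: scalerN. Qed.
Lemma rscale_suml I r (P : pred I) (F : I -> M) a :
  (\sum_(i <- r | P i) F i) ** a = \sum_(i <- r | P i) F i ** a.
Proof. exact: scaler_sumr. Qed.

Lemma form0l v : form 0 v = 0.
Proof. by apply: (addrI (form 0 v)); rewrite -formDl !addr0. Qed.
Lemma form0r v : form v 0 = 0.
Proof. by apply: (addrI (form v 0)); rewrite -formDr !addr0. Qed.
Lemma formNl u v : form (- u) v = - form u v.
Proof. by apply: (addrI (form u v)); rewrite -formDl !subrr form0l. Qed.
Lemma formNr u v : form u (- v) = - form u v.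
Proof. by apply: (addrI (form u v)); rewrite -formDr !subrr form0r. Qed.
Lemma formBl u v w : form (u - v) w = form u w - form v w.
Proof. by rewrite formDl formNl. Qed.
Lemma formBr u v w : form w (u - v) = form w u - form w v.
Proof. by rewrite formDr formNr. Qed.
Lemma form_suml I r (P : pred I) (F : I -> M) v :
  form (\sum_(i <- r | P i) F i) v = \sum_(i <- r | P i) form (F i) v.
Proof. exact: (big_morph (fun u => form u v) (fun u w => formDl u w v) (form0l v)). Qed.
Lemma form_sumr I r (P : pred I) (F : I -> M) v :
  form v (\sum_(i <- r | P i) F i) = \sum_(i <- r | P i) form v (F i).
Proof. exact: (big_morph (form v) (fun u w => formDr v u w) (form0r v)). Qed.

Lemma form_eq0C u v : form u v = 0 -> form v u = 0.
Proof. by move=> uv; rewrite formC uv invo0 mul0r. Qed.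

Definition lincomb n (x : 'I_n -> M) (a : 'I_n -> D) : M := \sum_i x i ** a i.

Lemma lincombD n (x : 'I_n -> M) (a b : 'I_n -> D) :
  lincomb x (fun i => a i + b i) = lincomb x a + lincomb x b.
Proof. by rewrite /lincomb -big_split; apply: eq_bigr => i _; rewrite rscaleDr. Qed.

Lemma lincombB n (x : 'I_n -> M) (a b : 'I_n -> D) :
  lincomb x (fun i => a i - b i) = lincomb x a - lincomb x b.
Proof. by rewrite /lincomb -sumrB; apply: eq_bigr => i _; rewrite rscaleDr rscaleN. Qed.

Lemma lincomb0 n (x : 'I_n -> M) : lincomb x (fun=> 0) = 0.
Proof. by rewrite /lincomb big1 // => i _; rewrite rscale0. Qed.

Lemma sum_delta n (a : 'I_n -> D) j : \sum_i (j == i)%:R * a i = a j.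
Proof.
rewrite (bigD1 j) //= eqxx mul1r big1 ?addr0 // => i /negPf ij.
by rewrite eq_sym ij mul0r.
Qed.

Lemma sum_deltar n (a : 'I_n -> D) j : \sum_i a i * (i == j)%:R = a j.
Proof. by rewrite (bigD1 j) //= eqxx mulr1 big1 ?addr0 // => i /negPf->; rewrite mulr0. Qed.

Lemma lincomb_delta n (x : 'I_n -> M) j : lincomb x (fun i => (i == j)%:R) = x j.
Proof.
rewrite /lincomb (bigD1 j) //= eqxx rscale1 big1 ?addr0 // => i /negPf->.
exact: rscale0.
Qed.

Lemma form_lincombr n (x : 'I_n -> M) (a : 'I_n -> D) v :
  form v (lincomb x a) = \sum_i form v (x i) * a i.
Proof. by rewrite form_sumr; apply: eq_bigr => i _; rewrite form_Zr. Qed.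

Lemma form_lincombl n (x : 'I_n -> M) (a : 'I_n -> D) v :
  form (lincomb x a) v = \sum_i invo (a i) * form (x i) v.
Proof. by rewrite form_suml; apply: eq_bigr => i _; rewrite form_Zl. Qed.

Definition fcons T n (t : T) (x : 'I_n -> T) : 'I_n.+1 -> T := fun i => oapp x t (unlift ord0 i).

Lemma fcons0 T n t (x : 'I_n -> T) : fcons t x ord0 = t.
Proof. by rewrite /fcons unlift_none. Qed.
Lemma fconsS T n t (x : 'I_n -> T) i : fcons t x (lift ord0 i) = x i.
Proof. by rewrite /fcons liftK. Qed.

Lemma lincomb_recl n (x : 'I_n.+1 -> M) (a : 'I_n.+1 -> D) : lincomb x a =
  x ord0 ** a ord0 + lincomb (fun i => x (lift ord0 i)) (fun i => a (lift ord0 i)).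
Proof. exact: big_ord_recl. Qed.

Lemma lincomb_cons n v (x : 'I_n -> M) b (a : 'I_n -> D) :
  lincomb (fcons v x) (fcons b a) = v ** b + lincomb x a.
Proof.
rewrite lincomb_recl !fcons0; congr (_ + _).
by apply: eq_bigr => i _; rewrite !fconsS.
Qed.

Definition subspace (X : set M) := [/\ X 0, forall u v, X u -> X v -> X (u + v)
  & forall v a, X v -> X (v ** a)].

Lemma subspace_sub X u v : subspace X -> X u -> X v -> X (u - v).
Proof. by move=> [_ XD XZ] Xu Xv; apply: XD => //; rewrite -[v]rscale1 -rscaleN; exact: XZ. Qed.

Lemma subspace_lincomb X n (x : 'I_n -> M) (a : 'I_n -> D) :
  subspace X -> (forall i, X (x i)) -> X (lincomb x a).
Proof.
move=> [X0 XD XZ] Xx; rewrite /lincomb; elim/big_ind: _ => // i _; exact: XZ.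
Qed.

Lemma subspaceI X Y : subspace X -> subspace Y -> subspace (X `&` Y)%classic.
Proof.
move=> [X0 XD XZ] [Y0 YD YZ]; split=> //.
  by move=> u v [Xu Yu] [Xv Yv]; split; [exact: XD | exact: YD].
by move=> v a [Xv Yv]; split; [exact: XZ | exact: YZ].
Qed.

Lemma perp_subspace X : subspace (perp X).
Proof.
split=> [u _|u v uX vX w Xw|v a vX w Xw]; first exact: form0r.
  by rewrite formDr uX // vX // addr0.
by rewrite form_Zr vX // mul0r.
Qed.

Lemma lagr_subspace (X : lagrangian M) : subspace X.
Proof. by rewrite lset_perp; exact: perp_subspace. Qed.

Lemma lagr_form (X : lagrangian M) u v : lset X u -> lset X v -> form u v = 0.
Proof. by move=> Xu; rewrite lset_perp; apply. Qed.

Lemma basis_mem (X : set M) n (x : 'I_n -> M) i : is_basis X x -> X (x i).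
Proof. by move=> [Xx _]; apply/Xx; eexists; symmetry; exact: lincomb_delta. Qed.

Lemma basis_inj (X : set M) n (x : 'I_n -> M) (a b : 'I_n -> D) :
  is_basis X x -> lincomb x a = lincomb x b -> a =1 b.
Proof.
move=> [_ xfree] ab i; apply/eqP; rewrite -subr_eq0; apply/eqP.
by apply: (xfree (fun i => a i - b i)); rewrite -/(lincomb _ _) lincombB ab subrr.
Qed.

Lemma oppositeP (X Y : lagrangian M) :
  opposite X Y <-> forall v, lset X v -> lset Y v -> v = 0.
Proof.
rewrite /opposite; split=> [XY v Xv Yv|XY].
  by have : (X `&` Y)%classic v by []; rewrite XY.
have [[X0 _ _] [Y0 _ _]] := (lagr_subspace X, lagr_subspace Y).
by apply/seteqP; split=> [v [Xv Yv]|_ ->]; [exact: XY | split].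
Qed.

Lemma oppositeC (X Y : lagrangian M) : opposite X Y -> opposite Y X.
Proof. by rewrite /opposite setIC. Qed.

(** Gram-Schmidt against Y, by induction on n: if y' is dual to all but the first vector
    x0, then x0 - sum x'_i h(y'_i, x0) pairs nontrivially with some w in Y; correcting w by
    the y' and then the y' by w gives the dual family.  The hypothesis is that no nonzero
    combination of x is orthogonal to Y. *)
Lemma dual_family (Y : set M) n (x : 'I_n -> M) : subspace Y ->
  (forall a : 'I_n -> D, (forall w, Y w -> form w (lincomb x a) = 0) -> forall i, a i = 0) ->
  exists y : 'I_n -> M, (forall i, Y (y i)) /\ forall i j, form (y i) (x j) = (i == j)%:R.
Proof.
move=> Ysub; elim: n x => [|n IHn] x xY; first by exists (fun=> 0); split=> -[].
pose x0 := x ord0; pose x' i := x (lift ord0 i).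
have [|y' [y'Y y'x']] := IHn x'.
  move=> a aY i; have := xY (fcons 0 a); rewrite lincomb_recl fcons0 rscale0 add0r.
  move=> /(_ _ (lift ord0 i)); rewrite fconsS; apply=> w /aY <-.
  by congr (form w _); apply: eq_bigr => j _; rewrite fconsS.
pose u := x0 - lincomb x' (fun i => form (y' i) x0).
have [w Yw wu] : exists2 w, Y w & form w u = 1.
  have [[w [Yw /eqP wu]]|Nw] := pselect (exists w, Y w /\ form w u <> 0).
    exists (w ** invo (form w u)^-1); first by case: Ysub => _ _; apply.
    by rewrite form_Zl invoK mulVr // skew_unit.
  have /xY/(_ ord0) : forall w, Y w ->
      form w (lincomb x (fcons 1 (fun i => - form (y' i) x0))) = 0.
    move=> w Yw; rewrite lincomb_recl fcons0 rscale1.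
    rewrite [X in _ + X](_ : _ = - lincomb x' (fun i => form (y' i) x0)).
      by apply/eqP/negPn/negP => wu; apply: Nw; exists w; split=> //; apply/eqP.
    rewrite -sumrN; apply: eq_bigr => i _.
    by rewrite fconsS rscaleN.
  by rewrite fcons0 => /eqP; rewrite oner_eq0.
pose v := w - lincomb y' (fun i => invo (form w (x' i))).
have Yv : Y v by apply: subspace_sub => //; exact: subspace_lincomb.
have vx' j : form v (x' j) = 0.
  rewrite formBl form_lincombl; under eq_bigr do rewrite invoK y'x'.
  by rewrite sum_deltar subrr.
have vx0 : form v x0 = 1.
  rewrite formBl form_lincombl -wu formBr form_lincombr.
  by congr (_ - _); apply: eq_bigr => i _; rewrite invoK.
exists (fcons v (fun i => y' i - v ** invo (form (y' i) x0))); split=> [i|i j].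
  case: (unliftP ord0 i) => [k|] ->; rewrite ?fcons0 ?fconsS //.
  by apply: subspace_sub => //; case: Ysub => _ _; apply.
case: (unliftP ord0 i) => [k|] ->; rewrite ?fcons0 ?fconsS.
  rewrite formBl form_Zl invoK; case: (unliftP ord0 j) => [l|] ->.
    by rewrite -/(x' l) vx' mulr0 subr0 y'x' (inj_eq lift_inj).
  by rewrite -/x0 vx0 mulr1 subrr eq_sym (negPf (neq_lift _ _)).
case: (unliftP ord0 j) => [l|] ->; last by rewrite -/x0 vx0 eqxx.
by rewrite -/(x' l) vx' (negPf (neq_lift _ _)).
Qed.

(** Induction on the number of functionals h(e_i, _) that separate the points of X: either the
    first one vanishes on X, or X is the sum of a line and of its intersection with the kernel. *)
Lemma finite_basis (X : set M) N (e : 'I_N -> M) : subspace X ->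
  (forall v, X v -> (forall i, form (e i) v = 0) -> v = 0) ->
  exists n (x : 'I_n -> M), is_basis X x.
Proof.
elim: N e X => [|N IHN] e X Xsub eX.
  exists 0, (fun=> 0); split=> [v|a _ []] //.
  split=> [Xv|[a ->]].
    by exists (fun=> 0); rewrite big_ord0; apply: eX => // -[].
  by rewrite big_ord0; case: Xsub.
pose e' i := e (lift ord0 i).
have [[v1 [Xv1 /eqP ev1]]|Nv] := pselect (exists v, X v /\ form (e ord0) v <> 0); last first.
  apply: (IHN e') => // v Xv e'v; apply: eX => // i.
  case: (unliftP ord0 i) => [j|] ->; first exact: e'v.
  by apply: contrapT => ev; apply: Nv; exists v.
pose v0 := v1 ** (form (e ord0) v1)^-1.
have Xv0 : X v0 by case: Xsub => _ _; apply.
have ev0 : form (e ord0) v0 = 1 by rewrite form_Zr mulrV // skew_unit.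
pose X' := (X `&` perp [set e ord0])%classic.
have eX' v : X' v -> form (e ord0) v = 0 by move=> [_]; apply.
have X'sub : subspace X' by apply: subspaceI => //; exact: perp_subspace.
have [|n [x [xX' xfree]]] := IHN e' X' X'sub.
  move=> v X'v e'v; apply: eX; first by case: X'v.
  by move=> i; case: (unliftP ord0 i) => [j|] ->; [exact: e'v | exact: eX'].
have X'x (a : 'I_n -> D) : X' (lincomb x a) by apply/xX'; exists a.
exists n.+1, (fcons v0 x); split=> [v|a].
  split=> [Xv|[a ->]]; last first.
    apply: subspace_lincomb => // i; case: (unliftP ord0 i) => [j|] ->; rewrite ?fcons0 // fconsS.
    by have [] := X'x (fun i => (i == j)%:R); rewrite lincomb_delta.
  have : X' (v - v0 ** form (e ord0) v).
    split; first by apply: subspace_sub => //; case: Xsub => _ _; apply.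
    by move=> _ ->; rewrite formBr form_Zr ev0 mul1r subrr.
  move=> /xX'[a va]; exists (fcons (form (e ord0) v) a).
  by rewrite -/(lincomb _ _) lincomb_cons /lincomb -va addrC subrK.
rewrite -/(lincomb _ _) => a0.
have aE : lincomb (fcons v0 x) a = v0 ** a ord0 + lincomb x (fun i => a (lift ord0 i)).
  rewrite lincomb_recl fcons0; congr (_ + _).
  by apply: eq_bigr => i _; rewrite fconsS.
have a00 : a ord0 = 0.
  move: (congr1 (form (e ord0)) a0).
  by rewrite aE formDr form_Zr ev0 mul1r (eX' _ (X'x _)) addr0 form0r.
move: a0; rewrite aE a00 rscale0 add0r => /xfree a0 i.
by case: (unliftP ord0 i) => [j|] ->.
Qed.

(** As the perpendicular of Y is Y, no nonzero vector of X is orthogonal to Y, and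
    [dual_family] applies.  Subtracting from v the combination of the dual vectors
    with the same products with X leaves a vector orthogonal to X, that is, in X; so
    X + Y = M without any dimension count. *)
Lemma opposite_dual (X Y : lagrangian M) n (x : 'I_n -> M) :
  opposite X Y -> is_basis X x -> exists y : 'I_n -> M,
  [/\ is_basis Y y, forall i j, form (y i) (x j) = (i == j)%:R
    & forall v, exists a : 'I_n -> D, lset X (v - lincomb y a)].
Proof.
move=> /oppositeP XY xX; have [Ysub Xsub] := (lagr_subspace Y, lagr_subspace X).
have Xx (a : 'I_n -> D) : lset X (lincomb x a) by apply/(proj1 xX); exists a.
have [|y [yY yx]] := dual_family (x := x) Ysub.
  move=> a aY; have: lset Y (lincomb x a) by rewrite lset_perp.
  by move=> /(XY _ (Xx a)) /(proj2 xX).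
have xy j i : form (x j) (y i) = (-1) ^+ s * (j == i)%:R.
  rewrite formC yx eq_sym.
  by case: eqP => _; rewrite ?invo1 ?invo0 ?mul0r ?mul1r ?mulr0 ?mulr1.
have Yspan v : exists a : 'I_n -> D, lset X (v - lincomb y a).
  exists (fun i => (-1) ^+ s * form (x i) v); rewrite lset_perp => u /(proj1 xX)[b ->].
  rewrite -/(lincomb _ _) form_lincombl big1 // => i _.
  rewrite formBr form_lincombr; under eq_bigr => j _.
    rewrite xy -sign_comm -mulrA [X in _ * X]mulrA -expr2 sqrr_sign mul1r. over.
  by rewrite sum_delta subrr mulr0.
exists y; split=> //; split=> [v|a].
  split=> [Yv|[a ->]]; last exact: subspace_lincomb.
  have [a va] := Yspan v; exists a; apply/eqP; rewrite -subr_eq0; apply/eqP; apply: XY => //.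
  by apply: subspace_sub => //; exact: subspace_lincomb.
rewrite -/(lincomb _ _) => a0 i; apply: (can_inj (@invoK D)).
have := form_lincombl y a (x i); rewrite a0 form0l.
by under eq_bigr do rewrite yx; rewrite sum_deltar invo0.
Qed.
End Families.

(** * Hyperbolic frames *)

Section Frames.
Variables (D : invSkewFieldType) (s : bool) (M : hermMod D s).
Implicit Types (u v w : M) (a b : D).

(** A basis of M with the Gram matrix of a hyperbolic module; unlike an isometry with
    X + X^J it is transported by extension of scalars at once. *)
Definition hyp_frame n (x y : 'I_n -> M) :=
  [/\ forall i j, form (x i) (x j) = 0, forall i j, form (y i) (y j) = 0,
      forall i j, form (y i) (x j) = (i == j)%:R
    & forall v, exists a b : 'I_n -> D, v = lincomb x a + lincomb y b].

Lemma hyp_frame_coordx n (x y : 'I_n -> M) (a b : 'I_n -> D) i : hyp_frame x y ->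
  form (y i) (lincomb x a + lincomb y b) = a i.
Proof.
move=> [_ yy yx _]; rewrite formDr !form_lincombr.
rewrite [X in _ + X]big1 ?addr0 => [|j _]; last by rewrite yy mul0r.
by under eq_bigr do rewrite yx; rewrite sum_delta.
Qed.

Lemma hyp_frame_coordy n (x y : 'I_n -> M) (a b : 'I_n -> D) i : hyp_frame x y ->
  form (x i) (lincomb x a + lincomb y b) = (-1) ^+ s * b i.
Proof.
move=> [xx _ yx _]; rewrite formDr !form_lincombr.
rewrite big1 ?add0r => [|j _]; last by rewrite xx mul0r.
rewrite -(sum_delta b i) mulr_sumr; apply: eq_bigr => j _.
rewrite formC yx eq_sym mulrA -sign_comm.
by case: eqP => _; rewrite ?invo1 ?invo0.
Qed.

Lemma hyp_frame_spanx n (x y : 'I_n -> M) v : hyp_frame x y ->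
  (forall i, form (x i) v = 0) <-> exists a : 'I_n -> D, v = lincomb x a.
Proof.
move=> xy; have [xx _ _ /(_ v)[a [b vE]]] := xy; split=> [xv|[c ->] i]; last first.
  by rewrite form_lincombr big1 // => j _; rewrite xx mul0r.
exists a; rewrite vE; suff -> : b = fun=> 0 by rewrite lincomb0 addr0.
apply/funext => i; have := xv i; rewrite vE (hyp_frame_coordy _ _ _ xy).
by case: (s); rewrite ?expr1 ?mulN1r ?mul1r // => /eqP; rewrite oppr_eq0 => /eqP.
Qed.

Lemma hyp_frame_eq0 n (x y : 'I_n -> M) v : hyp_frame x y ->
  (forall i, form (x i) v = 0) -> (forall i, form (y i) v = 0) -> v = 0.
Proof.
move=> xy /(hyp_frame_spanx _ xy)[a ->] ya; rewrite -[RHS](lincomb0 x); congr lincomb.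
apply/funext => i; rewrite -(ya i) -[lincomb x a]addr0 -(lincomb0 y).
by rewrite (hyp_frame_coordx _ _ _ xy).
Qed.

Lemma hyp_frame_freex n (x y : 'I_n -> M) (a : 'I_n -> D) :
  hyp_frame x y -> lincomb x a = 0 -> forall i, a i = 0.
Proof.
move=> xy a0 i; rewrite -(hyp_frame_coordx a (fun=> 0) i xy).
by rewrite lincomb0 a0 addr0 form0r.
Qed.

(** By [hyp_frame_spanx], the perpendicular of the span of x is this span. *)
Lemma hyp_frame_lagrangian n (x y : 'I_n -> M) : hyp_frame x y ->
  exists X : lagrangian M, is_basis X x.
Proof.
move=> xy; pose X := [set v | exists a : 'I_n -> D, v = lincomb x a]%classic.
have XP : (X = perp X)%classic.
  have [xx _ _ _] := xy; apply/seteqP; split=> v.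
    move=> [a ->] _ [b ->]; rewrite form_lincombl big1 // => i _.
    by rewrite form_lincombr big1 ?mulr0 // => j _; rewrite xx mul0r.
  move=> Xv; apply/(hyp_frame_spanx _ xy) => i; apply: Xv.
  by exists (fun j => (j == i)%:R); rewrite lincomb_delta.
by exists (Lagrangian XP); split=> // a; exact: (hyp_frame_freex xy).
Qed.

Lemma opposite_hyp_frame (X Y : lagrangian M) n (x y : 'I_n -> M) : opposite X Y ->
  is_basis X x -> is_basis Y y -> (forall i j, form (y i) (x j) = (i == j)%:R) ->
  hyp_frame x y.
Proof.
move=> XY xX yY yx; have [y' [y'Y y'x Yv]] := opposite_dual XY xX.
split=> //.
- by move=> i j; apply: (lagr_form (X := X)); exact: basis_mem.
- by move=> i j; apply: (lagr_form (X := Y)); exact: basis_mem.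
move=> v; have [a /(proj1 xX)[b vb]] := Yv v.
have /(proj1 yY)[c vc] : lset Y (lincomb y' a) by apply/(proj1 y'Y); exists a.
by exists b, c; rewrite /lincomb -vb -vc subrK.
Qed.

(** Nondegeneracy and finite dimension in one condition, as the products with the e_i separate
    the vectors; isotropy of the e_i makes transvections available. *)
Definition nonsingular := exists N (e : 'I_N -> M), (forall i, form (e i) (e i) = 0) /\
  forall v, (forall i, form (e i) v = 0) -> v = 0.

Lemma hyp_frame_nonsingular n (x y : 'I_n -> M) : hyp_frame x y -> nonsingular.
Proof.
move=> xy; exists (n + n)%N,
  (fun k : 'I_(n + n) => match fintype.split k with inl i => x i | inr i => y i end).
have [xx yy _ _] := xy; split=> [k|v kv]; first by case: (fintype.split k) => i; rewrite ?xx ?yy.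
apply: (hyp_frame_eq0 xy) => i.
  by have := kv (lshift n i); rewrite (unsplitK (inl i)).
by have := kv (rshift n i); rewrite (unsplitK (inr i)).
Qed.

Lemma lagr_basis (X : lagrangian M) : nonsingular -> exists n (x : 'I_n -> M), is_basis X x.
Proof.
move=> [N [e [_ e0]]]; apply: (finite_basis (e := e)) => [|v _]; last exact: e0.
exact: lagr_subspace.
Qed.

End Frames.

Section HyperbolicFrame.
Variables (D : invSkewFieldType) (s : bool).

Lemma isometric_hyp_frame (M N : hermMod D s) n (x y : 'I_n -> M) :
  isometric M N -> hyp_frame x y -> exists x' y' : 'I_n -> N, hyp_frame x' y'.
Proof.
move=> [f [[g fK gK] fform]] [xx yy yx span].
have fcomb (z : 'I_n -> M) (a : 'I_n -> D) : f (lincomb z a) = lincomb (f \o z) a.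
  by rewrite /lincomb raddf_sum; apply: eq_bigr => i _; exact: linearZ.
exists (f \o x), (f \o y); split=> [i j|i j|i j|v] /=; rewrite ?fform //.
have [a [b vE]] := span (g v); exists a, b.
by rewrite -[v]gK vE raddfD -!fcomb.
Qed.

Section DualBasis.
Import VectorInternalTheory.
Variable X : vectType D^c.

(** The basis of the dual module, dual to [coord_vec]. *)
Program Definition coord_form (i : 'I_(dim X)) : dualJ X :=
  @DualJ D X (fun v => v2r v ord0 i) _ _.
Next Obligation. by rewrite raddfD mxE. Qed.
Next Obligation. by rewrite [v2r _]linearZ mxE. Qed.

Definition coord_vec (i : 'I_(dim X)) : X := r2v (delta_mx ord0 i).

Lemma coord_vecE (v : X) : v = \sum_i coord_vec i ** coord_form i v.
Proof.
rewrite -[LHS]v2rK {1}[v2r v]row_sum_delta raddf_sum; apply: eq_bigr => i _.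
exact: linearZ.
Qed.

Lemma coord_form_vec i j : coord_form i (coord_vec j) = (i == j)%:R.
Proof. by rewrite /= r2vK mxE eqxx. Qed.

Lemma dfun0 (xi : dualJ X) : xi 0 = 0.
Proof. by apply: (addrI (xi 0)); rewrite -dfunD !addr0. Qed.

Lemma dfun_sum (xi : dualJ X) I (r : seq I) (F : I -> X) :
  xi (\sum_(i <- r) F i) = \sum_(i <- r) xi (F i).
Proof. exact: (big_morph xi (dfunD xi) (dfun0 xi)). Qed.

Lemma hyp_mod_hyp_frame : exists n (x y : 'I_n -> hyp_mod s X), hyp_frame x y.
Proof.
exists (dim X), (fun i => (coord_vec i, 0)), (fun i => (0, coord_form i)).
split=> [i j|i j|i j|[v xi]].
- by rewrite /= /hyp_form /= invo0 mul0r addr0.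
- by rewrite /= /hyp_form /= !raddf0 !mxE invo0 mul0r addr0.
- by rewrite /= /hyp_form /= -[v2r _ _ _]/(coord_form i _) coord_form_vec invo0 mul0r addr0.
exists (fun i => coord_form i v), (fun i => invo (xi (coord_vec i))).
rewrite /lincomb; apply/eqP/andP => /=; split; apply/eqP.
  rewrite !raddf_sum /= [X in _ + X]big1 ?addr0; first exact: coord_vecE.
  by move=> i _; exact: scaler0.
rewrite !raddf_sum /= big1 ?add0r => [|i _]; last exact: scaler0.
apply: dualJP => w.
have -> : forall (F : 'I_(dim X) -> dualJ X), (\sum_i F i) w = \sum_i F i w.
  by move=> F; apply: (big_morph (fun eta : dualJ X => eta w)).
rewrite {1}[w]coord_vecE dfun_sum; apply: eq_bigr => i _.
by rewrite dfunZ /= invoK.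
Qed.

End DualBasis.

Lemma hyperbolic_hyp_frame (M : hermMod D s) : hyperbolic M ->
  exists n (x y : 'I_n -> M), hyp_frame x y.
Proof.
move=> [X XM]; have [n [x [y xy]]] := hyp_mod_hyp_frame X.
by exists n; exact: isometric_hyp_frame XM xy.
Qed.

End HyperbolicFrame.

(** * Lagrangians opposite to finitely many given ones *)

Section GenericOpposite.
Variables (D : invSkewFieldType) (eps : bool) (M : hermMod D (~~ eps)).
Implicit Types (u v w : M) (a b : D) (W Z : lagrangian M).

Section Transvection.
Variables (u : M) (a : D).
Hypotheses (uu : form u u = 0) (a_herm : a - invo a * (-1) ^+ eps = 0).

Definition transv b v := v + u ** (b * form u v).

Lemma transvK b : cancel (transv b) (transv (- b)).
Proof.
move=> v; rewrite /transv formDr form_Zr uu mul0r addr0.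
by rewrite mulNr rscaleN addrK.
Qed.

Lemma transvD b v w : transv b (v + w) = transv b v + transv b w.
Proof. by rewrite /transv formDr mulrDr rscaleDr addrACA. Qed.

Lemma transvZ b v c : transv b (v ** c) = transv b v ** c.
Proof. by rewrite /transv form_Zr rscaleDl rscaleA mulrA. Qed.

(** The two terms linear in a cancel exactly when a is in D^eps; the quadratic one has the
    factor h(u, u) = 0. *)
Lemma transv_form v w : form (transv a v) (transv a w) = form v w.
Proof.
rewrite /transv formDl !formDr !form_Zl !form_Zr uu mul0r mulr0 addr0.
rewrite -addrA -[RHS]addr0; congr (_ + _).
rewrite (formC v u) signrN mulrN mulNr invoM addrC -!mulrA; apply/eqP.
rewrite subr_eq0; apply/eqP; congr (_ * _); rewrite !mulrA; congr (_ * _).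
move: a_herm => /eqP; rewrite subr_eq0 => /eqP {2}->.
by rewrite mulrA -sign_comm -mulrA -expr2 sqrr_sign mulr1.
Qed.

Lemma transvNK b : cancel (transv (- b)) (transv b).
Proof. by move=> v; rewrite -{1}(opprK b) transvK. Qed.

Definition transvection : 'U(M) := Unitary (@transvK a) (@transvNK a)
  (transvD a) (transvZ a) transv_form.

End Transvection.

(** Write u = p + q with p in W and q in Z.  If w in W is sent into Z, then w + p a h(u, w) lies
    in both W and Z, so it is 0; pairing with u gives (1 + h(u, p) a) h(u, w) = 0, and w = 0
    unless a = - h(u, p)^-1. *)
Lemma transv_opposite W Z u (uu : form u u = 0) : nonsingular M -> opposite W Z ->
  exists b : D, forall a (a_herm : a - invo a * (-1) ^+ eps = 0), a != b ->
    opposite (lagr_act (transvection uu a_herm) W) Z.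
Proof.
move=> Mns WZ; have [n [x xW]] := lagr_basis W Mns.
have [y [yZ _ Zspan]] := opposite_dual WZ xW; have [c Wp] := Zspan u.
set p := u - _ in Wp; exists (- (form u p)^-1) => a a_herm ab.
apply/oppositeP => _ [w Ww <-] /= Zw.
have [Zsub Wsub] := (lagr_subspace Z, lagr_subspace W).
have Zc : lset Z (lincomb y c) by apply/(proj1 yZ); exists c.
set k := a * form u w in Zw *.
have w0 : w + p ** k = 0.
  have /oppositeP := WZ; apply.
    by case: Wsub => _ WD WZ'; apply: WD => //; exact: WZ'.
  have -> : w + p ** k = transv u a w - lincomb y c ** k.
    by rewrite /transv -/k /p rscaleDl rscaleNl addrA.
  by apply: subspace_sub => //; case: Zsub => _ _; apply.
have uw : form u w = 0.
  apply: contrapT => /eqP uw; move/(congr1 (form u)): w0.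
  rewrite formDr form_Zr form0r /k mulrA -{1}[form u w]mul1r -mulrDl.
  rewrite -[RHS](mul0r (form u w)) => /(mulIr (skew_unit _ uw)) /eqP.
  rewrite addr_eq0 => /eqP e.
  have up : form u p != 0.
    by apply: contra_eq_neq e => ->; rewrite mul0r oppr0 oner_eq0.
  case/eqP: ab; apply: (mulrI (skew_unit _ up)).
  by rewrite mulrN mulrV ?skew_unit // e opprK.
by rewrite /transv uw mulr0 rscale0 addr0; move: w0; rewrite /k uw mulr0 rscale0 addr0.
Qed.

(** The inner induction is on the number n of vectors w that span the intersection of W'
    and Z.  If w0 is one of them and u an isotropic vector with h(u, w0) <> 0, then
    the transvection v + u a h(u, v) turns W' into a Lagrangian that meets Z in the part
    of the intersection orthogonal to u, spanned by n - 1 vectors. *)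
Lemma opposite_to_all (l : seq (lagrangian M)) :
  infinite_set [set a : D | a - invo a * (-1) ^+ eps = 0]%classic ->
  nonsingular M -> inhabited (lagrangian M) ->
  exists W, forall Z, Z \in l -> opposite W Z.
Proof.
move=> Dinf Mns [W0]; elim: l => [|Z l [W Wl]]; first by exists W0.
suff red n W' (w : 'I_n -> M) : (forall Z', Z' \in l -> opposite W' Z') ->
    (forall i, (W' `&` Z)%classic (w i)) ->
    (forall v, (W' `&` Z)%classic v -> exists b : 'I_n -> D, v = lincomb w b) ->
    exists W'', forall Z', Z' \in Z :: l -> opposite W'' Z'.
  have [N [e [_ e0]]] := Mns.
  have [|//|n [w wB]] := finite_basis (X := (W `&` Z)%classic) (e := e).
  - by apply: subspaceI; exact: lagr_subspace.
  - by move=> v _; exact: e0.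
  apply: (red n W w) => // [i|v]; first exact: basis_mem.
  by move=> /(proj1 wB).
elim: n W' w => [|n IHn] W' w W'l wWZ wspan.
  exists W' => Z'; rewrite inE => /predU1P[->|/W'l//].
  apply/oppositeP => v Wv Zv; have [|b ->] := wspan v; first by split.
  by rewrite /lincomb big_ord0.
have [N [e [ee e0]]] := Mns; pose w0 := w ord0; pose w' i := w (lift ord0 i).
have [[i ew0]|ew0] := pselect (exists i, form (e i) w0 <> 0); last first.
  have w00 : w0 = 0.
    by apply: e0 => i; apply: contrapT => ewi; apply: ew0; exists i.
  apply: (IHn W' w') => // [i|v /wspan[b ->]]; first exact: wWZ.
  exists (fun i => b (lift ord0 i)).
  by rewrite lincomb_recl -/w0 w00 /rscale scaler0 add0r.
pose u := e i; have uu : form u u = 0 := ee i; move: ew0 => /eqP ew0.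
have /choice[bad badP] : forall Z', exists b : D, Z' \in l ->
    forall a (a_herm : a - invo a * (-1) ^+ eps = 0), a != b ->
    opposite (lagr_act (transvection uu a_herm) W') Z'.
  move=> Z'; case: (boolP (Z' \in l)) => [/W'l/(transv_opposite uu Mns)[b bP]|_].
    by exists b.
  by exists 0.
(* a <> 0 and a avoids the one bad value of each Lagrangian of l. *)
have [a a_herm aN] : exists2 a : D, a - invo a * (-1) ^+ eps = 0 & a \notin 0 :: map bad l.
  apply: contrapT => N'; apply: Dinf.
  apply: (sub_finite_set (B := [set` 0 :: map bad l])); last exact: finite_seq.
  by move=> a /= a_herm; apply: contrapT => /negP aN; apply: N'; exists a.
move: aN; rewrite inE negb_or => /andP[a0 aN].
have [[W'0 Z0] [_ _ W'Z0]] := (wWZ ord0, lagr_subspace W').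
pose c j := (form u w0)^-1 * form u (w' j).
pose w'' j := w' j - w0 ** c j.
have uw'' j : form u (w'' j) = 0.
  by rewrite formBr form_Zr /c mulrA mulrV ?skew_unit // mul1r subrr.
apply: (IHn (lagr_act (transvection uu a_herm) W') w'') => [Z' Z'l|j|v [[v1 W'v1 <-] Zv]].
- apply: badP => //; apply: contraNneq aN => ->; exact: map_f.
- have [W'j Zj] : (W' `&` Z)%classic (w'' j).
    have WZsub : subspace (W' `&` Z)%classic by apply: subspaceI; exact: lagr_subspace.
    apply: subspace_sub => //; first exact: wWZ.
    by case: WZsub => _ _; apply; exact: wWZ.
  by split=> //; exists (w'' j) => //=; rewrite /transv uw'' mulr0 rscale0 addr0.
(* v1 + u a h(u, v1) is in Z and v1 in W'; w0 is orthogonal to both, but not to u. *)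
have uv1 : form u v1 = 0.
  have /(lagr_form Z0) := Zv; rewrite /= /transv formDr (lagr_form W'0 W'v1) add0r form_Zr.
  have w0u : form w0 u != 0 by apply: contra_neq ew0; exact: form_eq0C.
  rewrite -[RHS](mulr0 (form w0 u)) => /(mulrI (skew_unit _ w0u)).
  by rewrite -[RHS](mulr0 a) => /(mulrI (skew_unit _ a0)).
have vE : transv u a v1 = v1 by rewrite /transv uv1 mulr0 rscale0 addr0.
rewrite /= vE in Zv *; have [|b v1E] := wspan v1; first by split.
exists (fun j => b (lift ord0 j)); move: uv1; rewrite {}v1E lincomb_recl.
rewrite formDr form_Zr form_lincombr -/w0 => /eqP; rewrite addr_eq0 => /eqP ub.
have -> : b ord0 = - \sum_j c j * b (lift ord0 j).
  apply: (mulrI (skew_unit _ ew0)); rewrite -/u ub mulrN mulr_sumr; congr (- _).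
  by apply: eq_bigr => j _; rewrite /c !mulrA mulrV ?skew_unit // mul1r.
rewrite /w'' addrC [RHS](_ : _ = lincomb w' (fun j => b (lift ord0 j)) -
    \sum_j w0 ** (c j * b (lift ord0 j))).
  rewrite rscaleN; congr (_ - _); rewrite -[RHS]/(_ : M).
  by rewrite /rscale scaler_suml.
rewrite /lincomb -sumrB; apply: eq_bigr => j _.
by rewrite rscaleDl rscaleNl rscaleA.
Qed.

End GenericOpposite.

(** * Congruences of Gram matrices *)

Section MatrixForms.
Variables (D : invSkewFieldType) (eps : bool).
Local Notation sg := ((-1) ^+ eps : D).

Lemma mulmx_sign m n p (a : 'M[D]_(m, n)) (b : 'M[D]_(n, p)) :
  a *m (sg *: b) = sg *: (a *m b).
Proof. by rewrite !scaler_sign; case: (eps); rewrite ?mulmxN. Qed.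

Lemma mul_sign_mx m n p (a : 'M[D]_(m, n)) (b : 'M[D]_(n, p)) :
  (sg *: a) *m b = sg *: (a *m b).
Proof. by rewrite scalemxAl. Qed.

Lemma adjmxN m n (a : 'M[D]_(m, n)) : adjmx (- a) = - adjmx a.
Proof. by apply/matrixP => i j; rewrite !mxE invoN. Qed.

Lemma adjmxD m n (a b : 'M[D]_(m, n)) : adjmx (a + b) = adjmx a + adjmx b.
Proof. by apply/matrixP => i j; rewrite !mxE invoD. Qed.

Lemma adjmx_col m1 m2 n (a : 'M[D]_(m1, n)) (b : 'M[D]_(m2, n)) :
  adjmx (col_mx a b) = row_mx (adjmx a) (adjmx b).
Proof. by rewrite /adjmx map_col_mx tr_col_mx. Qed.

Lemma adjmx_row m n1 n2 (a : 'M[D]_(m, n1)) (b : 'M[D]_(m, n2)) :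
  adjmx (row_mx a b) = col_mx (adjmx a) (adjmx b).
Proof. by rewrite /adjmx map_row_mx tr_row_mx. Qed.

Lemma adjmx_sign m n (a : 'M[D]_(m, n)) : adjmx (sg *: a) = sg *: adjmx a.
Proof. by rewrite !scaler_sign; case: (eps); rewrite ?adjmxN. Qed.

Lemma signmxK m n (a : 'M[D]_(m, n)) : sg *: (sg *: a) = a.
Proof. by rewrite scalerA -expr2 sqrr_sign scale1r. Qed.

Lemma herm_mxP n (t : 'M[D]_n) : herm_mx eps t <-> adjmx t = sg *: t.
Proof.
rewrite /herm_mx; have -> : map_mx (fun a => a * sg) (adjmx t) = sg *: adjmx t.
  by apply/matrixP => i j; rewrite !mxE sign_comm.
by split=> [{2}->|->]; rewrite signmxK.
Qed.

Lemma herm_mxN n (t : 'M[D]_n) : herm_mx eps t -> herm_mx eps (- t).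
Proof. by move=> /herm_mxP th; apply/herm_mxP; rewrite adjmxN th scalerN. Qed.

Lemma herm_mxD n (t s : 'M[D]_n) : herm_mx eps t -> herm_mx eps s -> herm_mx eps (t + s).
Proof.
by move=> /herm_mxP th /herm_mxP sh; apply/herm_mxP; rewrite adjmxD th sh scalerDr.
Qed.

Lemma invertibleN m n (a : 'M[D]_(m, n)) : invertible a -> invertible (- a).
Proof. by move=> [b [ab ba]]; exists (- b); rewrite !mulmxN !mulNmx !opprK. Qed.

Lemma invertible_sign m n (a : 'M[D]_(m, n)) : invertible a -> invertible (sg *: a).
Proof.
by move=> [b [ab ba]]; exists (sg *: b); rewrite !mulmx_sign !mul_sign_mx !signmxK.
Qed.

Lemma invertible_adj m n (a : 'M[D]_(m, n)) : invertible a -> invertible (adjmx a).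
Proof. by move=> [b [ab ba]]; exists (adjmx b); rewrite -!adjmxM ab ba !adjmx1. Qed.

Lemma adjmx_inv n (t b : 'M[D]_n) : herm_mx eps t -> t *m b = 1%:M -> b *m t = 1%:M ->
  adjmx b = sg *: b.
Proof.
move=> /herm_mxP th tb bt.
have: adjmx t *m adjmx b = 1%:M by rewrite -adjmxM bt adjmx1.
rewrite th mul_sign_mx -mulmx_sign => /(congr1 (mulmx b)).
by rewrite mulmxA bt mul1mx mulmx1 => bE; rewrite -{2}bE signmxK.
Qed.

Lemma herm_mx_inv n (t b : 'M[D]_n) : herm_mx eps t -> t *m b = 1%:M -> b *m t = 1%:M ->
  herm_mx eps (sg *: b).
Proof.
by move=> th tb bt; apply/herm_mxP; rewrite adjmx_sign (adjmx_inv th tb bt).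
Qed.

Definition nform_opp (q : nform D eps) : nform D eps :=
  NForm (herm_mxN (gram_herm q)) (invertibleN (gram_inv q)).

(** - eps t^-1 is the invariant that comes up when X and Y are exchanged. *)
Lemma congruent_opp_inv n (t b : 'M[D]_n) : herm_mx eps t -> b *m t = 1%:M ->
  t *m b = 1%:M -> congruent (- (sg *: b)) (- t).
Proof.
move=> /herm_mxP th bt tb; exists t; split; first by exists b.
by rewrite mulmxN mulNmx -mulmxA mul_sign_mx bt mulmx_sign mulmx1 th signmxK.
Qed.

(** The first block of columns of the matrix spans the diagonal (e, e) of t + (s - t), on which the
    form is s.  Its orthogonal complement consists of the (- t^-1 (s - t) b, b), and
    b = s^-1 normalizes the form on it. *)
Lemma congruent_cocycle n (t s t' s' : 'M[D]_n) :
  herm_mx eps t -> herm_mx eps s ->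
  t *m t' = 1%:M -> t' *m t = 1%:M -> s *m s' = 1%:M -> s' *m s = 1%:M ->
  congruent (block_mx t 0 0 (s - t)) (block_mx s 0 0 (sg *: t' - sg *: s')).
Proof.
move=> th sh tt' t't ss' s's.
have [t'J s'J] := (adjmx_inv th tt' t't, adjmx_inv sh ss' s's).
exists (block_mx 1%:M (s' - t') 1%:M s'); split.
  exists (block_mx (s' *m t) (1%:M - s' *m t) (- t) t).
  split; rewrite !mulmx_block scalar_mx_block; congr block_mx;
    rewrite !(mul1mx, mulmx1, mulmxBl, mulmxBr, mulmxN, mulNmx) -?mulmxA ?(tt', t't)
      ?ss' ?mulmx1 ?opprK;
    by [rewrite !(addrA, subrK, subrr, addNr, add0r) | rewrite addrC subrK
      | rewrite addrAC addNr add0r].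
rewrite adjmx_block !adjmx1 adjmxD adjmxN t'J s'J -!scalerBr.
rewrite !mulmx_block; congr block_mx;
  rewrite !(mul1mx, mulmx1, mul0mx, mulmx0, add0r, addr0, mulmxBl, mulmxBr, mul_sign_mx)
    -?mulmxA ?(tt', t't, ss', s's) ?(scaler0, addr0) ?mul_sign_mx -?scalerBr -?scalerDr.
- by rewrite addrC subrK.
- by rewrite addrA subrK subrr.
- by rewrite addrA subrK subrr scaler0.
rewrite !(mulmxBl, mulmxBr, mul1mx, mulmx1) -!mulmxA ?tt' ?mulmx1; congr (_ *: _).
by rewrite opprB addrAC subrKA subrr add0r.
Qed.

(** Let e, f, g be the bases of the three summands.  The vectors - (e + f) t^-1 and
    f + g span a hyperbolic form, with orthogonal complement spanned by e + f + g, on which the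
    form is t - t + t = t. *)
Lemma congruent_hyp n (t t' : 'M[D]_n) : herm_mx eps t ->
  t *m t' = 1%:M -> t' *m t = 1%:M ->
  congruent (block_mx (block_mx t 0 0 (- t)) 0 0 t) (block_mx (hyp_gram D eps n) 0 0 t).
Proof.
move=> th tt' t't; have t'J := adjmx_inv th tt' t't.
exists (block_mx (block_mx (- t') 0 (- t') 1%:M) (col_mx 1%:M 1%:M)
                 (row_mx 0 1%:M) 1%:M); split.
  exists (block_mx (block_mx 0 (- t) (- 1%:M) 1%:M) (col_mx t 0)
                   (row_mx 1%:M (- 1%:M)) 1%:M).
  rewrite !mulmx_block !mul_row_block !mul_block_col !mul_col_row !mul_row_col.
  rewrite !(mul_mx_row, mul_col_mx, add_col_mx, add_row_mx, add_block_mx).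
  rewrite !(mul1mx, mulmx1, mul0mx, mulmx0, mulmxN, mulNmx, oppr0, opprK, add0r, addr0) tt' t't.
  rewrite !(addNr, subrr, add0r) !scalar_mx_block -row_mx0 -col_mx0.
  by split; rewrite ?addrK.
rewrite !adjmx_block adjmx_col adjmx_row !adjmxN !adjmx0 !adjmx1 t'J /hyp_gram.
rewrite !(mulmx_block, mul_row_block, mul_block_col, mul_col_row, mul_row_col, mul_mx_row,
  mul_col_mx, add_col_mx, add_row_mx, add_block_mx, mul1mx, mulmx1, mul0mx, mulmx0,
  mulmxN, mulNmx, oppr0, opprK, add0r, addr0, mul_sign_mx, tt', t't).
rewrite -[X in row_mx X (col_mx 0 t)]col_mx0 -block_mxEh -block_mxEv add_block_mx.
rewrite !addr0 scalerN !(subrr, addNr) add0r scale_scalar_mx mulr1.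
by rewrite col_mx0 row_mx0.
Qed.

Lemma Witt_classD (k l : isoclass D eps) : Witt_class (k + l) = Witt_class k + Witt_class l.
Proof. by rewrite /Witt_class -raddfD /= gc_diffD addr0. Qed.

(** By [congruent_hyp], [t] + [-t] + [t] = [H] + [t] for a hyperbolic form H, and [t] cancels in
    the completion. *)
Lemma Witt_class_opp (q : nform D eps) :
  Witt_class (class_of (nform_opp q)) = - Witt_class (class_of q).
Proof.
have [b [qb bq]] := gram_inv q.
have hh : herm_mx eps (hyp_gram D eps (rk q)).
  apply/herm_mxP; rewrite /hyp_gram adjmx_block !adjmx0 adjmx1 scale_block_mx !scaler0.
  rewrite scale_scalar_mx -expr2 sqrr_sign -[1%:M in RHS]/(1%:M) scale_scalar_mx mulr1.
  congr block_mx; apply/matrixP => i j; rewrite !mxE eq_sym.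
  by case: eqP => _; rewrite ?mulr1n ?mulr0n ?invo_sign ?invo0.
have hi : invertible (hyp_gram D eps (rk q)).
  exists (block_mx 0 1%:M ((-1) ^+ eps)%:M 0).
  rewrite !mulmx_block !(mul0mx, mulmx0, addr0, add0r, mul1mx, mulmx1) -!scalar_mxM.
  by rewrite -!expr2 sqrr_sign -!scalar_mx_block.
pose h := NForm hh hi.
have e : class_of q + class_of (nform_opp q) + class_of q = class_of h + class_of q.
  rewrite -!class_ofD; apply/class_ofP => /=.
  exact: congruent_hyp (gram_herm q) qb bq.
apply/eqP; rewrite -addr_eq0 addrC -Witt_classD; apply/eqP.
rewrite -[0](raddf0 \pi_(Witt D eps)) /Witt_class; apply/quot_piP; rewrite subr0.
rewrite (_ : gc_diff _ _ = gc_diff (class_of h) 0).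
  by apply: gen_sub_gen; exists h, (rk q); split=> //; exact: congruent_refl.
by apply/gc_diffP; exists (class_of q); rewrite !addr0.
Qed.

End MatrixForms.

(** * The invariant of a triple of Lagrangians *)

Section Combinations.
Variables (D : invSkewFieldType) (s : bool) (M : hermMod D s).

(** The family x A, for x seen as a row of vectors. *)
Definition comb m n (x : 'I_m -> M) (A : 'M[D]_(m, n)) : 'I_n -> M :=
  fun j => lincomb x (A^~ j).

Lemma lincomb_comb m n (x : 'I_m -> M) (A : 'M[D]_(m, n)) (b : 'I_n -> D) :
  lincomb (comb x A) b = lincomb x (fun i => (A *m \col_j b j) i ord0).
Proof.
rewrite /lincomb /comb; under eq_bigr => j _.
  rewrite rscale_suml; under eq_bigr do rewrite rscaleA. over.
rewrite exchange_big; apply: eq_bigr => i _; rewrite mxE.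
rewrite /rscale scaler_suml; apply: eq_bigr => j _.
by rewrite mxE.
Qed.

Lemma combM m n p (x : 'I_m -> M) (A : 'M[D]_(m, n)) (B : 'M[D]_(n, p)) :
  comb (comb x A) B = comb x (A *m B).
Proof.
apply/funext => j; rewrite /comb lincomb_comb; congr lincomb; apply/funext => i.
by rewrite !mxE; apply: eq_bigr => k _; rewrite mxE.
Qed.

Lemma comb1 n (x : 'I_n -> M) : comb x 1%:M = x.
Proof.
apply/funext => j; rewrite -[RHS]lincomb_delta; congr lincomb; apply/funext => i.
by rewrite mxE.
Qed.

Lemma combD m n (x : 'I_m -> M) (A B : 'M[D]_(m, n)) j :
  comb x (A + B) j = comb x A j + comb x B j.
Proof. by rewrite /comb -lincombD; congr lincomb; apply/funext => i; rewrite mxE. Qed.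

Lemma comb_inj (X : set M) m n (x : 'I_m -> M) (A B : 'M[D]_(m, n)) :
  is_basis X x -> comb x A = comb x B -> A = B.
Proof.
move=> xX AB; apply/matrixP => i j.
exact: (basis_inj xX (congr1 (fun f => f j) AB)).
Qed.

Lemma basis_comb (X : set M) m n (x : 'I_m -> M) (A : 'M[D]_(m, n)) :
  is_basis X x -> invertible A -> is_basis X (comb x A).
Proof.
move=> [xX xfree] [B [AB BA]]; split=> [v|b]; rewrite -?/(lincomb _ _).
  split=> [/xX[a ->]|[b ->]].
    exists (fun j => (B *m \col_i a i) j ord0).
    rewrite -[LHS]/(lincomb x a) -[RHS]/(lincomb _ _) lincomb_comb.
    congr lincomb; apply/funext => i.
    rewrite (_ : \col_j _ = B *m \col_i a i); first by rewrite mulmxA AB mul1mx mxE.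
    by apply/matrixP => j k; rewrite [k]ord1 mxE.
  by rewrite -/(lincomb _ _) lincomb_comb; apply/xX; eexists.
rewrite lincomb_comb => /xfree b0 j.
have: A *m \col_j b j = 0 by apply/matrixP => i k; rewrite ord1 b0 mxE.
move=> /(congr1 (mulmx B)); rewrite mulmxA BA mul1mx mulmx0.
by move=> /matrixP/(_ j ord0); rewrite !mxE.
Qed.

Lemma basis_coords (X : set M) m n (x : 'I_m -> M) (v : 'I_n -> M) :
  is_basis X x -> (forall j, X (v j)) -> exists A, v = comb x A.
Proof.
move=> [xX _] Xv; have /choice[a aP] : forall j, exists a : 'I_m -> D, v j = lincomb x a.
  by move=> j; apply/xX.
exists (\matrix_(i, j) a j i); apply/funext => j; rewrite aP /comb; congr lincomb.
by apply/funext => i; rewrite mxE.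
Qed.

Lemma basis_change (X : set M) m n (x : 'I_m -> M) (x' : 'I_n -> M) :
  is_basis X x -> is_basis X x' -> exists A, invertible A /\ x' = comb x A.
Proof.
move=> xX x'X; have [A x'E] := basis_coords xX (fun j => basis_mem j x'X).
have [B xE] := basis_coords x'X (fun j => basis_mem j xX).
exists A; split=> //; exists B; split.
  by apply: (comb_inj xX); rewrite -combM -x'E -xE comb1.
by apply: (comb_inj x'X); rewrite -combM -xE -x'E comb1.
Qed.

Lemma combN m n (x : 'I_m -> M) (A : 'M[D]_(m, n)) j : comb x (- A) j = - comb x A j.
Proof.
apply: (addrI (comb x A j)); rewrite -combD !subrr.
by apply: big1 => i _; rewrite mxE rscale0.
Qed.

Definition gramf m n (x : 'I_m -> M) (y : 'I_n -> M) : 'M[D]_(m, n) :=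
  \matrix_(i, j) form (x i) (y j).

Lemma gramf_comb m n p q (x : 'I_m -> M) (y : 'I_n -> M) (A : 'M[D]_(m, p)) (B : 'M[D]_(n, q)) :
  gramf (comb x A) (comb y B) = adjmx A *m gramf x y *m B.
Proof.
apply/matrixP => i j; rewrite !mxE form_lincombr; apply: eq_bigr => l _.
rewrite form_lincombl mxE; congr (_ * _).
by apply: eq_bigr => k _; rewrite !mxE.
Qed.

Lemma gramf_Dl m n (x x' : 'I_m -> M) (y : 'I_n -> M) :
  gramf (fun i => x i + x' i) y = gramf x y + gramf x' y.
Proof. by apply/matrixP => i j; rewrite !mxE formDl. Qed.

Lemma gramf_Dr m n (x : 'I_m -> M) (y y' : 'I_n -> M) :
  gramf x (fun i => y i + y' i) = gramf x y + gramf x y'.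
Proof. by apply/matrixP => i j; rewrite !mxE formDr. Qed.

Lemma gramfP m n (x : 'I_m -> M) (y : 'I_n -> M) A :
  gramf x y = A <-> forall i j, form (x i) (y j) = A i j.
Proof.
split=> [<- i j|xy]; first by rewrite mxE.
by apply/matrixP => i j; rewrite mxE.
Qed.

Lemma gramf_lagr (X : lagrangian M) m n (x : 'I_m -> M) (y : 'I_n -> M) :
  (forall i, lset X (x i)) -> (forall i, lset X (y i)) -> gramf x y = 0.
Proof. by move=> Xx Xy; apply/gramfP => i j; rewrite (lagr_form (Xx i)) // mxE. Qed.

(** The family y + x t, a basis of the Lagrangian with invariant t. *)
Definition graph_of n (x y : 'I_n -> M) (t : 'M[D]_n) : 'I_n -> M := fun j => y j + comb x t j.

Lemma comb_graph_of n m (x y : 'I_n -> M) (t : 'M[D]_n) (A : 'M[D]_(n, m)) j :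
  comb (graph_of x y t) A j = comb y A j + comb x (t *m A) j.
Proof.
rewrite -combM /comb /lincomb -big_split; apply: eq_bigr => i _.
by rewrite rscaleDl.
Qed.

End Combinations.

Section Kappa.
Variables (D : invSkewFieldType) (eps : bool) (M : hermMod D (~~ eps)).
Implicit Types X Y Z W : lagrangian M.
Local Notation sg := ((-1) ^+ eps : D).

Lemma gramf_swap m n (x : 'I_m -> M) (y : 'I_n -> M) :
  gramf x y = - (sg *: adjmx (gramf y x)).
Proof. by apply/matrixP => i j; rewrite !mxE formC signrN mulrN sign_comm. Qed.

Definition dual_bases X Y n (x y : 'I_n -> M) :=
  [/\ is_basis X x, is_basis Y y, gramf y x = 1%:M & hyp_frame x y].

Lemma dual_basesI X Y n (x y : 'I_n -> M) : opposite X Y ->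
  is_basis X x -> is_basis Y y -> gramf y x = 1%:M -> dual_bases X Y x y.
Proof.
move=> XY xX yY yx; split=> //; apply: (opposite_hyp_frame XY) => // i j.
by move/gramfP: yx => ->; rewrite mxE.
Qed.

Lemma dual_bases_exist X Y n (x : 'I_n -> M) : opposite X Y -> is_basis X x ->
  exists y, dual_bases X Y x y.
Proof.
move=> XY xX; have [y [yY yx _]] := opposite_dual XY xX; exists y.
by apply: dual_basesI => //; apply/gramfP => i j; rewrite yx mxE.
Qed.

Section Graphs.
Variables (X Y : lagrangian M) (n : nat) (x y : 'I_n -> M).
Hypothesis xy : dual_bases X Y x y.

Lemma gramf_xx : gramf x x = 0.
Proof. by have [xX _ _ _] := xy; apply: (gramf_lagr (X := X)) => i; exact: basis_mem. Qed.

Lemma gramf_yy : gramf y y = 0.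
Proof. by have [_ yY _ _] := xy; apply: (gramf_lagr (X := Y)) => i; exact: basis_mem. Qed.

Lemma gramf_yx : gramf y x = 1%:M. Proof. by have [] := xy. Qed.

Lemma gramf_xy : gramf x y = - (sg *: 1%:M).
Proof. by rewrite gramf_swap gramf_yx adjmx1. Qed.

Lemma gramf_graph_x t : gramf (graph_of x y t) x = 1%:M.
Proof.
by rewrite gramf_Dl -{3}(comb1 x) gramf_comb gramf_xx mulmx0 mul0mx addr0 gramf_yx.
Qed.

Lemma gramf_graph_y t : gramf (graph_of x y t) y = - (sg *: adjmx t).
Proof.
rewrite gramf_Dl gramf_yy add0r -{1}(comb1 y) gramf_comb gramf_xy.
by rewrite mulmx1 mulmxN mulmx_sign mulmx1.
Qed.

Lemma gramf_graph_graph t : gramf (graph_of x y t) (graph_of x y t) = t - sg *: adjmx t.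
Proof.
rewrite gramf_Dr gramf_graph_y addrC; congr (_ + _).
by rewrite -(comb1 (graph_of x y t)) gramf_comb gramf_graph_x adjmx1 !mul1mx.
Qed.

(** The basis z of Z dual to x has the same products with x as y, so the z_i - y_i are
    orthogonal to X and hence in X; t is hermitian because Z is isotropic. *)
Lemma graph_exists Z : opposite X Z -> exists t, herm_mx eps t /\ is_basis Z (graph_of x y t).
Proof.
move=> XZ; have [xX _ _ _] := xy; have [z [_ zZ zx _]] := dual_bases_exist XZ xX.
have [t zyt] : exists t, (fun i => z i - y i) = comb x t.
  apply: (basis_coords xX) => i; rewrite lset_perp => _ /(proj1 xX)[a ->].
  rewrite -/(lincomb _ _) form_lincombl big1 // => j _.
  rewrite formBr (formC (x j) (z i)) (formC (x j) (y i)).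
  move/gramfP: zx => ->; move/gramfP: gramf_yx => ->.
  by rewrite subrr mulr0.
have zE : z = graph_of x y t by apply/funext => i; rewrite /graph_of -zyt addrC subrK.
exists t; split; last by rewrite -zE.
apply/herm_mxP; have := gramf_graph_graph t; rewrite -zE (gramf_lagr (X := Z)).
- by move=> /esym/eqP; rewrite subr_eq0 => /eqP tE; rewrite {2}tE signmxK.
- by move=> i; exact: basis_mem.
- by move=> i; exact: basis_mem.
Qed.

(** The difference of the two families lies in X and in Z. *)
Lemma graph_unique Z t t' : opposite X Z ->
  (forall i, lset Z (graph_of x y t i)) -> (forall i, lset Z (graph_of x y t' i)) -> t = t'.
Proof.
move=> /oppositeP XZ Zt Zt'; have [xX _ _ _] := xy; apply: (comb_inj xX).
apply/funext => j; apply/eqP; rewrite -subr_eq0; apply/eqP; apply: XZ.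
  apply: subspace_sub; first exact: lagr_subspace.
    by apply/(proj1 xX); eexists.
  by apply/(proj1 xX); eexists.
have -> : comb x t j - comb x t' j = graph_of x y t j - graph_of x y t' j.
  by rewrite /graph_of opprD addrACA subrr add0r.
by apply: subspace_sub => //; exact: lagr_subspace.
Qed.

(** The Gram matrix of Z against Y in these bases is - t, and it is invertible as Y has a dual
    basis in Z. *)
Lemma graph_invertible Z t : opposite Y Z -> herm_mx eps t ->
  is_basis Z (graph_of x y t) -> invertible t.
Proof.
move=> YZ th zZ; have [_ yY _ _] := xy; have [z' [_ z'Z z'y _]] := dual_bases_exist YZ yY.
have [B [Binv z'E]] := basis_change zZ z'Z.
move: z'y; rewrite z'E -[X in gramf _ X](comb1 y) gramf_comb gramf_graph_y mulmx1.
move/herm_mxP: th => ->; rewrite signmxK => Bt.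
have [C [BC CB]] := invertible_adj Binv.
have tC : - t = C by rewrite -[LHS]mul1mx -CB -mulmxA Bt mulmx1.
by rewrite -[t]opprK tC; apply: invertibleN; exists (adjmx B).
Qed.

End Graphs.

Lemma is_kappaI X Y Z n (x y : 'I_n -> M) t (th : herm_mx eps t) (ti : invertible t) :
  dual_bases X Y x y -> is_basis Z (graph_of x y t) -> is_kappa X Y Z (NForm th ti).
Proof.
by move=> [xX yY /gramfP yx _] zZ; exists x, y; split=> // i j; rewrite yx mxE.
Qed.

Lemma is_kappaE X Y Z t : opposite X Y -> is_kappa X Y Z t ->
  exists x y : 'I_(rk t) -> M, dual_bases X Y x y /\ is_basis Z (graph_of x y (gram t)).
Proof.
move=> XY [x [y [xX yY yx zZ]]]; exists x, y; split=> //.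
by apply: dual_basesI => //; apply/gramfP => i j; rewrite yx mxE.
Qed.

(** A change of basis x' = x A forces y' = y B with B^-1 = A^J, and then t = A t' A^J. *)
Lemma is_kappa_unique X Y Z t t' : opposite X Y -> opposite X Z ->
  is_kappa X Y Z t -> is_kappa X Y Z t' -> class_of t = class_of t'.
Proof.
move=> XY XZ /(is_kappaE XY)[x [y [xy zZ]]] /(is_kappaE XY)[x' [y' [xy' zZ']]].
have [[xX yY yx _] [x'X y'Y y'x' _]] := (xy, xy').
have [A [Ainv x'E]] := basis_change xX x'X; have [B [Binv y'E]] := basis_change yY y'Y.
move: y'x'; rewrite x'E y'E gramf_comb yx mulmx1 => BA.
have [C [AC CA]] := Ainv.
have BC : adjmx B = C by rewrite -[LHS]mulmx1 -AC mulmxA BA mul1mx.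
have BA1 : B *m adjmx A = 1%:M by rewrite -[B]adjmxK BC -adjmxM AC adjmx1.
apply/class_ofP; apply: congruent_sym; exists (adjmx A); split; first exact: invertible_adj.
rewrite adjmxK; apply: (graph_unique xy XZ) => j; last exact: basis_mem.
have Zz : lset Z (comb (graph_of x' y' (gram t')) (adjmx A) j).
  by apply: subspace_lincomb; [exact: lagr_subspace | move=> i; exact: basis_mem].
by move: Zz; rewrite comb_graph_of x'E y'E !combM BA1 comb1 mulmxA.
Qed.

Lemma kappaE X Y Z t : opposite X Y -> opposite X Z -> is_kappa X Y Z t ->
  kappa X Y Z = class_of t.
Proof.
move=> XY XZ tk; rewrite /kappa; case: xgetP => [_ _ [t' [t'k ->]]|N].
  exact: is_kappa_unique t'k tk.
by case: (N (class_of t)); exists t.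
Qed.

Lemma kappa_exists X Y Z : nonsingular M -> opposite X Y -> opposite X Z -> opposite Y Z ->
  exists t, is_kappa X Y Z t.
Proof.
move=> Mns XY XZ YZ; have [n [x xX]] := lagr_basis X Mns.
have [y xy] := dual_bases_exist XY xX; have [t [th zZ]] := graph_exists xy XZ.
by eexists; exact: (is_kappaI th (graph_invertible xy YZ th zZ) xy zZ).
Qed.

(** y = (y + x t) + x (- t). *)
Lemma is_kappa_swap23 X Y Z t : opposite X Y -> opposite X Z ->
  is_kappa X Y Z t -> is_kappa X Z Y (nform_opp t).
Proof.
move=> XY XZ /(is_kappaE XY)[x [y [xy zZ]]]; have [xX yY _ _] := xy.
have xz := dual_basesI XZ xX zZ (gramf_graph_x xy (gram t)).
apply: (is_kappaI _ _ xz) => /=.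
rewrite (_ : graph_of _ _ _ = y) //; apply/funext => j.
by rewrite /graph_of combN addrK.
Qed.

(** The basis of X dual to y is - eps x, and - eps (y + x t) t^-1 = - eps x + y (- eps t^-1). *)
Lemma is_kappa_swap12 X Y Z t : opposite X Y -> is_kappa X Y Z t ->
  exists r, is_kappa Y X Z r /\ class_of r = class_of (nform_opp t).
Proof.
move=> XY /(is_kappaE XY)[x [y [xy zZ]]]; have [xX yY _ _] := xy.
have [b [tb bt]] := gram_inv t.
have yx' : dual_bases Y X y (comb x (- (sg *: 1%:M))).
  apply: dual_basesI => //; first exact: oppositeC.
    apply: basis_comb => //; apply: invertibleN; apply: invertible_sign.
    by exists 1%:M; rewrite mulmx1.
  rewrite -[X in gramf _ X](comb1 y) gramf_comb (gramf_xy xy) adjmxN adjmx_sign adjmx1.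
  by rewrite mulmx1 mulmxN mulNmx opprK mulmx_sign mulmx1 signmxK.
have ri : invertible (- (sg *: b)) by apply/invertibleN/invertible_sign; exists (gram t).
have rh := herm_mxN (herm_mx_inv (gram_herm t) tb bt).
exists (NForm rh ri); split; last first.
  by apply/class_ofP; exact: congruent_opp_inv (gram_herm t) bt tb.
apply: (is_kappaI _ _ yx') => /=.
rewrite (_ : graph_of _ _ _ = comb (graph_of x y (gram t)) (- (sg *: b))).
  exact: basis_comb.
by apply/funext => j; rewrite comb_graph_of mulmxN mulmx_sign tb addrC.
Qed.

(** With Z and W the graphs of t and s, W is the graph of s - t over the bases x of X and y + x t
    of Z, and the graph of eps (t^-1 - s^-1) over the bases y of Y and z' = - eps (y + x t) t^-1
    of Z. *)
Lemma kappa_cocycle X Y Z W : nonsingular M ->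
  opposite X Y -> opposite X Z -> opposite X W -> opposite Y Z -> opposite Y W ->
  opposite Z W -> kappa X Y Z + kappa X Z W = kappa X Y W + kappa Y Z W.
Proof.
move=> Mns XY XZ XW YZ YW ZW; have [n [x xX]] := lagr_basis X Mns.
have [y xy] := dual_bases_exist XY xX; have [_ yY _ _] := xy.
have [t [th zZ]] := graph_exists xy XZ; have ti := graph_invertible xy YZ th zZ.
have [s [sh wW]] := graph_exists xy XW; have si := graph_invertible xy YW sh wW.
have [[t' [tt' t't]] [s' [ss' s's]]] := (ti, si).
have xz := dual_basesI XZ xX zZ (gramf_graph_x xy t).
have rh : herm_mx eps (s - t) by apply: herm_mxD => //; exact: herm_mxN.
have wW1 : is_basis W (graph_of x (graph_of x y t) (s - t)).
  rewrite (_ : graph_of x _ _ = graph_of x y s) //; apply/funext => j.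
  by rewrite /graph_of -addrA -combD [t + _]addrC subrK.
have ri := graph_invertible xz ZW rh wW1.
pose z' := comb (graph_of x y t) (- (sg *: t')).
have yz' : dual_bases Y Z y z'.
  apply: dual_basesI => //.
    by apply: basis_comb zZ _; apply/invertibleN/invertible_sign; exists t.
  rewrite -[X in gramf _ X](comb1 y) gramf_comb (gramf_graph_y xy) mulmx1.
  rewrite adjmxN adjmx_sign mulmxN mulNmx opprK mulmx_sign mul_sign_mx signmxK.
  by rewrite -adjmxM tt' adjmx1.
have qh : herm_mx eps (sg *: t' - sg *: s').
  apply: herm_mxD; first exact: herm_mx_inv th tt' t't.
  by apply: herm_mxN; exact: herm_mx_inv sh ss' s's.
have wW2 : is_basis W (graph_of y z' (sg *: t' - sg *: s')).
  rewrite (_ : graph_of y _ _ = comb (graph_of x y s) (- (sg *: s'))).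
    by apply: basis_comb wW _; apply/invertibleN/invertible_sign; exists s.
  apply/funext => j; rewrite /graph_of /z' !comb_graph_of !mulmxN !mulmx_sign tt' ss'.
  by rewrite addrAC -combD addrA addNr add0r.
have qi := graph_invertible yz' ZW qh wW2.
rewrite (kappaE XY XZ (is_kappaI th ti xy zZ)) (kappaE XZ XW (is_kappaI rh ri xz wW1)).
rewrite (kappaE XY XW (is_kappaI sh si xy wW)) (kappaE YZ YW (is_kappaI qh qi yz' wW2)).
rewrite -!class_ofD; apply/class_ofP => /=.
exact: (congruent_cocycle th sh tt' t't ss' s's).
Qed.

Definition adjacent X Y := X = Y \/ opposite X Y.

Lemma adjacentC X Y : adjacent X Y -> adjacent Y X.
Proof. by move=> [->|/oppositeC XY]; [left | right]. Qed.

Lemma maslov_deg X Y Z : [|| X == Y, Y == Z | X == Z] -> maslov X Y Z = 0.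
Proof. by rewrite /maslov => ->. Qed.

Lemma maslovE X Y Z : X != Y -> Y != Z -> X != Z -> maslov X Y Z = Witt_class (kappa X Y Z).
Proof. by rewrite /maslov => /negPf-> /negPf-> /negPf->. Qed.

Lemma adjacent_opposite X Y : adjacent X Y -> X != Y -> opposite X Y.
Proof. by move=> [->|//]; rewrite eqxx. Qed.

Lemma maslov_swap23 X Y Z : nonsingular M -> adjacent X Y -> adjacent X Z -> adjacent Y Z ->
  maslov X Z Y = - maslov X Y Z.
Proof.
move=> Mns aXY aXZ aYZ; have [deg|] := boolP [|| X == Y, Y == Z | X == Z].
  rewrite !maslov_deg ?oppr0 // (eq_sym Z).
  by case/or3P: deg => ->; rewrite ?orbT.
move=> /norP[nXY /norP[nYZ nXZ]].
have [XY XZ YZ] := And3 (adjacent_opposite aXY nXY) (adjacent_opposite aXZ nXZ)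
  (adjacent_opposite aYZ nYZ).
rewrite !maslovE // 1?eq_sym //; have [t tk] := kappa_exists Mns XY XZ YZ.
rewrite (kappaE XY XZ tk) (kappaE XZ XY (is_kappa_swap23 XY XZ tk)).
exact: Witt_class_opp.
Qed.

Lemma maslov_swap12 X Y Z : nonsingular M -> adjacent X Y -> adjacent X Z -> adjacent Y Z ->
  maslov Y X Z = - maslov X Y Z.
Proof.
move=> Mns aXY aXZ aYZ; have [deg|] := boolP [|| X == Y, Y == Z | X == Z].
  rewrite !maslov_deg ?oppr0 // (eq_sym Y X).
  by case/or3P: deg => ->; rewrite ?orbT.
move=> /norP[nXY /norP[nYZ nXZ]].
have [XY XZ YZ] := And3 (adjacent_opposite aXY nXY) (adjacent_opposite aXZ nXZ)
  (adjacent_opposite aYZ nYZ).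
rewrite !maslovE // 1?eq_sym //; have [t tk] := kappa_exists Mns XY XZ YZ.
have [r [rk rt]] := is_kappa_swap12 XY tk.
rewrite (kappaE XY XZ tk) (kappaE (oppositeC XY) YZ rk) rt.
exact: Witt_class_opp.
Qed.

(** For distinct vertices this is [kappa_cocycle]; the degenerate tuples follow from the
    fact that the cochain is alternating. *)
Lemma maslov_cocycle X Y Z W : nonsingular M ->
  adjacent X Y -> adjacent X Z -> adjacent X W -> adjacent Y Z -> adjacent Y W ->
  adjacent Z W ->
  maslov Y Z W - maslov X Z W + maslov X Y W - maslov X Y Z = 0.
Proof.
move=> Mns aXY aXZ aXW aYZ aYW aZW.
have deg12 (A B : lagrangian M) : maslov A A B = 0 by rewrite maslov_deg ?eqxx.
have deg23 (A B : lagrangian M) : maslov A B B = 0 by rewrite maslov_deg ?eqxx ?orbT.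
have deg13 (A B : lagrangian M) : maslov A B A = 0 by rewrite maslov_deg ?eqxx ?orbT.
have [e|nXY] := eqVneq X Y; first by subst Y; rewrite !deg12 subrr add0r subr0.
have [e|nZW] := eqVneq Z W; first by subst W; rewrite !deg23 subrr add0r subrr.
have [e|nYZ] := eqVneq Y Z; first by subst Z; rewrite deg12 deg23 subr0 sub0r addNr.
have [e|nXZ] := eqVneq X Z.
  by subst Z; rewrite deg12 deg13 !subr0 (maslov_swap12 Mns aXY aXW aYW) addNr.
have [e|nYW] := eqVneq Y W.
  by subst W; rewrite deg13 deg23 addr0 (maslov_swap23 Mns aXY aXZ aYZ) sub0r opprK subrr.
have [e|nXW] := eqVneq X W.
  subst W; rewrite !deg13 subr0 addr0 (maslov_swap23 Mns (adjacentC aXY) aYZ aXZ).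
  by rewrite (maslov_swap12 Mns aXY aXZ aYZ) opprK subrr.
have E : maslov X Y W + maslov Y Z W = maslov X Y Z + maslov X Z W.
  rewrite !maslovE // -!Witt_classD kappa_cocycle //; exact: adjacent_opposite.
by rewrite [X in X - _]addrAC [X in X - _ - _]addrC E addrK subrr.
Qed.

End Kappa.

(** * The Maslov class *)

Section MaslovCocycle.
Variables (D : invSkewFieldType) (eps : bool) (M : hermMod D (~~ eps)).
Hypothesis Mns : nonsingular M.
Implicit Types X Y Z : lagrangian M.

Lemma unitary_lincomb (g : 'U(M)) n (x : 'I_n -> M) (a : 'I_n -> D) :
  g (lincomb x a) = lincomb (g \o x) a.
Proof.
rewrite /lincomb (big_morph g (ufunD g) (_ : g 0 = 0)).
  by apply: eq_bigr => i _; rewrite ufunZ.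
by apply: (addrI (g 0)); rewrite -ufunD !addr0.
Qed.

Lemma basis_act (g : 'U(M)) X n (x : 'I_n -> M) :
  is_basis X x -> is_basis (lagr_act g X) (g \o x).
Proof.
move=> [xX xfree]; split=> [v|a].
  split=> [[u /xX[a ->] <-]|[a ->]]; first by exists a; exact: unitary_lincomb.
  by exists (lincomb x a); [apply/xX; exists a | exact: unitary_lincomb].
rewrite -/(lincomb _ _) -unitary_lincomb => ga; apply: xfree; rewrite -/(lincomb _ _).
apply: (can_inj (ufunK g)); rewrite ga; symmetry.
by apply: (addrI (g 0)); rewrite -ufunD !addr0.
Qed.

Lemma is_kappa_act (g : 'U(M)) X Y Z t : is_kappa X Y Z t ->
  is_kappa (lagr_act g X) (lagr_act g Y) (lagr_act g Z) t.
Proof.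
move=> [x [y [xX yY yx zZ]]]; exists (g \o x), (g \o y); split; try exact: basis_act.
  by move=> i j; rewrite /= ufun_form.
have := basis_act g zZ; congr is_basis; apply/funext => j /=.
by rewrite ufunD -/(lincomb _ _) unitary_lincomb.
Qed.

Lemma lagr_actK (g : 'U(M)) : cancel (lagr_act g) (lagr_act g^-1%g).
Proof. by move=> X; rewrite -lagr_actM mulVg lagr_act1. Qed.

Lemma maslov_act (g : 'U(M)) X Y Z :
  maslov (lagr_act g X) (lagr_act g Y) (lagr_act g Z) = maslov X Y Z.
Proof.
rewrite /maslov !(inj_eq (can_inj (lagr_actK g))); case: ifP => // _.
congr Witt_class; congr xget; apply/seteqP; split=> k [t [tk ->]]; exists t; split=> //.
  by have := is_kappa_act g^-1%g tk; rewrite !lagr_actK.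
exact: is_kappa_act.
Qed.

Fact maslov_supp s z : ~ cell (X := Fl M) 2 s z -> maslov_fun s z = 0.
Proof.
case: s => [|g [|]] //; case: z => [|X [|Y [|Z [|]]]] //= Nsz.
by case: asboolP => // zX; case: Nsz; split.
Qed.

Fact maslov_inv (g : 'U(M)) s (z : seq (lagrangian M)) :
  maslov_fun [seq (g * x)%g | x <- s] (map (lagr_act g) z) = maslov_fun s z.
Proof.
case: s => [|h [|h' s]] //; case: z => [|X [|Y [|Z [|]]]] //=.
by rewrite maslov_act (asbool_equiv_eq (@simplex_actE _ (Fl M) g [:: X; Y; Z])).
Qed.

Definition maslov_cochain : cochain (Fl M) (Witt D eps) 2 :=
  @Cochain _ (Fl M) _ _ _ maslov_supp maslov_inv.

(** In bidegree (0, 3) this is [maslov_cocycle]; in bidegree (1, 2) the values at the two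
    group elements cancel, as the cochain does not depend on the group variable. *)
Lemma maslov_cochain_diff : cochain_diff maslov_cochain = 0.
Proof.
apply: cochainP => s z; rewrite [RHS]/=.
have [[s0 zX sz]|] := pselect (cell (X := Fl M) 3 s z); last exact: cochain_supp.
rewrite cochain_diffE; last by right.
have dX i : (i < size z)%N -> (1 < size z)%N -> fl_simplex (del i z).
  exact: (@simplex_del _ (Fl M)).
case: s s0 sz => [//|g [|g1 s]] _ sz.
  case: z zX dX sz => [|X [|Y [|Z [|W [|V z]]]]] //= zX dX _.
  rewrite !big_ord_recr !big_ord0 /= !asboolT; try by [exact: (dX 0) | exact: (dX 1)
    | exact: (dX 2) | exact: (dX 3)].
  have [_ adj] := zX; have {}adj A B : A \in [:: X; Y; Z; W] -> B \in [:: X; Y; Z; W] ->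
    adjacent A B by exact: adj.
  rewrite -[RHS](@maslov_cocycle _ _ _ X Y Z W) //; last 6 first.
  - by apply: adj; rewrite !inE eqxx ?orbT.
  - by apply: adj; rewrite !inE eqxx ?orbT.
  - by apply: adj; rewrite !inE eqxx ?orbT.
  - by apply: adj; rewrite !inE eqxx ?orbT.
  - by apply: adj; rewrite !inE eqxx ?orbT.
  - by apply: adj; rewrite !inE eqxx ?orbT.
  by rewrite mul0rz !add0r.
rewrite [X in _ + X]big1 ?addr0 => [|j _]; last by rewrite /= mul0rz.
case: s sz => [|g2 s] sz.
  rewrite !big_ord_recr big_ord0 /= add0r expr0 expr1 mulrNz !mulr1z.
  exact: subrr.
rewrite big1 // => i _; rewrite [maslov_cochain _ _]/=.
have: size (del i [:: g, g1, g2 & s]) = (size s).+2 by rewrite size_del.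
by case: (del i _) => [|? [|? ?]] //=; rewrite mul0rz.
Qed.

(** A Lagrangian opposite to all vertices of the given simplices is the apex. *)
Lemma Fl_cones : infinite_set [set a : D | a - invo a * (-1) ^+ eps = 0]%classic ->
  inhabited (lagrangian M) -> has_cones (Fl M).
Proof.
move=> Dinf M0 zs zsX; have [W Wopp] := opposite_to_all (flatten zs) Dinf Mns M0.
exists W; elim: zs zsX Wopp => //= z zs IHzs /andP[zX zsX] Wopp.
rewrite IHzs //= ?andbT; last by move=> Z Zzs; apply: Wopp; rewrite mem_cat Zzs orbT.
apply/asboolP; right; split=> // X Y; rewrite !inE.
have zadj A B : A \in z -> B \in z -> adjacent A B.
  by move/asboolP: zX => [->//|[_]]; apply.
have Wz A : A \in z -> opposite W A by move=> Az; apply: Wopp; rewrite mem_cat Az.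
move=> /predU1P[->|Xz] /predU1P[->|Yz]; first by left.
- by right; exact: Wz.
- by right; apply/oppositeC/Wz.
- exact: zadj.
Qed.

Lemma maslov_classP : infinite_set [set a : D | a - invo a * (-1) ^+ eps = 0]%classic ->
  inhabited (lagrangian M) ->
  exists c : cocycles (eq_complex (Fl M) (Witt D eps)) 2,
    cochain_fun (cocycle_val c) = @maslov_fun D eps M /\
    H_map (aug_cmap (Fl M) (Witt D eps)) (maslov_class M) = coh_class c.
Proof.
move=> Dinf M0; rewrite /maslov_class; case: xgetP => [m _ //|N].
have cP : maslov_cochain \in @cocycle (eq_complex (Fl M) (Witt D eps)) 2.
  by apply/eqP; exact: maslov_cochain_diff.
have [m mE] := H_aug_surj (Fl_cones Dinf M0) (coh_class (Cocycle cP)).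
by case: (N m); exists (Cocycle cP).
Qed.

End MaslovCocycle.

(** * Extension of scalars *)

Section Extension.
Variables (D E : invSkewFieldType) (phi : invMorph D E).

Lemma morph_eq0 a : phi a = 0 -> a = 0.
Proof.
move=> /eqP pa; apply/eqP; apply: contraTT pa => /skew_unit/(rmorph_unit phi) pa.
by apply: contraTneq pa => ->; rewrite unitr0.
Qed.

Lemma morph_inj : injective phi.
Proof.
move=> a b /eqP; rewrite -subr_eq0 -rmorphB => /eqP/morph_eq0/eqP.
by rewrite subr_eq0 => /eqP.
Qed.

Lemma herm_infinite (eps : bool) :
  infinite_set [set a : D | a - invo a * (-1) ^+ eps = 0]%classic ->
  infinite_set [set a : E | a - invo a * (-1) ^+ eps = 0]%classic.
Proof.
move=> Dinf Efin; apply: Dinf.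
have: finite_set (phi @^-1` [set a : E | a - invo a * (-1) ^+ eps = 0])%classic.
  by apply: finite_preimage => // a b _ _; exact: morph_inj.
apply: sub_finite_set => a /= aH.
by rewrite -im_invo -(rmorph_sign phi) -rmorphM -rmorphB aH rmorph0.
Qed.

Section Embedding.
Variables (s : bool) (M : hermMod D s).
Local Notation ME := (ext_mod phi M).

Definition temb (m : M) : ME := tens phi m 1.

Lemma form_temb u v : form (temb u) (temb v) = phi (form u v).
Proof.
by rewrite [LHS]ext_formE /ext_sum !big_seq1 /= invo1 mul1r mulr1.
Qed.

Lemma tens0l e : tens phi (0 : M) e = 0.
Proof. by apply: (addrI (tens phi (0 : M) e)); rewrite -tensDl !addr0. Qed.

Lemma tens_lincomb n (x : 'I_n -> M) (a : 'I_n -> D) e :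
  tens phi (lincomb x a) e = lincomb (temb \o x) (fun i => phi (a i) * e) :> ME.
Proof.
rewrite /lincomb (big_morph (fun m => tens phi m e) (fun m m' => tensDl phi m m' e) (tens0l e)).
apply: eq_bigr => i _; rewrite tens_bal.
by rewrite -[RHS]/(rscale (M := tensor phi M) _ _) tensZ mul1r.
Qed.

Lemma temb_lincomb n (x : 'I_n -> M) (a : 'I_n -> D) :
  temb (lincomb x a) = lincomb (temb \o x) (phi \o a).
Proof. by rewrite /temb tens_lincomb; congr lincomb; apply/funext => i /=; rewrite mulr1. Qed.

Lemma temb_hyp_frame n (x y : 'I_n -> M) : hyp_frame x y -> hyp_frame (temb \o x) (temb \o y).
Proof.
move=> [xx yy yx span]; split=> [i j|i j|i j|v].
- by rewrite [LHS]form_temb xx rmorph0.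
- by rewrite [LHS]form_temb yy rmorph0.
- by rewrite [LHS]form_temb yx rmorph_nat.
elim/tens_sum_ind: v; elim=> [|[m e] l [a [b IHl]]].
  by exists (fun=> 0), (fun=> 0); rewrite !lincomb0 addr0.
have [a' [b' mE]] := span m; rewrite tens_sum_cons IHl /= mE tensDl !tens_lincomb.
exists (fun i => phi (a' i) * e + a i), (fun i => phi (b' i) * e + b i).
by rewrite !lincombD; exact: addrACA.
Qed.

Lemma temb_eq0 v : nonsingular M -> temb v = 0 -> v = 0.
Proof.
move=> [N [e [_ e0]]] v0; apply: e0 => i; apply: morph_eq0.
by rewrite -form_temb v0 form0r.
Qed.

(** X (x) E, described by orthogonality to the image of X, which is legitimate as X is its
    own perpendicular ([ext_set_span]).  In this form functoriality is immediate. *)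
Definition ext_set (X : set M) : set ME := perp (temb @` X)%classic.

Lemma ext_setP (X : set M) w : ext_set X w <-> forall u, X u -> form (temb u) w = 0.
Proof. by split=> [Xw u Xu|Xw _ [u Xu <-]]; [apply: Xw; exists u | exact: Xw]. Qed.

Lemma ext_set_temb (X : lagrangian M) v : ext_set X (temb v) <-> lset X v.
Proof.
rewrite ext_setP; split=> [Xv|Xv u Xu].
  by rewrite lset_perp => u Xu; apply: morph_eq0; rewrite -form_temb Xv.
by rewrite form_temb (lagr_form Xu Xv) rmorph0.
Qed.

Lemma ext_set_span (X : lagrangian M) n (x y : 'I_n -> M) w : is_basis X x ->
  hyp_frame x y -> ext_set X w <-> exists a : 'I_n -> E, w = lincomb (temb \o x) a.
Proof.
move=> xX xy; rewrite ext_setP -(hyp_frame_spanx _ (temb_hyp_frame xy)).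
split=> [Xw i|xw u /(proj1 xX)[a ->]]; first by apply: Xw; exact: basis_mem.
by rewrite -/(lincomb _ _) temb_lincomb form_lincombl big1 // => i _; rewrite xw mulr0.
Qed.

Lemma ext_set_act (g : 'U(M)) (X : set M) :
  ext_set (g @` X)%classic = (unitary_ext phi M g @` ext_set X)%classic.
Proof.
have gt u : unitary_ext phi M g (temb u) = temb (g u) by exact: tens_mapE.
apply/seteqP; split=> [w gXw|_ [w Xw <-]]; last first.
  apply/ext_setP => _ [u Xu <-]; rewrite -gt ufun_form.
  by move/ext_setP: Xw; apply.
exists (uinv (unitary_ext phi M g) w); last exact: uinvK.
apply/ext_setP => u Xu; rewrite -(ufun_form (unitary_ext phi M g)) uinvK gt.
by move/ext_setP: gXw; apply; exists u.
Qed.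

End Embedding.
Arguments temb {s M}.

Section ExtLagrangian.
Variables (eps : bool) (M : hermMod D (~~ eps)).
Hypothesis Mns : nonsingular M.
Hypothesis Mopp : forall X : lagrangian M, exists Y, opposite X Y.
Local Notation ME := (ext_mod phi M).
Implicit Types X Y Z : lagrangian M.

Lemma frame_of_basis X n (x : 'I_n -> M) : is_basis X x -> exists y, hyp_frame x y.
Proof.
move=> xX; have [Y XY] := Mopp X; have [y [_ _ _ xy]] := dual_bases_exist XY xX.
by exists y.
Qed.

(** A basis of X extends to a frame of M, whose extension is a frame of M (x) E. *)
Fact ext_set_perp X : ext_set X = perp (ext_set X).
Proof.
have [n [x xX]] := lagr_basis X Mns; have [y xy] := frame_of_basis xX.
have [xx _ _ _] := temb_hyp_frame xy; apply/seteqP; split=> w.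
  move=> /(ext_set_span _ xX xy)[a ->] _ /(ext_set_span _ xX xy)[b ->].
  rewrite form_lincombl big1 // => i _; rewrite form_lincombr big1 ?mulr0 // => j _.
  by rewrite xx mul0r.
move=> Xw; apply/(ext_set_span _ xX xy)/(hyp_frame_spanx _ (temb_hyp_frame xy)) => i.
by apply: Xw; apply/ext_set_temb; exact: basis_mem.
Qed.

Definition ext_lagr X : lagrangian ME := Lagrangian (ext_set_perp X).

Lemma ext_lagr_act (g : 'U(M)) X :
  ext_lagr (lagr_act g X) = lagr_act (unitary_ext phi M g) (ext_lagr X).
Proof. by apply: lagrangianP; exact: ext_set_act. Qed.

(** X is recovered as the set of v with v (x) 1 in X (x) E. *)
Lemma ext_lagr_inj : injective ext_lagr.
Proof.
move=> X Y XY; apply: lagrangianP; apply/seteqP; split=> v.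
  by move=> /ext_set_temb; rewrite -[ext_set X]/(lset (ext_lagr X)) XY => /ext_set_temb.
by move=> /ext_set_temb; rewrite -[ext_set Y]/(lset (ext_lagr Y)) -XY => /ext_set_temb.
Qed.

Lemma ext_basis X n (x : 'I_n -> M) : is_basis X x -> is_basis (ext_lagr X) (temb \o x).
Proof.
move=> xX; have [y xy] := frame_of_basis xX; split.
  by move=> w; exact: (ext_set_span w xX xy).
by move=> a; exact: (hyp_frame_freex (temb_hyp_frame xy)).
Qed.

Lemma ext_opposite X Y : opposite (ext_lagr X) (ext_lagr Y) <-> opposite X Y.
Proof.
split=> [/oppositeP XY|XY].
  apply/oppositeP => v Xv Yv; apply: (@temb_eq0 _ M _ Mns).
  by apply: XY; apply/ext_set_temb.
have [n [x xX]] := lagr_basis X Mns; have [y [_ yY _ xy]] := dual_bases_exist XY xX.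
apply/oppositeP => w /ext_setP Xw /ext_setP Yw; apply: (hyp_frame_eq0 (temb_hyp_frame xy)) => i.
  by apply: Xw; exact: basis_mem.
by apply: Yw; exact: basis_mem.
Qed.

Lemma ext_is_kappa X Y Z t :
  is_kappa X Y Z t -> is_kappa (ext_lagr X) (ext_lagr Y) (ext_lagr Z) (nform_map phi t).
Proof.
move=> [x [y [xX yY yx zZ]]]; exists (temb \o x), (temb \o y); split.
- exact: ext_basis.
- exact: ext_basis.
- by move=> i j; rewrite [LHS]form_temb yx rmorph_nat.
have := ext_basis zZ; congr is_basis; apply/funext => j /=.
rewrite [LHS]tensDl; congr (_ + _).
rewrite -[LHS]/(temb (lincomb x (fun i => gram t i j))) temb_lincomb.
by apply: eq_bigr => i _; rewrite /= mxE.
Qed.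

Lemma ext_maslov X Y Z : adjacent X Y -> adjacent X Z -> adjacent Y Z ->
  maslov (ext_lagr X) (ext_lagr Y) (ext_lagr Z) = Witt_ext phi eps (maslov X Y Z).
Proof.
move=> aXY aXZ aYZ; have [deg|] := boolP [|| X == Y, Y == Z | X == Z].
  by rewrite !maslov_deg ?raddf0 // !(inj_eq ext_lagr_inj).
move=> /norP[nXY /norP[nYZ nXZ]].
have [XY XZ YZ] := And3 (adjacent_opposite aXY nXY) (adjacent_opposite aXZ nXZ)
  (adjacent_opposite aYZ nYZ).
have [t tk] := kappa_exists Mns XY XZ YZ.
rewrite !maslovE ?(inj_eq ext_lagr_inj) // Witt_ext_class (kappaE XY XZ tk) iso_mapE.
by rewrite (kappaE _ _ (ext_is_kappa tk)) //; exact/ext_opposite.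
Qed.

Lemma ext_simplex (z : seq (lagrangian M)) :
  @simplex _ (Fl ME) (map ext_lagr z) <-> @simplex _ (Fl M) z.
Proof.
split=> -[z0 zX]; split.
- by move=> z0'; apply: z0; rewrite z0'.
- move=> X Y Xz Yz; have := zX _ _ (map_f ext_lagr Xz) (map_f ext_lagr Yz).
  by move=> [/ext_lagr_inj|/ext_opposite] ?; [left | right].
- by case: z z0 {zX}.
- move=> _ _ /mapP[X Xz ->] /mapP[Y Yz ->].
  by have [->|XY] := zX X Y Xz Yz; [left | right; exact/ext_opposite].
Qed.

Lemma ext_maslov_fun (s : seq 'U(M)) z :
  maslov_fun (map (unitary_ext phi M) s) (map ext_lagr z) = Witt_ext phi eps (maslov_fun s z).
Proof.
case: s => [|g [|? ?]] /=; rewrite ?raddf0 //.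
case: z => [|X [|Y [|Z [|? ?]]]] /=; rewrite ?raddf0 //.
rewrite (asbool_equiv_eq (ext_simplex [:: X; Y; Z])); case: asboolP => [[_ zX]|_].
  by rewrite ext_maslov //; apply: zX; rewrite !inE eqxx ?orbT.
by rewrite raddf0.
Qed.

End ExtLagrangian.
End Extension.

Theorem theorem6p2 (D E : invSkewFieldType) (phi : invMorph D E) (eps : bool)
    (Deps_infinite : infinite_set [set a : D | a - invo a * (-1) ^+ eps = 0]%classic)
    (M : hermMod D (~~ eps)) (M_hyperbolic : hyperbolic M) :
  H_map (coef_cmap (triv_complex 'U(M)) (Witt_ext phi eps)) (maslov_class M) =
  H_map (res_cmap (Witt E eps) (unitary_ext phi M)) (maslov_class (ext_mod phi M)).
Proof.
have [n [x [y xy]]] := hyperbolic_hyp_frame M_hyperbolic.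
have [Mns MEns] := (hyp_frame_nonsingular xy, hyp_frame_nonsingular (temb_hyp_frame phi xy)).
have [[X _] [XE _]] := (hyp_frame_lagrangian xy, hyp_frame_lagrangian (temb_hyp_frame phi xy)).
have Mopp (X' : lagrangian M) : exists Y, opposite X' Y.
  have [Y YX'] := opposite_to_all [:: X'] Deps_infinite Mns (inhabits X).
  by exists Y; apply/oppositeC/YX'; exact: mem_head.
have [c [cE mD]] := maslov_classP Mns Deps_infinite (inhabits X).
have [cX [cXE mE]] := maslov_classP MEns (herm_infinite phi Deps_infinite) (inhabits XE).
(* It suffices to compare in H^2_U(M) (Fl(M); W(E)), where both sides are computed by cocycles. *)
pose pull := pull_cmap (Phi := unitary_ext phi M) (X := Fl M) (X' := Fl (ext_mod phi M))
  (ext_lagr_act phi Mns Mopp) (ext_simplex phi Mns Mopp) (Witt E eps).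
apply: (H_aug_inj (Fl_cones Mns Deps_infinite (inhabits X))).
rewrite (H_map_comm (f' := aug_cmap (Fl M) _) (g' := coef_cmap (Fl M) (Witt_ext phi eps))).
  rewrite (H_map_comm (f' := aug_cmap (Fl (ext_mod phi M)) _) (g' := pull)).
    rewrite mD mE !H_mapE; congr coh_class; apply: val_inj; apply: cochainP => s z /=.
    by rewrite cE cXE ext_maslov_fun.
  by move=> b; symmetry; exact: pull_aug.
by move=> b; symmetry; exact: coef_aug.
Qed.
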